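(* Let $\{D_i\}_{i=1}^{\infty}$ be a sequence of domains in $\mathbb{C}$ and let $\mu_i\in AW(D_i)$ for each $i$. (I) Suppose $D=\bigcup_i D_i$, $\mu\in AW(D)$, for any $i\in\mathbb{Z}^+$ there exists $j(i)\in\mathbb{Z}^+$ such that $D_i\subset D_k$ and $\mu_i(z)\le\mu_k(z)\le\mu(z)$ for all $k\ge j(i)$ and $z\in D_i$, and $\mu_i\to\mu$ pointwise a.e. on $D$. Then for every $n\ge1$ and every $\xi\in D$, the $n$-th order kernel function $M_{D_i,\mu_i,n}(\cdot,\xi)$ converges locally uniformly on $D$ to $M_{D,\mu,n}(\cdot,\xi)$. (II) Suppose $D=\bigcap_i D_i$ is a domain, $\mu\in AW(D)$ satisfies $\mu(z)\le\mu_i(z)$ for all $i\in\mathbb{Z}^+$ and $z\in D$, $\mu_i\to\mu$ pointwise a.e. on $D$, and for every $t\in D$, $\lim_{i\to\infty}\tilde K_{D_i,\mu_i}(t,t)=\tilde K_{D,\mu}(t,t)$. Then (1) for every $\xi\in D$, the first order kernel function $M_{D_i,\mu_i}(\cdot,\xi)$ converges locally uniformly on $D$ to $M_{D,\mu}(\cdot,\xi)$; (2) for every $n>1$ and every $\xi\in D\setminus N_D(\mu)$, the $n$-th order kernel function $M_{D_i,\mu_i,n}(\cdot,\xi)$ converges locally uniformly on $D$ to $M_{D,\mu,n}(\cdot,\xi)$.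
   Context: For a domain $D\subset\mathbb{C}$, $\mathcal{O}(D)$ is the space of holomorphic functions on $D$ and $dA$ is the area measure. For a positive measurable function $\mu$ on $D$, $L^2_\mu(D)$ is the space of measurable $f$ with $\int_D|f|^2\mu\,dA<\infty$, and $A^2_\mu(D)=L^2_\mu(D)\cap\mathcal{O}(D)$. The weight $\mu$ is admissible, written $\mu\in AW(D)$, if (i) $A^2_\mu(D)$ is a closed subspace of $L^2_\mu(D)$, and (ii) for every $z\in D$ the evaluation functional $A^2_\mu(D)\ni f\mapsto f(z)\in\mathbb{C}$ is continuous. For $\mu\in AW(D)$, $\zeta\in D$ and a positive integer $n$, let $$AD^\mu(D,\zeta^n)=\Big\{f\in\mathcal{O}(D): f(\zeta)=f'(\zeta)=\cdots=f^{(n-1)}(\zeta)=0,\ \int_D|f'(z)|^2\mu(z)\,dA(z)<\infty\Big\},$$ a Hilbert space with inner product $\langle f,g\rangle=\int_D f'\,\overline{g'}\,\mu\,dA$. The functional $f\mapsto f^{(n)}(\zeta)$ is continuous on it, and the $n$-th order kernel function $M_{D,\mu,n}(\cdot,\zeta)\in AD^\mu(D,\zeta^n)$ is the unique function with $f^{(n)}(\zeta)=\langle f,M_{D,\mu,n}(\cdot,\zeta)\rangle$ for all $f\in AD^\mu(D,\zeta^n)$. Put $\tilde K_{D,\mu,n}(z,\zeta)=\frac{\partial}{\partial z}M_{D,\mu,n}(z,\zeta)$. For $n=1$ one writes $M_{D,\mu}=M_{D,\mu,1}$ and $\tilde K_{D,\mu}=\tilde K_{D,\mu,1}$. $N_D(\mu):=\{z\in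 D:\tilde K_{D,\mu}(z,z)=0\}$. Locally uniform convergence means uniform convergence on every compact subset (each compact subset being considered for all sufficiently large $i$, when the functions are defined on it). *)

(* Defs.v *)
From HB Require Import structures.
From mathcomp Require Import all_boot all_order all_algebra.
From mathcomp Require Import all_classical all_reals all_analysis.
From mathcomp Require Import measurable_realfun.
From mathcomp Require Export complex.

Set Implicit Arguments.
Unset Strict Implicit.
Unset Printing Implicit Defensive.

Import Order.TTheory GRing.Theory Num.Theory.
Import numFieldNormedType.Exports.

Local Open Scope classical_set_scope.
Local Open Scope ring_scope.
Local Open Scope complex_scope.

(* R[i] as a normed space over itself: `derivable` and the iterated derivative
   `derive1n` then denote complex differentiability and complex derivatives. *)
HB.instance Definition _ (R : rcfType) := NormedModule.copy R[i] R[i]^o.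

Section plane.
Variable R : realType.
Implicit Types (D : set R[i]) (f g : R[i] -> R[i]) (mu : R[i] -> R).

Definition domain D := [/\ D !=set0, open D & connected D].

Definition holomorphic_on D f := forall z, D z -> derivable f z 1.

Definition toC (p : R * R) : R[i] := p.1 +i* p.2.

Definition area :
    {measure set (measurableTypeR R * measurableTypeR R) -> \bar R} :=
  (@lebesgue_measure R \x @lebesgue_measure R)%E.

(* `area` lives on the Borel sets; `completed_algebra_gen area` consists of the
   Lebesgue measurable sets.  The integral below is taken against `area`
   itself: on a nonnegative Lebesgue measurable integrand, the supremum over
   Borel simple minorants is the Lebesgue integral. *)
Definition lebesgue_measurable_on D (h : R[i] -> R) :=
  forall Y : set (measurableTypeR R), measurable Y ->
    completed_algebra_gen area (toC @^-1` (D `&` h @^-1` Y)).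

Definition ae_on D (P : R[i] -> Prop) :=
  {ae area, forall p, D (toC p) -> P (toC p)}.

Definition weight D mu :=
  lebesgue_measurable_on D mu /\ (forall z, D z -> 0 < mu z).

Definition sqnormL2 D mu f : \bar R :=
  (\int[area]_(p in toC @^-1` D)
     (Normc.normc (f (toC p)) ^+ 2 * mu (toC p))%:E)%E.

Definition normL2 D mu f : \bar R := sqrte (sqnormL2 D mu f).

Definition L2 D mu : set (R[i] -> R[i]) := [set f |
  [/\ lebesgue_measurable_on D (fun z => complex.Re (f z)),
      lebesgue_measurable_on D (fun z => complex.Im (f z)) &
      (sqnormL2 D mu f < +oo)%E]].

Definition A2 D mu : set (R[i] -> R[i]) := L2 D mu `&` holomorphic_on D.

(* Elements of L^2_mu(D) are classes modulo a.e. equality, hence the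
   conclusion up to a null set. *)
Definition A2_closed D mu := forall f, L2 D mu f ->
  (forall e : R, 0 < e ->
     exists2 g, A2 D mu g & (normL2 D mu (f \- g)%R < e%:E)%E) ->
  exists2 g, A2 D mu g & ae_on D (fun z => f z = g z).

Definition evaluation_continuous D mu (z : R[i]) :=
  forall f, A2 D mu f -> forall e : R, 0 < e -> exists2 d : R, 0 < d &
    forall g, A2 D mu g -> (normL2 D mu (g \- f)%R < d%:E)%E ->
      Normc.normc (g z - f z) < e.

Definition admissible D mu :=
  [/\ weight D mu, A2_closed D mu &
      forall z, D z -> evaluation_continuous D mu z].

Definition AD D mu (zeta : R[i]) (n : nat) : set (R[i] -> R[i]) := [set f |
  [/\ holomorphic_on D f,
      (forall k, (k < n)%N -> derive1n k f zeta = 0) &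
      (sqnormL2 D mu (derive1 f) < +oo)%E]].

Definition innerAD D mu f g : R[i] :=
  let h z := derive1 f z * (derive1 g z)^*%C in
  (\int[area]_(p in toC @^-1` D) (complex.Re (h (toC p)) * mu (toC p)))%R +i*
  (\int[area]_(p in toC @^-1` D) (complex.Im (h (toC p)) * mu (toC p)))%R.

Definition is_kernel D mu n zeta (M : R[i] -> R[i]) :=
  AD D mu zeta n M /\
  forall f, AD D mu zeta n f -> derive1n n f zeta = innerAD D mu f M.

(* `kernelM D mu n zeta z` is M_{D,mu,n}(z,zeta).  Functions are total, so the
   kernel is determined only on D; its values elsewhere are irrelevant. *)
Definition kernelM D mu n zeta : R[i] -> R[i] :=
  xget (cst 0) (is_kernel D mu n zeta).

Definition Ktilde D mu n (z zeta : R[i]) : R[i] :=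
  derive1 (kernelM D mu n zeta) z.

Definition Nset D mu : set R[i] := [set z | D z /\ Ktilde D mu 1 z z = 0].

(* The i-th function is meaningful on `Ds i` only, so a compact subset of D
   must be contained in `Ds i` for all large i. *)
Definition cvg_locally_uniformly (Ds : nat -> set R[i]) D
    (F : nat -> R[i] -> R[i]) (G : R[i] -> R[i]) :=
  forall K, compact K -> K `<=` D ->
    (\forall i \near \oo, K `<=` Ds i) /\ {uniform K, F @ \oo --> G}.

End plane.

(* Main.v *)
Require Import Defs.
From HB Require Import structures.
From mathcomp Require Import all_boot all_order all_algebra.
From mathcomp Require Import all_classical all_reals all_analysis.
From mathcomp Require Import measurable_realfun ring lra.
Set Implicit Arguments.
Unset Strict Implicit.
Unset Printing Implicit Defensive.

Import Order.TTheory GRing.Theory Num.Theory.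
Import numFieldNormedType.Exports.
Local Open Scope classical_set_scope.
Local Open Scope ring_scope.
Local Open Scope complex_scope.
Local Notation cabs := (@Normc.normc _).

(* Idea.  For a kernel M of AD^mu(D, xi^n) put lam = M^(n)(xi) = |M|^2.  If
   D1 is contained in D2 and mu1 <= mu2 on D1, restriction is a contraction
   AD(D2) -> AD(D1), and the reproducing property on D1 gives
   |M2 - M1|_{D1}^2 <= lam1 - lam2.  Since point evaluations are bounded locally
   uniformly (uniform boundedness principle, in the space A^2 that admissibility
   makes complete), it suffices to show lam_i -> lam.

   (I) lam_i decreases to some L >= lam and the M_i are Cauchy in every AD(D_k).
   Their limit f has |f|^2 <= L by Fatou and f^(n)(xi) = L, so testing f against
   the kernel of D gives L^2 <= L lam.

   (II) The case n = 1 is the hypothesis.  It says that J_i J_i^* tends to the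
   identity on first order kernels, where J_i : AD(D_i) -> AD(D) is restriction,
   hence on a dense subspace.  So every f in AD(D, xi^1) is approximated in
   AD(D) by elements of AD(D_i, xi^1) of asymptotically no larger norm.  By
   induction on n this persists for functions vanishing to order n at xi, and
   testing the approximants of M against M_i yields liminf lam_i >= lam. *)

(** * The complex plane and complex derivatives *)

(** Admissibility asks for closedness and for the continuity of each evaluation separately; no bound
    on the weight over compact sets is available. Hence the detour through uniform boundedness.
    Passing from values to derivatives of every order takes Cauchy estimates, which rest on
    Goursat's lemma; curve integrals are defined by antiderivatives, so that the mean value
    inequality is the only estimate of them. Weights are Lebesgue measurable while [area] is a Borel
    measure, so integrals are added on a Borel subset of full measure. The real part of the inner
    product suffices: replacing f by -i f recovers the imaginary part. In (II) each D_i is compared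
    with D alone. Up to additive constants J_i^* sends the first order kernel of D at t to that of
    D_i, since both represent w -> w'(t). An approximant of f taken in AD(D_i, xi^1) need not vanish
    to higher order when f does; the induction on n repairs this. *)

Section modulus.
Context {R : realType}.
Implicit Types (z w : R[i]) (x : R).

Lemma normC_cabs z : `|z| = (cabs z)%:C. Proof. by []. Qed.

Lemma cabs_ge0 z : 0 <= cabs z.
Proof. by case: z => a b; rewrite sqrtr_ge0. Qed.

Lemma cabs_real x : cabs x%:C = `|x|.
Proof. by rewrite /= expr0n addr0 sqrtr_sqr. Qed.

Lemma cabs_eq0 z : (cabs z == 0) = (z == 0).
Proof.
apply/eqP/eqP => [/Normc.eq0_normc //|->]; exact: Normc.normc0.
Qed.

Lemma cabs_gt0 z : (0 < cabs z) = (z != 0).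
Proof. by rewrite lt_def cabs_eq0 cabs_ge0 andbT. Qed.

Lemma cabsN z : cabs (- z) = cabs z.
Proof. exact: normcN. Qed.

Lemma cabsBC z w : cabs (z - w) = cabs (w - z).
Proof. by rewrite -cabsN opprB. Qed.

Lemma cabsM z w : cabs (z * w) = cabs z * cabs w.
Proof. exact: Normc.normcM. Qed.

Lemma cabsV z : cabs z^-1 = (cabs z)^-1.
Proof. exact: Normc.normcV. Qed.

Lemma cabsX z n : cabs (z ^+ n) = cabs z ^+ n.
Proof.
elim: n => [|n IH]; first by rewrite !expr0 Normc.normc1.
by rewrite !exprS cabsM IH.
Qed.

Lemma cabsD z w : cabs (z + w) <= cabs z + cabs w.
Proof. exact: le_normcD. Qed.

Lemma cabsB z w : cabs (z - w) <= cabs z + cabs w.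
Proof. by rewrite -(cabsN w) cabsD. Qed.

Lemma cabs_tri z w u : cabs (z - u) <= cabs (z - w) + cabs (w - u).
Proof. by apply: le_trans (cabsD _ _); rewrite addrA subrK. Qed.

Lemma cabs_sqr z : cabs z ^+ 2 = complex.Re z ^+ 2 + complex.Im z ^+ 2.
Proof. by case: z => a b /=; rewrite sqr_sqrtr // addr_ge0 ?sqr_ge0. Qed.

Lemma Re_le_cabs z : `|complex.Re z| <= cabs z.
Proof.
by case: z => a b /=; rewrite -sqrtr_sqr ler_sqrt ?addr_ge0 ?sqr_ge0 // lerDl sqr_ge0.
Qed.

Lemma Im_le_cabs z : `|complex.Im z| <= cabs z.
Proof.
by case: z => a b /=; rewrite -sqrtr_sqr ler_sqrt ?addr_ge0 ?sqr_ge0 // lerDr sqr_ge0.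
Qed.

Lemma cabs_le_ReIm z : cabs z <= `|complex.Re z| + `|complex.Im z|.
Proof.
rewrite -(@ler_pXn2r _ 2) ?nnegrE ?cabs_ge0 ?addr_ge0 // cabs_sqr sqrrD.
by rewrite !real_normK ?num_real // lerD2r lerDl mulrn_wge0 // mulr_ge0.
Qed.

(** The order of [R[i]] compares only numbers with equal imaginary parts, so every epsilon of its
    norm topology is real. *)
Lemma gt0_complexE (e : R[i]) : 0 < e -> exists2 r : R, 0 < r & e = r%:C.
Proof.
case: e => a b; rewrite ltcE /= => /andP[/eqP -> a0]; by exists a.
Qed.

Lemma near_cabsP z (P : R[i] -> Prop) :
  (\forall w \near z, P w) <->
  exists2 d : R, 0 < d & forall w, cabs (w - z) < d -> P w.
Proof.
split.
  move=> /nbhs_ballP[e /= e0 zP].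
  have [r r0 er] := gt0_complexE e0; exists r => // w wz; apply: zP.
  by rewrite -ball_normE /= distrC normC_cabs er ltcR.
move=> [d d0 dP]; apply/nbhs_ballP; exists d%:C => /=.
  by rewrite ltcR.
by move=> w; rewrite -ball_normE /= distrC normC_cabs ltcR => /dP.
Qed.

Lemma open_cabsP (D : set R[i]) : open D <->
  forall z, D z -> exists2 d : R, 0 < d & forall w, cabs (w - z) < d -> D w.
Proof.
rewrite openE; split=> H z Dz; first by apply/near_cabsP; exact: H.
by apply/near_cabsP; exact: H.
Qed.

End modulus.

(** * Complex differentiability by first order expansion *)

Section complex_derivative.
Context {R : realType}.
Implicit Types (f g : R[i] -> R[i]) (z w d : R[i]).

Lemma scalecE (a b : R[i]) : a *: b = a * b. Proof. by []. Qed.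

(** Without a quotient the point w = z needs no exclusion, and sums, composites and changes of
    domain become epsilon arithmetic. *)
Definition cderiv f z d := forall e : R, 0 < e -> exists2 r : R, 0 < r &
  forall w, cabs (w - z) < r -> cabs (f w - f z - d * (w - z)) <= e * cabs (w - z).

Lemma cderivP f z d :
  cderiv f z d <-> (h^-1 *: (f (h + z) - f z) @[h --> 0^'] --> d).
Proof.
split=> H.
  apply/cvgrPdist_le => _ /gt0_complexE[e re0 ->].
  have [r r0 rH] := H _ re0.
  apply/near_cabsP; exists r => // h; rewrite subr0 => hr /= h0.
  have := rH (h + z); rewrite addrK => /(_ hr) hh.
  rewrite normC_cabs lecR -(@ler_pM2r _ (cabs h)) ?cabs_gt0 // -cabsM.
  rewrite -cabsN (_ : - _ = f (h + z) - f z - d * h) //.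
  by rewrite scalecE; field.
move=> e e0.
have ee0 : 0 < e%:C by rewrite ltcR.
have /cvgrPdist_le/(_ _ ee0)/near_cabsP[r r0 rH] := H.
exists r => // w wz; have [->|wz0] := eqVneq w z.
  by rewrite !subrr mulr0 subrr Normc.normc0 mulr0.
have h0 : w - z != 0 by rewrite subr_eq0.
have := rH (w - z); rewrite subr0 => /(_ wz h0).
rewrite normC_cabs lecR subrK -(@ler_pM2r _ (cabs (w - z))) ?cabs_gt0 // -cabsM.
by rewrite -cabsN scalecE; congr (cabs _ <= _); field.
Qed.

Lemma cderiv_derivable f z d : cderiv f z d -> derivable f z 1.
Proof.
move=> /cderivP H; apply/cvg_ex; exists d.
suff -> : (fun h : R[i] => h^-1 *: (f (h *: 1 + z) - f z)) =
          (fun h => h^-1 *: (f (h + z) - f z)) by [].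
by apply/funext => h; congr (_ *: (f (_ + _) - _)); exact: mulr1.
Qed.

Lemma cderiv_derive1 f z d : cderiv f z d -> derive1 f z = d.
Proof. by move=> /cderivP H; rewrite /derive1; apply/cvg_lim. Qed.

Lemma derivable_cderiv f z : derivable f z 1 -> cderiv f z (derive1 f z).
Proof.
move=> H; apply/cderivP; rewrite derive1E /derive.
have <- : (fun h : R[i] => h^-1 *: (f (h *: 1 + z) - f z)) =
          (fun h => h^-1 *: (f (h + z) - f z)).
  by apply/funext => h; congr (_ *: (f (_ + _) - _)); exact: mulr1.
exact: H.
Qed.

Lemma cderiv_cst c z : cderiv (fun=> c) z 0.
Proof.
move=> e e0; exists 1 => // w _.
by rewrite subrr mul0r subrr Normc.normc0 mulr_ge0 ?cabs_ge0 ?(ltW e0).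
Qed.

Lemma cderiv_id z : cderiv (fun w => w) z 1.
Proof.
move=> e e0; exists 1 => // w _.
by rewrite mul1r subrr Normc.normc0 mulr_ge0 ?cabs_ge0 ?(ltW e0).
Qed.

Lemma cderivD f g z d d' :
  cderiv f z d -> cderiv g z d' -> cderiv (fun w => f w + g w) z (d + d').
Proof.
move=> fd gd e e0; have e2 : 0 < e / 2 by rewrite divr_gt0.
have [r r0 rH] := fd _ e2; have [s s0 sH] := gd _ e2.
exists (Num.min r s); first by rewrite lt_min r0.
move=> w; rewrite lt_min => /andP[wr ws].
rewrite (_ : _ - _ = (f w - f z - d * (w - z)) + (g w - g z - d' * (w - z))); last by ring.
apply: (le_trans (cabsD _ _)).
apply: (le_trans (lerD (rH _ wr) (sH _ ws))).
by rewrite -mulrDl -splitr.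
Qed.

Lemma cderiv_ext (U : set R[i]) f g z d : open U -> U z -> (forall w, U w -> f w = g w) ->
  cderiv f z d -> cderiv g z d.
Proof.
move=> oU Uz fg fd e e0; have [r r0 rH] := fd _ e0.
have /open_cabsP/(_ _ Uz)[s s0 sH] := oU.
exists (Num.min r s); first by rewrite lt_min r0.
move=> w; rewrite lt_min => /andP[wr ws].
by rewrite -!fg //; [exact: rH|exact: sH].
Qed.

Lemma cderivZ c f z d : cderiv f z d -> cderiv (fun w => c * f w) z (c * d).
Proof.
move=> fd e e0.
have c1 : 0 < cabs c + 1 by rewrite ltr_wpDl ?cabs_ge0.
have [r r0 rH] := fd _ (divr_gt0 e0 c1).
exists r => // w wr.
rewrite (_ : _ - _ = c * (f w - f z - d * (w - z))); last by ring.
rewrite cabsM; apply: (le_trans (ler_wpM2l (cabs_ge0 _) (rH _ wr))).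
rewrite mulrA ler_wpM2r ?cabs_ge0 // mulrCA ler_piMr ?(ltW e0) //.
by rewrite ler_pdivrMr // mul1r lerDl.
Qed.

Lemma cderivN f z d : cderiv f z d -> cderiv (fun w => - f w) z (- d).
Proof.
move=> /(cderivZ (-1)); rewrite mulN1r.
by under eq_fun do rewrite mulN1r.
Qed.

Lemma cderivB f g z d d' :
  cderiv f z d -> cderiv g z d' -> cderiv (fun w => f w - g w) z (d - d').
Proof. by move=> fd /cderivN gd; exact: cderivD. Qed.

Lemma cderiv_continuous f z d : cderiv f z d -> forall e : R, 0 < e ->
  exists2 r : R, 0 < r & forall w, cabs (w - z) < r -> cabs (f w - f z) < e.
Proof.
move=> fd e e0; have [r r0 rH] := fd _ ltr01.
have c1 : 0 < cabs d + 1 by rewrite ltr_wpDl ?cabs_ge0.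
exists (Num.min r (e / (cabs d + 1))); first by rewrite lt_min r0 divr_gt0.
move=> w; rewrite lt_min => /andP[wr]; rewrite ltr_pdivlMr // => we.
apply: le_lt_trans we.
rewrite -(subrK (d * (w - z)) (f w - f z)); apply: (le_trans (cabsD _ _)).
by have := rH _ wr; rewrite cabsM; lra.
Qed.

Lemma cderiv_shift_cvg f z d : cderiv f z d -> f (h + z) @[h --> 0^'] --> f z.
Proof.
move=> fd; apply/cvgrPdist_lt => _ /gt0_complexE[e e0 ->].
have [r r0 rH] := cderiv_continuous fd e0.
apply/near_cabsP; exists r => // h; rewrite subr0 => hr /= h0.
by rewrite distrC normC_cabs ltcR; apply: rH; rewrite addrK.
Qed.

Lemma cderivM f g z d d' : cderiv f z d -> cderiv g z d' ->
  cderiv (fun w => f w * g w) z (d * g z + f z * d').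
Proof.
move=> /cderivP fd /cderivP gd.
have ch := cderiv_shift_cvg ((cderivP _ _ _).2 fd).
apply/cderivP.
have := cvgD (cvgM fd (cvg_cst (g z))) (cvgM ch gd).
do 4?move/(_ _); move=> lim_eq; apply: (cvg_trans _ lim_eq); apply: near_eq_cvg; near=> h.
rewrite ?fctE /= ?scalecE; field.
by near: h; exact: nbhs_dnbhs_neq.
Unshelve. all: by end_near. Qed.

Lemma cderivV f z d : cderiv f z d -> f z != 0 ->
  cderiv (fun w => (f w)^-1) z (- d / f z ^+ 2).
Proof.
move=> fd fz0.
have ca : 0 < cabs (f z) by rewrite cabs_gt0.
have [s s0 sH] := cderiv_continuous fd (divr_gt0 ca (ltr0n _ 2)).
have ch := cderiv_shift_cvg fd.
have ci : (fun h : R[i] => (f (h + z))^-1) @ 0^' --> (f z)^-1 by exact: cvgV.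
move/cderivP: fd => fd; apply/cderivP.
have := cvgM (cvgN fd) (cvgM ci (cvg_cst ((f z)^-1))).
rewrite (_ : - d * _ = - d / f z ^+ 2); last by rewrite -invfM -expr2.
do 4?move/(_ _); move=> lim_eq; apply: (cvg_trans _ lim_eq); apply: near_eq_cvg; near=> h.
have fh0 : f (h + z) != 0.
  rewrite -cabs_gt0.
  have : cabs (f (h + z) - f z) < cabs (f z) / 2.
    by near: h; apply/nbhs_dnbhs/near_cabsP; exists s => // h; rewrite subr0 => hs; apply: sH; rewrite addrK.
  by have := cabs_tri (f z) (f (h + z)) 0; rewrite !subr0 cabsBC; lra.
have h0 : h != 0 by near: h; exact: nbhs_dnbhs_neq.
rewrite ?fctE /= ?scalecE; field.
by rewrite h0 fz0 fh0.
Unshelve. all: by end_near. Qed.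

End complex_derivative.

(** * Integrals along curves, via antiderivatives *)

Section curves.
Context {R : realType}.
Implicit Types (P Q : R -> R[i]) (t s : R).

(** The counterpart of [cderiv] for a curve with real parameter; [rderiv_comp] is the chain rule
    between the two. *)
Definition rderiv P t (v : R[i]) := forall e : R, 0 < e -> exists2 r : R, 0 < r &
  forall s, `|s - t| < r -> cabs (P s - P t - v * (s - t)%:C) <= e * `|s - t|.

Lemma real_is_deriveP (f : R -> R) t d : is_derive t 1 f d <->
  (forall e : R, 0 < e -> exists2 r : R, 0 < r &
     forall s, `|s - t| < r -> `|f s - f t - d * (s - t)| <= e * `|s - t|).
Proof.
have E : (fun h : R => h^-1 *: (f (h *: 1 + t) - f t)) =
         (fun h => h^-1 * (f (h + t) - f t)).
  by apply/funext => h; congr (_ * (f (_ + _) - _)); exact: mulr1.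
split=> H.
  have {H} : h^-1 * (f (h + t) - f t) @[h --> 0^'] --> d.
    case: H => dv <-; rewrite -E; exact: dv.
  move=> /cvgrPdist_le H e e0.
  have /nbhs_ballP[r /= r0 rH] := H _ e0.
  exists r => // s sr; have [->|s0] := eqVneq s t.
    by rewrite !subrr mulr0 subrr normr0 mulr0.
  have h0 : s - t != 0 by rewrite subr_eq0.
  have := rH (s - t); rewrite /= -ball_normE /= sub0r normrN => /(_ sr h0).
  rewrite subrK -(@ler_pM2r _ (`|s - t|)) ?normr_gt0 // -normrM.
  by rewrite -normrN; congr (Num.norm _ <= _); field.
have {}H : h^-1 * (f (h + t) - f t) @[h --> 0^'] --> d.
  apply/cvgrPdist_le => e e0; have [r r0 rH] := H _ e0.
  apply/nbhs_ballP; exists r => // h; rewrite /= -ball_normE /= sub0r normrN => hr /= h0.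
  have := rH (h + t); rewrite addrK => /(_ hr) H1.
  rewrite -(@ler_pM2r _ (`|h|)) ?normr_gt0 // -normrM.
  rewrite (_ : _ * h = - (f (h + t) - f t - d * h)) ?normrN //; field.
  by [].
apply: DeriveDef; first by apply/cvg_ex; exists d; rewrite E.
by apply/cvg_lim => //; rewrite -E in H.
Qed.

Lemma rderiv_ReM (u : R[i]) P t v : rderiv P t v ->
  is_derive t 1 (fun s => complex.Re (u * P s)) (complex.Re (u * v)).
Proof.
move=> Pv; apply/real_is_deriveP => e e0.
have c1 : 0 < cabs u + 1 by rewrite ltr_wpDl ?cabs_ge0.
have [r r0 rH] := Pv _ (divr_gt0 e0 c1); exists r => // s sr.
have -> : complex.Re (u * P s) - complex.Re (u * P t) - complex.Re (u * v) * (s - t) =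
    complex.Re (u * (P s - P t - v * (s - t)%:C)).
  by case: (u) (P s) (P t) (v) => [a b] [c d] [x y] [z w] /=; ring.
apply: (le_trans (Re_le_cabs _)); rewrite cabsM.
apply: (le_trans (ler_wpM2l (cabs_ge0 _) (rH _ sr))).
rewrite mulrA ler_wpM2r // mulrCA ler_piMr ?(ltW e0) //.
by rewrite ler_pdivrMr // mul1r lerDl.
Qed.

(** Multiplication by the unimodular u that turns P 1 - P 0 into its modulus reduces the claim to
    the real mean value theorem for Re (u P). *)
Lemma mean_value01 P v (M : R) :
  (forall t, 0 <= t <= 1 -> rderiv P t (v t)) ->
  (forall t, 0 <= t <= 1 -> cabs (v t) <= M) -> cabs (P 1 - P 0) <= M.
Proof.
move=> Pv vM; have [/eqP|] := eqVneq (P 1 - P 0) 0.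
  move=> /eqP ->; rewrite Normc.normc0.
  by apply: le_trans (cabs_ge0 _) (vM 0 _); rewrite lexx ler01.
move=> d0; set d := P 1 - P 0 in d0 *.
have cd0 : 0 < cabs d by rewrite cabs_gt0.
pose u : R[i] := (d^*)%C / (cabs d)%:C.
have u1 : cabs u = 1.
  rewrite /u cabsM cabsV cabs_real (ger0_norm (cabs_ge0 _)).
  have -> : cabs (d^*)%C = cabs d by case: (d) => a b /=; rewrite sqrrN.
  by rewrite divff // gt_eqF.
have ud : u * d = (cabs d)%:C.
  have : (d^*)%C * d = (cabs d ^+ 2)%:C.
    by rewrite cabs_sqr; case: (d) => a b; apply/eqP; rewrite eq_complex /=; apply/andP; split; apply/eqP; ring.
  rewrite rmorphXn.
  move=> E; rewrite /u mulrAC E; field.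
  by apply/eqP => -[] /eqP; rewrite gt_eqF.
have d01 t : t \in `]0, 1[ -> is_derive t 1 (fun s => complex.Re (u * P s)) (complex.Re (u * v t)).
  by rewrite in_itv /= => /andP[t0 t1]; apply/rderiv_ReM/Pv; rewrite !ltW.
have cont : {within `[0, 1], continuous (fun s => complex.Re (u * P s))}.
  apply: derivable_within_continuous => t; rewrite in_itv /= => t01.
  exact: (@ex_derive _ _ _ _ _ _ _ (rderiv_ReM u (Pv _ t01))).
have [c] := MVT ltr01 d01 cont.
rewrite in_itv /= subr0 mulr1 => /andP[c0 c1] H.
have : cabs d = complex.Re (u * v c).
  rewrite -H -[LHS]/(complex.Re (cabs d)%:C) -ud /d.
  by case: (u) (P 1) (P 0) => [a b] [c' d'] [x y] /=; ring.
move=> ->; apply: (le_trans (ler_norm _)); apply: (le_trans (Re_le_cabs _)).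
by rewrite cabsM u1 mul1r; apply: vM; rewrite !ltW.
Qed.

Lemma rderiv_cst c t : rderiv (fun=> c) t 0.
Proof.
move=> e e0; exists 1 => // s _.
by rewrite mul0r subr0 subrr Normc.normc0 mulr_ge0 // ltW.
Qed.

Lemma rderivD P Q t v w : rderiv P t v -> rderiv Q t w ->
  rderiv (fun s => P s + Q s) t (v + w).
Proof.
move=> Pv Qw e e0; have e2 : 0 < e / 2 by rewrite divr_gt0.
have [r r0 rH] := Pv _ e2; have [q q0 qH] := Qw _ e2.
exists (Num.min r q); first by rewrite lt_min r0.
move=> s; rewrite lt_min => /andP[wr ws].
rewrite (_ : _ - _ = (P s - P t - v * (s - t)%:C) + (Q s - Q t - w * (s - t)%:C)); last by ring.
apply: (le_trans (cabsD _ _)).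
apply: (le_trans (lerD (rH _ wr) (qH _ ws))).
by rewrite -mulrDl -splitr.
Qed.

Lemma rderivZ c P t v : rderiv P t v -> rderiv (fun s => c * P s) t (c * v).
Proof.
move=> Pv e e0.
have c1 : 0 < cabs c + 1 by rewrite ltr_wpDl ?cabs_ge0.
have [r r0 rH] := Pv _ (divr_gt0 e0 c1).
exists r => // s wr.
rewrite (_ : _ - _ = c * (P s - P t - v * (s - t)%:C)); last by ring.
rewrite cabsM; apply: (le_trans (ler_wpM2l (cabs_ge0 _) (rH _ wr))).
rewrite mulrA ler_wpM2r // mulrCA ler_piMr ?(ltW e0) //.
by rewrite ler_pdivrMr // mul1r lerDl.
Qed.

Lemma rderivB P Q t v w : rderiv P t v -> rderiv Q t w ->
  rderiv (fun s => P s - Q s) t (v - w).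
Proof.
move=> Pv /(rderivZ (-1)) Qw.
have := rderivD Pv Qw; rewrite mulN1r.
by under eq_fun do rewrite mulN1r.
Qed.

Lemma rderiv_affine a b t : rderiv (fun s => a + s%:C * b) t b.
Proof.
move=> e e0; exists 1 => // s _.
rewrite (_ : _ - _ = 0); last by rewrite rmorphB; ring.
by rewrite Normc.normc0 mulr_ge0 // ltW.
Qed.

Lemma rderiv_reparam P (p q : R) t v : rderiv P (p * t + q) v ->
  rderiv (fun s => P (p * s + q)) t (v * p%:C).
Proof.
move=> Pv e e0.
have p1 : 0 < `|p| + 1 by rewrite ltr_wpDl.
have [r r0 rH] := Pv _ (divr_gt0 e0 p1).
exists (r / (`|p| + 1)); first by rewrite divr_gt0.
move=> s; rewrite ltr_pdivlMr // => sr.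
have E : p * s + q - (p * t + q) = p * (s - t) by ring.
have sr' : `|p * s + q - (p * t + q)| < r.
  by apply: le_lt_trans sr; rewrite E normrM mulrC ler_wpM2l // lerDl.
have := rH _ sr'; rewrite E normrM rmorphM mulrA => H; apply: (le_trans H).
rewrite mulrA ler_wpM2r // mulrAC -mulrA ler_piMr ?(ltW e0) //.
by rewrite ler_pdivrMr // mul1r lerDl.
Qed.

Lemma rderiv_comp (f : R[i] -> R[i]) P t v d :
  cderiv f (P t) d -> rderiv P t v -> rderiv (fun s => f (P s)) t (d * v).
Proof.
move=> fd Pv e e0.
have cv : 0 < cabs v + 1 by rewrite ltr_wpDl ?cabs_ge0.
have cd : 0 < cabs d + 1 by rewrite ltr_wpDl ?cabs_ge0.
have e2 : 0 < e / 2 by rewrite divr_gt0.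
have [r r0 rH] := fd _ (divr_gt0 e2 cv).
have [q q0 qH] := Pv _ ltr01.
have [q' q'0 q'H] := Pv _ (divr_gt0 e2 cd).
have lip s : `|s - t| < q -> cabs (P s - P t) <= (cabs v + 1) * `|s - t|.
  move=> sq; rewrite -(subrK (v * (s - t)%:C) (P s - P t)).
  apply: (le_trans (cabsD _ _)); rewrite cabsM cabs_real.
  by have := qH _ sq; lra.
exists (Num.min (Num.min q q') (r / (cabs v + 1))).
  by rewrite !lt_min q0 q'0 divr_gt0.
move=> s; rewrite !lt_min ltr_pdivlMr // => /andP[/andP[sq sq'] sr].
have sP := lip _ sq.
have Pr : cabs (P s - P t) < r by apply: le_lt_trans sP _; rewrite mulrC.
rewrite (_ : _ - _ = (f (P s) - f (P t) - d * (P s - P t)) +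
   d * (P s - P t - v * (s - t)%:C)); last by ring.
apply: (le_trans (cabsD _ _)); rewrite cabsM.
have H1 : cabs (f (P s) - f (P t) - d * (P s - P t)) <= e / 2 * `|s - t|.
  apply: (le_trans (rH _ Pr)).
  apply: (le_trans (ler_wpM2l _ sP)); first by rewrite ltW // divr_gt0.
  by rewrite mulrA divfK // gt_eqF.
have H2 : cabs d * cabs (P s - P t - v * (s - t)%:C) <= e / 2 * `|s - t|.
  apply: (@le_trans _ _ ((cabs d + 1) * (e / 2 / (cabs d + 1) * `|s - t|))).
    by apply: ler_pM; rewrite ?cabs_ge0 ?lerDl ?q'H.
  by rewrite mulrA [_ * (_ / _)]mulrC divfK // gt_eqF.
by lra.
Qed.

Definition cont01 P := forall t, 0 <= t <= 1 -> forall e : R, 0 < e ->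
  exists2 r : R, 0 < r & forall s, 0 <= s <= 1 -> `|s - t| < r -> cabs (P s - P t) < e.

Lemma rderiv_cont P t v : rderiv P t v -> forall e : R, 0 < e ->
  exists2 r : R, 0 < r & forall s, `|s - t| < r -> cabs (P s - P t) < e.
Proof.
move=> Pv e e0; have [r r0 rH] := Pv _ ltr01.
have c1 : 0 < cabs v + 1 by rewrite ltr_wpDl ?cabs_ge0.
exists (Num.min r (e / (cabs v + 1))); first by rewrite lt_min r0 divr_gt0.
move=> s; rewrite lt_min => /andP[sr]; rewrite ltr_pdivlMr // => se.
apply: le_lt_trans se.
rewrite -(subrK (v * (s - t)%:C) (P s - P t)); apply: (le_trans (cabsD _ _)).
by have := rH _ sr; rewrite cabsM cabs_real; lra.
Qed.

(* [c] is the integral of [P] over [0, 1]. *)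
Definition has_int01 P c := exists2 Q, (forall t, 0 <= t <= 1 -> rderiv Q t (P t)) & c = Q 1 - Q 0.

Lemma has_int01_bound P c (M : R) : has_int01 P c ->
  (forall t, 0 <= t <= 1 -> cabs (P t) <= M) -> cabs c <= M.
Proof. by move=> [Q QP ->]; exact: mean_value01. Qed.

Lemma has_int01_eq P P' c : (forall t, 0 <= t <= 1 -> P t = P' t) ->
  has_int01 P c -> has_int01 P' c.
Proof.
by move=> PP' [Q QP ->]; exists Q => // t t01; rewrite -PP' //; exact: QP.
Qed.

Lemma has_int01D P P' c c' : has_int01 P c -> has_int01 P' c' ->
  has_int01 (fun t => P t + P' t) (c + c').
Proof.
move=> [Q QP ->] [Q' QP' ->]; exists (fun t => Q t + Q' t); last by ring.
by move=> t t01; apply: rderivD; [exact: QP|exact: QP'].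
Qed.

Lemma has_int01Z a P c : has_int01 P c -> has_int01 (fun t => a * P t) (a * c).
Proof.
move=> [Q QP ->]; exists (fun t => a * Q t); last by ring.
by move=> t t01; apply: rderivZ; exact: QP.
Qed.

Lemma has_int01B P P' c c' : has_int01 P c -> has_int01 P' c' ->
  has_int01 (fun t => P t - P' t) (c - c').
Proof.
move=> [Q QP ->] [Q' QP' ->]; exists (fun t => Q t - Q' t); last by ring.
by move=> t t01; apply: rderivB; [exact: QP|exact: QP'].
Qed.

Lemma has_int01_unique P c c' : has_int01 P c -> has_int01 P c' -> c = c'.
Proof.
move=> H H'; have := has_int01B H H' => /has_int01_bound.
move=> /(_ 0) B; apply/eqP; rewrite -subr_eq0 -cabs_eq0 eq_le cabs_ge0 andbT.
by apply: B => t _; rewrite subrr Normc.normc0.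
Qed.

(** Continuity of a curve is assumed on [0, 1] only; composing with this 1-Lipschitz retraction
    makes it continuous on the whole line, where the fundamental theorem of calculus applies. *)
Let clamp (x : R) := Num.min 1 (Num.max 0 x).

Let clamp01 x : 0 <= clamp x <= 1.
Proof. by rewrite /clamp; apply/andP; split; rewrite ?le_min ?ge_min ?le_max ?ler01 ?lexx. Qed.

Let clamp_id x : 0 <= x <= 1 -> clamp x = x.
Proof. by move=> /andP[x0 x1]; rewrite /clamp max_r // min_r. Qed.

Let clamp_lip x y : `|clamp x - clamp y| <= `|x - y|.
Proof.
have c0 z : z <= 0 -> clamp z = 0 by move=> z0; rewrite /clamp max_l // min_r.
have c1 z : 1 <= z -> clamp z = 1.
  by move=> z1; rewrite /clamp max_r ?min_l // (le_trans ler01).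
move: (ler_norm (x - y)) (ler_norm (y - x)); rewrite (distrC y) => n1 n2.
have {c0 c1} c z : [\/ z <= 0 /\ clamp z = 0, 1 <= z /\ clamp z = 1 | 0 <= z <= 1 /\ clamp z = z].
  have [z0|z0] := leP z 0; first by constructor 1; rewrite c0.
  have [z1|z1] := leP 1 z; first by constructor 2; rewrite c1.
  by constructor 3; rewrite clamp_id !ltW.
by rewrite ler_norml; case: (c x) => -[hx ->]; case: (c y) => -[hy ->];
  apply/andP; split; lra.
Qed.

(** Integration starts at -1 and integrability is taken up to 2, so that 0 and 1 are interior points
    and the derivative there is two-sided. *)
Let antiderivative (f : R -> R) : continuous f ->
  exists F : R -> R, forall x : R, 0 <= x <= 1 -> is_derive x (1 : R) F (f x).
Proof.
move=> cf; exists (fun x => \int[lebesgue_measure]_(t in `[-1, x]) f t)%R => x /andP[x0 x1].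
have itg : (@lebesgue_measure R).-integrable `[-1, 2] (EFin \o f).
  apply: continuous_compact_integrable; first exact: segment_compact.
  exact: continuous_subspaceT.
have x2 : x < 2 by lra.
have mx : -1 < x by lra.
have [d e] := @continuous_FTC1_closed R f (-1) x 2 x2 itg mx (cf x).
exact: (DeriveDef d (etrans (esym (derive1E _ _)) e)).
Qed.

Let clamp_cont P (h : R[i] -> R) : cont01 P ->
  (forall z w, `|h z - h w| <= cabs (z - w)) -> continuous (fun x => h (P (clamp x))).
Proof.
move=> cP hl x; apply/cvgrPdist_lt => e e0.
have [r r0 rH] := cP _ (clamp01 x) _ e0.
apply/nbhs_ballP; exists r => // y; rewrite /= -?ball_normE /= => xy.
apply: le_lt_trans (hl _ _) _; rewrite cabsBC; apply: rH => //.
by apply: le_lt_trans (clamp_lip _ _) _; rewrite distrC.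
Qed.

Lemma cont01_bounded P : cont01 P ->
  exists2 B : R, 0 < B & forall t, 0 <= t <= 1 -> cabs (P t) <= B.
Proof.
move=> cP; have cc : continuous (fun x => cabs (P (clamp x))).
  apply: clamp_cont => // z w; rewrite ler_norml.
  by have := cabs_tri z w 0; have := cabs_tri w z 0; rewrite !subr0 (cabsBC w); lra.
have [c _ H] := @EVT_max R _ 0 1 ler01 (continuous_subspaceT cc).
exists (cabs (P (clamp c)) + 1); first by rewrite ltr_wpDl ?cabs_ge0.
move=> t t01; apply: (@le_trans _ _ (cabs (P (clamp c)))); last by rewrite lerDl.
by have := H t; rewrite in_itv /= t01 (clamp_id t01); apply.
Qed.

Lemma has_int01_cont P : cont01 P -> exists c, has_int01 P c.
Proof.
move=> cP.
have cc := clamp_cont cP.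
have [|F HF] := antiderivative (cc (@complex.Re R) _).
  by move=> [a b] [c d]; exact: (Re_le_cabs ((a +i* b) - (c +i* d))).
have [|G HG] := antiderivative (cc (@complex.Im R) _).
  by move=> [a b] [c d]; exact: (Im_le_cabs ((a +i* b) - (c +i* d))).
pose Q x := F x +i* G x; exists (Q 1 - Q 0), Q => // t t01 e e0.
have e2 : 0 < e / 2 by rewrite divr_gt0.
have [r r0 rH] := (real_is_deriveP _ _ _).1 (HF _ t01) _ e2.
have [q q0 qH] := (real_is_deriveP _ _ _).1 (HG _ t01) _ e2.
exists (Num.min r q); first by rewrite lt_min r0.
move=> s; rewrite lt_min => /andP[sr sq].
apply: (le_trans (cabs_le_ReIm _)).
have := lerD (rH _ sr) (qH _ sq); rewrite -mulrDl -splitr; apply: le_trans.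
rewrite !clamp_id // /Q; case: (P t) => a b /=.
by apply: lerD; rewrite le_eqVlt; apply/orP; left; apply/eqP; congr Num.norm; ring.
Qed.

End curves.

(** * Cauchy sequences of complex numbers *)

Section limits.
Context {R : realType}.
Implicit Types (u : nat -> R[i]).

Lemma complex_cauchy_cvg u :
  (forall e : R, 0 < e -> exists N, forall m n, (N <= m)%N -> (N <= n)%N -> cabs (u m - u n) <= e) ->
  exists l, forall e : R, 0 < e -> exists N, forall n, (N <= n)%N -> cabs (u n - l) <= e.
Proof.
move=> cu.
have lim (h : R[i] -> R) : (forall z w, `|h z - h w| <= cabs (z - w)) ->
    exists l : R, forall e, 0 < e -> exists N, forall n, (N <= n)%N -> `|h (u n) - l| <= e.
  move=> hl; have : cvg ((h \o u) @ \oo).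
    apply/cauchy_cvgP/cauchy_exP => e e0; have e2 : 0 < e / 2 by rewrite divr_gt0.
    have [N NH] := cu _ e2; exists (h (u N)); exists N => // n /= Nn.
    rewrite -ball_normE /=; apply: le_lt_trans (hl _ _) _.
    by apply: le_lt_trans (NH _ _ (leqnn N) Nn) _; rewrite ltr_pdivrMr // ltr_pMr // ltr1n.
  move=> /cvg_ex[l] /cvgrPdist_le hul; exists l => e e0.
  by have [N _ NH] := hul _ e0; exists N => n Nn; rewrite distrC; exact: NH.
have [|a aH] := lim (@complex.Re R).
  by move=> [a b] [c d]; exact: (Re_le_cabs ((a +i* b) - (c +i* d))).
have [|b bH] := lim (@complex.Im R).
  by move=> [a' b'] [c d]; exact: (Im_le_cabs ((a' +i* b') - (c +i* d))).
exists (a +i* b) => e e0; have e2 : 0 < e / 2 by rewrite divr_gt0.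
have [N NH] := aH _ e2; have [M MH] := bH _ e2.
exists (maxn N M) => n; rewrite geq_max => /andP[Nn Mn].
apply: (le_trans (cabs_le_ReIm _)).
have := lerD (NH _ Nn) (MH _ Mn); rewrite -splitr.
by case: (u n).
Qed.

(** The explicit rate matters: Goursat's lemma needs the n-th triangle to lie within a fixed
    multiple of 1 / 2 ^+ n of the limit point. *)
Lemma geometric_limit u (C : R) : 0 <= C ->
  (forall n, cabs (u n.+1 - u n) <= C / 2 ^+ n) ->
  exists l, forall n, cabs (u n - l) <= 2 * C / 2 ^+ n.
Proof.
move=> C0 uC.
have p2 n : 0 < 2 ^+ n :> R by rewrite exprn_gt0.
(* The right-hand side is the exact partial sum of the geometric series, which makes the induction
   on k close. *)
have step n k : cabs (u (n + k)%N - u n) <= 2 * C / 2 ^+ n - C / 2 ^+ n * (2 / 2 ^+ k).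
  elim: k => [|k IH]; last first.
    rewrite addnS; apply: (le_trans (cabs_tri _ (u (n + k)%N) _)).
    apply: (le_trans (lerD (uC _) IH)).
    rewrite exprD exprS le_eqVlt; apply/orP; left; apply/eqP; field.
    by rewrite !gt_eqF.
  rewrite addn0 subrr Normc.normc0 expr0 divr1 [_ * 2]mulrC mulrA subrr //.
have step' n k : cabs (u (n + k)%N - u n) <= 2 * C / 2 ^+ n.
  apply: (le_trans (step n k)); rewrite gerBl mulr_ge0 ?divr_ge0 //; exact: ltW.
have [|l lH] := @complex_cauchy_cvg u.
  move=> e e0; have [N NH] : exists N : nat, 4 * C / 2 ^+ N <= e.
    exists (Num.Def.archi_bound (4 * C / e)); rewrite ler_pdivrMr // -ler_pdivrMl // mulrC.
    exact/ltW/upper_nthrootP.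
  exists N => m n Nm Nn; apply: le_trans NH.
  apply: (le_trans (cabs_tri _ (u N) _)); rewrite [cabs (u N - _)]cabsBC.
  have := lerD (step' N (m - N)%N) (step' N (n - N)%N).
  rewrite !subnKC //; lra.
exists l => n; apply/ler_addgt0Pr => e e0; have [N NH] := lH _ e0.
rewrite cabsBC; apply: (le_trans (cabs_tri _ (u (n + N)%N) _)).
rewrite addrC; apply: lerD; first exact: step'.
by rewrite cabsBC; apply: NH; rewrite leq_addl.
Qed.

End limits.

(** * Goursat's lemma *)

Section goursat.
Context {R : realType}.
Implicit Types (f df : R[i] -> R[i]) (a b p z w : R[i]) (t : R).

Definition seg a b t : R[i] := a + t%:C * (b - a).

Lemma seg_dist a b p t (r : R) : 0 <= t <= 1 ->
  cabs (a - p) <= r -> cabs (b - p) <= r -> cabs (seg a b t - p) <= r.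
Proof.
move=> /andP[t0 t1] ar br.
have -> : seg a b t - p = (1 - t)%:C * (a - p) + t%:C * (b - p).
  by rewrite /seg rmorphB /=; ring.
apply: (le_trans (cabsD _ _)); rewrite !cabsM !cabs_real !ger0_norm ?subr_ge0 //.
have t1' : 0 <= 1 - t by rewrite subr_ge0.
by have := lerD (ler_wpM2l t1' ar) (ler_wpM2l t0 br); rewrite -mulrDl subrK mul1r.
Qed.

Lemma seg_rderiv a b t : rderiv (seg a b) t (b - a).
Proof. exact: rderiv_affine. Qed.

Lemma seg0 a b : seg a b 0 = a. Proof. by rewrite /seg rmorph0 mul0r addr0. Qed.
Lemma seg1 a b : seg a b 1 = b. Proof. by rewrite /seg rmorph1 mul1r addrC subrK. Qed.

Section disc.
Variables (c : R[i]) (r : R) (f df : R[i] -> R[i]).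
Hypothesis fd : forall z, cabs (z - c) <= r -> cderiv f z (df z).

Let K z := cabs (z - c) <= r.

(** The integral of f along the segment from a to b, as a total function of the endpoints; [segIP]
    shows that the default 0 is irrelevant for endpoints in the disc. *)
Definition segI a b := xget 0 (has_int01 (fun t => f (seg a b t) * (b - a))).

Lemma segIP a b : K a -> K b ->
  has_int01 (fun t => f (seg a b t) * (b - a)) (segI a b).
Proof.
move=> Ka Kb; rewrite /segI; case: xgetP => [//|H].
have [|I HI] := @has_int01_cont R (fun t => f (seg a b t) * (b - a)).
  move=> t t01 e e0.
  have D := rderivZ (b - a) (rderiv_comp (fd (seg_dist t01 Ka Kb)) (seg_rderiv a b t)).
  have [s s0 sH] := rderiv_cont D e0; exists s => // x _ xs.
  by rewrite !(mulrC _ (b - a)); exact: sH.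
by have := H I HI.
Qed.

Lemma segI_eq a b I : K a -> K b -> has_int01 (fun t => f (seg a b t) * (b - a)) I ->
  segI a b = I.
Proof. by move=> Ka Kb; exact: has_int01_unique (segIP Ka Kb). Qed.

(** Compares f with a function having an explicit primitive A: quadratic in the local estimate for
    triangles, linear when [segI c] is differentiated. *)
Lemma segI_bound a b (A : R[i] -> R[i]) (dA : R[i] -> R[i]) (M : R) : K a -> K b ->
  (forall t, 0 <= t <= 1 -> cderiv A (seg a b t) (dA (seg a b t))) ->
  (forall t, 0 <= t <= 1 -> cabs (f (seg a b t) - dA (seg a b t)) <= M) ->
  cabs (segI a b - (A b - A a)) <= M * cabs (b - a).
Proof.
move=> Ka Kb AdA fM.
have H : has_int01 (fun t => dA (seg a b t) * (b - a)) (A b - A a).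
  exists (fun t => A (seg a b t)); last first.
    by rewrite seg0 seg1.
  by move=> t t01; apply: rderiv_comp; [exact: AdA|exact: seg_rderiv].
apply: has_int01_bound (has_int01B (segIP Ka Kb) H) _ => t t01.
by rewrite -mulrBl cabsM ler_wpM2r ?cabs_ge0 // fM.
Qed.

(** One antiderivative along [a, b], reparametrised affinely, serves every subsegment. As p may
    exceed q, both reversal of orientation and additivity at the midpoint follow. *)
Lemma segI_sub a b (p q : R) Q : K a -> K b -> 0 <= p <= 1 -> 0 <= q <= 1 ->
  (forall t, 0 <= t <= 1 -> rderiv Q t (f (seg a b t) * (b - a))) ->
  segI (seg a b p) (seg a b q) = Q q - Q p.
Proof.
move=> Ka Kb p01 q01 QP; apply: segI_eq; rewrite /K ?seg_dist //.
exists (fun t => Q ((q - p) * t + p)); last first.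
  by rewrite /= mulr1 mulr0 subrK add0r.
move=> t t01.
have E : seg (seg a b p) (seg a b q) t = seg a b ((q - p) * t + p).
  by rewrite /seg rmorphD rmorphM rmorphB; ring.
have -> : f (seg (seg a b p) (seg a b q) t) * (seg a b q - seg a b p) =
    f (seg a b ((q - p) * t + p)) * (b - a) * (q - p)%:C.
  by rewrite E /seg rmorphB; ring.
apply: rderiv_reparam; apply: QP.
by move: p01 q01 t01 => /andP[p0 p1] /andP[q0 q1] /andP[t0 t1]; apply/andP; split; nra.
Qed.

Definition mid a b := seg a b 2^-1.

Let half01 : 0 <= (2^-1 : R) <= 1. Proof. by apply/andP; split; lra. Qed.
Let zero01 : 0 <= (0 : R) <= 1. Proof. by apply/andP; split; lra. Qed.
Let one01 : 0 <= (1 : R) <= 1. Proof. by apply/andP; split; lra. Qed.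

Lemma segIC a b : K a -> K b -> segI b a = - segI a b.
Proof.
move=> Ka Kb; have [Q QP E] := segIP Ka Kb.
by have := segI_sub Ka Kb one01 zero01 QP; rewrite seg0 seg1 E opprB.
Qed.

Lemma segI_mid a b : K a -> K b -> segI a b = segI a (mid a b) + segI (mid a b) b.
Proof.
move=> Ka Kb; have [Q QP E] := segIP Ka Kb.
have := segI_sub Ka Kb zero01 half01 QP; rewrite seg0 => ->.
by have := segI_sub Ka Kb half01 one01 QP; rewrite seg1 => ->; rewrite E; ring.
Qed.

Lemma midE a b : mid a b = (a + b) / 2.
Proof. by rewrite /mid /seg fmorphV rmorph_nat; field. Qed.

Let Kmid a b : K a -> K b -> K (mid a b).
Proof. exact: seg_dist. Qed.

Definition tri (x : R[i] * R[i] * R[i]) :=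
  segI x.1.1 x.1.2 + segI x.1.2 x.2 + segI x.2 x.1.1.
Definition perimeter (x : R[i] * R[i] * R[i]) : R :=
  cabs (x.1.2 - x.1.1) + cabs (x.2 - x.1.2) + cabs (x.1.1 - x.2).
Let K3 (x : R[i] * R[i] * R[i]) := [/\ K x.1.1, K x.1.2 & K x.2].

Let half_abs : cabs (2^-1 : R[i]) = 2^-1.
Proof. by rewrite cabsV -[2]/(2%:R) -(rmorph_nat (real_complex R)) cabs_real normr_nat. Qed.

(** The midpoints of the sides cut the triangle into four of half the perimeter, whose integrals add
    up to that over x; one of them carries at least a quarter. The hypothesis [K3 x] stands under
    the existential so that [choice] yields a total step function. *)
Let tri_step x : exists y, K3 x ->
  [/\ K3 y, cabs (tri x) <= 4 * cabs (tri y), perimeter y = perimeter x / 2 &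
      cabs (y.1.1 - x.1.1) <= perimeter x].
Proof.
case: x => -[a b] d; have [[Ka Kb Kd]|nK] := pselect (K3 (a, b, d)); last by exists (a, b, d).
rewrite /= in Ka Kb Kd.
pose x := mid a b; pose y := mid b d; pose z := mid d a.
have Kx : K x by exact: Kmid. have Ky : K y by exact: Kmid.
have Kz : K z by exact: Kmid.
have E : tri (a, b, d) = tri (a, x, z) + tri (x, b, y) + tri (z, y, d) + tri (x, y, z).
  rewrite /tri /= (segI_mid Ka Kb) (segI_mid Kb Kd) (segI_mid Kd Ka) -/x -/y -/z.
  by rewrite (segIC Kx Kz) (segIC Kx Ky) (segIC Kz Ky); ring.
have hp (u v u' v' : R[i]) : v - u = (v' - u') / 2 -> cabs (v - u) = cabs (v' - u') / 2.
  by move=> ->; rewrite cabsM half_abs.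
have P1 : perimeter (a, x, z) = perimeter (a, b, d) / 2.
  rewrite /perimeter /= (hp a x a b) ?(hp x z b d) ?(hp z a d a);
    rewrite ?/x ?/z ?midE; by field.
have P2 : perimeter (x, b, y) = perimeter (a, b, d) / 2.
  rewrite /perimeter /= (hp x b a b) ?(hp b y b d) ?(hp y x d a);
    rewrite ?/x ?/y ?midE; by field.
have P3 : perimeter (z, y, d) = perimeter (a, b, d) / 2.
  rewrite /perimeter /= (hp z y a b) ?(hp y d b d) ?(hp d z d a);
    rewrite ?/z ?/y ?midE; by field.
have P4 : perimeter (x, y, z) = perimeter (a, b, d) / 2.
  rewrite /perimeter /= (hp x y a d) ?(hp y z b a) ?(hp z x d b);
    [|by rewrite ?/z ?/x ?/y ?midE; field..].
  by rewrite (cabsBC d a) (cabsBC a b) (cabsBC b d); lra.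
have xa : cabs (x - a) <= perimeter (a, b, d).
  rewrite (hp a x a b) /x ?midE; last by field.
  rewrite /perimeter /=; have := cabs_ge0 (b - a); have := cabs_ge0 (d - b).
  by have := cabs_ge0 (a - d); lra.
have za : cabs (z - a) <= perimeter (a, b, d).
  rewrite cabsBC (hp z a d a) /z ?midE; last by field.
  rewrite /perimeter /=; have := cabs_ge0 (b - a); have := cabs_ge0 (d - b).
  by have := cabs_ge0 (a - d); lra.
have p0 : 0 <= perimeter (a, b, d) by rewrite !addr_ge0 ?cabs_ge0.
have T : cabs (tri (a, b, d)) <= cabs (tri (a, x, z)) + cabs (tri (x, b, y))
    + cabs (tri (z, y, d)) + cabs (tri (x, y, z)).
  rewrite E; do 3 (apply: (le_trans (cabsD _ _)); rewrite lerD2r).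
  exact: lexx.
have [h1|h1] := leP (cabs (tri (a, b, d))) (4 * cabs (tri (a, x, z))).
  by exists (a, x, z) => _; split => //=; rewrite ?subrr ?Normc.normc0.
have [h2|h2] := leP (cabs (tri (a, b, d))) (4 * cabs (tri (x, b, y))).
  by exists (x, b, y) => _; split => //=.
have [h3|h3] := leP (cabs (tri (a, b, d))) (4 * cabs (tri (z, y, d))).
  by exists (z, y, d) => _; split => //=.
by exists (x, y, z) => _; split => //=; lra.
Qed.

(** Near p the function is within e l of its first order expansion, which has the quadratic
    primitive A; the increments of A cancel around the triangle. *)
Let tri_local p (e : R) : K p -> 0 < e -> exists2 s : R, 0 < s & forall x l, K3 x ->
  l < s -> cabs (x.1.1 - p) <= l -> cabs (x.1.2 - p) <= l -> cabs (x.2 - p) <= l ->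
  cabs (tri x) <= e * l * perimeter x.
Proof.
move=> Kp e0; have [s s0 sH] := fd Kp e0; exists s => // -[[a b] d] l /= [Ka Kb Kd] ls al bl dl.
pose dA z := f p + df p * (z - p).
pose A z := f p * z + df p * ((z - p) * (z - p) / 2).
have AdA z : cderiv A z (dA z).
  have H1 : cderiv (fun w => w - p) z 1.
    by rewrite -[1]subr0; apply: cderivB; [exact: cderiv_id|exact: cderiv_cst].
  have -> : A = fun w => f p * w + (df p / 2) * ((w - p) * (w - p)).
    by apply/funext => w; rewrite /A; field.
  have -> : dA z = f p * 1 + df p / 2 * (1 * (z - p) + (z - p) * 1) by rewrite /dA; field.
  by apply: cderivD; apply: cderivZ; [exact: cderiv_id|exact: cderivM].
have B u v : K u -> K v -> cabs (u - p) <= l -> cabs (v - p) <= l ->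
    cabs (segI u v - (A v - A u)) <= e * l * cabs (v - u).
  move=> Ku Kv ul vl; apply: segI_bound (fun t _ => AdA (seg u v t)) _ => // t t01.
  have sl := seg_dist t01 ul vl; rewrite /dA opprD addrA.
  apply: le_trans (sH _ (le_lt_trans sl ls)) _.
  by rewrite ler_wpM2l // ltW.
have -> : tri (a, b, d) = (segI a b - (A b - A a)) + (segI b d - (A d - A b)) + (segI d a - (A a - A d)).
  by rewrite /tri /=; ring.
rewrite /perimeter /= !mulrDr; apply: (le_trans (cabsD _ _)); apply: lerD; last exact: B.
by apply: (le_trans (cabsD _ _)); apply: lerD; exact: B.
Qed.

(** The bisected triangles shrink to a point p. At stage N the integral is at most of order e / 4 ^+
    N by [tri_local], since distance to p and perimeter both halve, and this cancels the factor 4 ^+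
    N lost by bisection. *)
Lemma goursat x : K3 x -> tri x = 0.
Proof.
move=> Kx; have [step stepP] := choice tri_step.
pose X n := iter n step x.
have KX n : K3 (X n) by elim: n => [//|n IH] /=; have [] := stepP _ IH.
have PX n : perimeter (X n) = perimeter x / 2 ^+ n.
  elim: n => [|n IH]; first by rewrite expr0 divr1.
  by have [_ _ /= -> _] := stepP _ (KX n); rewrite IH exprS; field; rewrite gt_eqF ?exprn_gt0.
have TX n : cabs (tri x) <= 4 ^+ n * cabs (tri (X n)).
  elim: n => [|n IH]; first by rewrite expr0 mul1r.
  apply: (le_trans IH); have [_ H _ _] := stepP _ (KX n).
  by rewrite exprSr -mulrA ler_wpM2l // exprn_ge0.
have p0 : 0 <= perimeter x by rewrite !addr_ge0 ?cabs_ge0.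
have [|p pH] := @geometric_limit R (fun n => (X n).1.1) _ p0.
  by move=> n /=; have [_ _ _] := stepP _ (KX n); rewrite PX.
have Kp : K p.
  rewrite /K; apply/ler_addgt0Pr => e e0.
  set N := Num.Def.archi_bound (2 * perimeter x / e).
  have NH : 2 * perimeter x / 2 ^+ N <= e.
    by rewrite ler_pdivrMr ?exprn_gt0 // -ler_pdivrMl // mulrC; exact/ltW/upper_nthrootP.
  apply: (le_trans (cabs_tri _ (X N).1.1 _)).
  have [Ka _ _] := KX N; rewrite addrC; apply: lerD; first exact: Ka.
  by rewrite cabsBC; apply: le_trans NH.
apply/eqP; rewrite -cabs_eq0 eq_le cabs_ge0 andbT; apply/ler_addgt0Pr => e e0; rewrite add0r.
(* Adding 1 keeps [P] positive for a degenerate triangle. *)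
pose P := perimeter x + 1.
have P0 : 0 < P by rewrite ltr_wpDl.
(* The first vertex lies within 2 P / 2 ^+ N of p and the others at most P / 2 ^+ N further: hence
   the 3. The second factor P comes from the perimeter. *)
pose e' := e / (3 * P ^+ 2).
have e'0 : 0 < e' by rewrite divr_gt0 // mulr_gt0 // exprn_gt0.
have [s s0 sH] := tri_local Kp e'0.
set N := Num.Def.archi_bound (3 * P / s).
have p2 : 0 < 2 ^+ N :> R by rewrite exprn_gt0.
have NH : 3 * P / 2 ^+ N < s.
  by rewrite ltr_pdivrMr // -ltr_pdivrMl // mulrC; exact/upper_nthrootP.
have PN : perimeter (X N) <= P / 2 ^+ N by rewrite PX ler_pM2r ?invr_gt0 // lerDl.
have aN : cabs ((X N).1.1 - p) <= 2 * P / 2 ^+ N.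
  by apply: (le_trans (pH N)); rewrite ler_pM2r ?invr_gt0 // ler_pM2l // lerDl.
have PNge : cabs ((X N).1.2 - (X N).1.1) + cabs ((X N).1.1 - (X N).2) <= P / 2 ^+ N.
  apply: le_trans PN; rewrite /perimeter.
  by have := cabs_ge0 ((X N).2 - (X N).1.2); lra.
have n1 := cabs_ge0 ((X N).1.2 - (X N).1.1).
have n2 := cabs_ge0 ((X N).1.1 - (X N).2).
have q0 : 0 < P / 2 ^+ N by rewrite divr_gt0.
have E2 : 2 * P / 2 ^+ N = 2 * (P / 2 ^+ N) by rewrite mulrA.
have E3 : 3 * P / 2 ^+ N = 3 * (P / 2 ^+ N) by rewrite mulrA.
have := sH _ _ (KX N) NH.
have -> : cabs ((X N).1.1 - p) <= 3 * P / 2 ^+ N by lra.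
have -> : cabs ((X N).1.2 - p) <= 3 * P / 2 ^+ N.
  by apply: (le_trans (cabs_tri _ (X N).1.1 _)); lra.
have -> : cabs ((X N).2 - p) <= 3 * P / 2 ^+ N.
  apply: (le_trans (cabs_tri _ (X N).1.1 _)); rewrite (cabsBC (X N).2); lra.
move=> /(_ isT isT isT) H.
apply: (le_trans (TX N)).
have H2 : cabs (tri (X N)) <= e' * (3 * P / 2 ^+ N) * (P / 2 ^+ N).
  apply: (le_trans H); rewrite ler_wpM2l // mulr_ge0 ?(ltW e'0) //.
  by rewrite E3 mulr_ge0 // ltW.
apply: (@le_trans _ _ (4 ^+ N * (e' * (3 * P / 2 ^+ N) * (P / 2 ^+ N)))).
  by rewrite ler_wpM2l // exprn_ge0.
have -> : 4 ^+ N = 2 ^+ N * 2 ^+ N :> R by rewrite -exprMn -natrM.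
rewrite /e' le_eqVlt; apply/orP; left; apply/eqP; field.
by rewrite !gt_eqF.
Qed.

(** Goursat's lemma on the triangle c, z, w turns the increment of [segI c] into an integral over
    [z, w], where f is close to f z. *)
Lemma segI_primitive z : cabs (z - c) < r -> cderiv (segI c) z (f z).
Proof.
move=> zr; have Kz : K z by exact: ltW.
have Kc : K c by rewrite /K subrr Normc.normc0; apply: le_trans (cabs_ge0 _) Kz.
move=> e e0; have [s s0 sH] := cderiv_continuous (fd Kz) e0.
exists (Num.min s (r - cabs (z - c))); first by rewrite lt_min s0 subr_gt0.
move=> w; rewrite lt_min => /andP[ws wr].
have Kw : K w by apply: (le_trans (cabs_tri _ z _)); lra.
have := goursat (x := (c, z, w)) (And3 Kc Kz Kw).
rewrite /tri /= (segIC Kc Kw) => E.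
have -> : segI c w - segI c z - f z * (w - z) = segI z w - (f z * w - f z * z).
  by rewrite -[LHS]addr0 -E; ring.
have D u : cderiv (fun w => f z * w) u (f z).
  by rewrite -[X in cderiv _ _ X]mulr1; apply: cderivZ; exact: cderiv_id.
apply: (segI_bound (dA := fun=> f z) Kz Kw (fun t _ => D _)) => t t01.
apply/ltW/sH; apply: le_lt_trans ws.
by apply: seg_dist t01 _ _; rewrite ?subrr ?Normc.normc0 ?cabs_ge0.
Qed.

End disc.
End goursat.

(** * Cauchy's integral formula *)

Section circle.
Context {R : realType}.
Implicit Types (a c w z : R[i]) (t rho : R).

Lemma disc_primitive c (r : R) (f df : R[i] -> R[i]) :
  (forall z, cabs (z - c) <= r -> cderiv f z (df z)) ->
  exists F, forall z, cabs (z - c) < r -> cderiv F z (f z).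
Proof. by move=> fd; exists (segI f c) => z zr; exact: segI_primitive fd _ zr. Qed.

Lemma rderiv_complex (F G : R -> R) t (a b : R) :
  is_derive t (1 : R) F a -> is_derive t (1 : R) G b ->
  rderiv (fun s => F s +i* G s) t (a +i* b).
Proof.
move=> HF HG e e0; have e2 : 0 < e / 2 by rewrite divr_gt0.
have [r r0 rH] := (real_is_deriveP _ _ _).1 HF _ e2.
have [q q0 qH] := (real_is_deriveP _ _ _).1 HG _ e2.
exists (Num.min r q); first by rewrite lt_min r0.
move=> s; rewrite lt_min => /andP[sr sq].
apply: (le_trans (cabs_le_ReIm _)).
have := lerD (rH _ sr) (qH _ sq); rewrite -mulrDl -splitr; apply: le_trans => /=.
by apply: lerD; rewrite le_eqVlt; apply/orP; left; apply/eqP; congr Num.norm; ring.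
Qed.

Definition turn t : R[i] := cos (2 * pi * t) +i* sin (2 * pi * t).
(* 2 pi i *)
Definition tau_i : R[i] := 0 +i* (2 * pi).

Lemma cabs_turn t : cabs (turn t) = 1.
Proof. by rewrite /turn /= cos2Dsin2 sqrtr1. Qed.

Lemma turn01 : turn 1 = turn 0.
Proof. by rewrite /turn mulr1 mulr0 mulr_natl -[pi *+ 2]add0r cosD2pi sinD2pi. Qed.

Lemma cabs_tau_i : cabs tau_i = 2 * pi.
Proof. by rewrite /tau_i /= expr0n add0r sqrtr_sqr ger0_norm // mulr_ge0 // pi_ge0. Qed.

Lemma tau_i_neq0 : tau_i != 0.
Proof. by rewrite -cabs_gt0 cabs_tau_i mulr_gt0 // pi_gt0. Qed.

Lemma rderiv_turn t : rderiv turn t (tau_i * turn t).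
Proof.
have H (s : R) : rderiv (fun s : R => cos s +i* sin s) s ((- sin s) +i* cos s).
  exact: (@rderiv_complex (@cos R) (@sin R) s _ _ (is_derive_cos s) (is_derive_sin s)).
have := @rderiv_reparam _ _ (2 * pi) 0 t _ (H (2 * pi * t + 0)).
rewrite (_ : _ * _%:C = tau_i * turn t); last first.
  by rewrite addr0 /turn /tau_i; apply/eqP; rewrite eq_complex /=; apply/andP; split; apply/eqP; ring.
rewrite (_ : (fun s : R => _) = turn) //.
by apply/funext => s; rewrite addr0.
Qed.

Definition circ c rho t : R[i] := c + rho%:C * turn t.
Definition dcirc rho t : R[i] := rho%:C * (tau_i * turn t).

Lemma rderiv_circ c rho t : rderiv (circ c rho) t (dcirc rho t).
Proof.
have := rderivD (rderiv_cst c t) (rderivZ rho%:C (rderiv_turn t)).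
by rewrite add0r.
Qed.

Lemma circ01 c rho : circ c rho 1 = circ c rho 0.
Proof. by rewrite /circ turn01. Qed.

Lemma cabs_circ c rho t : 0 <= rho -> cabs (circ c rho t - c) = rho.
Proof. by move=> r0; rewrite /circ addrC addKr cabsM cabs_turn cabs_real mulr1 ger0_norm. Qed.

Lemma rderiv_dcirc rho t : rderiv (dcirc rho) t (rho%:C * (tau_i * (tau_i * turn t))).
Proof. by do 2 apply: rderivZ; exact: rderiv_turn. Qed.

Lemma cont01_rderiv (P dP : R -> R[i]) : (forall t, 0 <= t <= 1 -> rderiv P t (dP t)) -> cont01 P.
Proof.
move=> Pd t t01 e e0; have [r r0 rH] := rderiv_cont (Pd _ t01) e0.
by exists r => // s _; exact: rH.
Qed.

Lemma cont01M (P Q : R -> R[i]) : cont01 P -> cont01 Q -> cont01 (fun t => P t * Q t).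
Proof.
move=> cP cQ t t01 e e0.
have [B B0 BP] := cont01_bounded cP.
have [C C0 CQ] := cont01_bounded cQ.
have [r r0 rH] := cP _ t01 _ (divr_gt0 e0 (mulr_gt0 (ltr0n R 2) C0)).
have [q q0 qH] := cQ _ t01 _ (divr_gt0 e0 (mulr_gt0 (ltr0n R 2) B0)).
exists (Num.min r q); first by rewrite lt_min r0.
move=> s s01; rewrite lt_min => /andP[sr sq].
rewrite (_ : _ - _ = (P s - P t) * Q s + P t * (Q s - Q t)); last by ring.
apply: (le_lt_trans (cabsD _ _)); rewrite !cabsM.
have h1 : cabs (P s - P t) * cabs (Q s) <= cabs (P s - P t) * C by rewrite ler_wpM2l ?cabs_ge0 ?CQ.
have h2 : cabs (P t) * cabs (Q s - Q t) <= B * cabs (Q s - Q t) by rewrite ler_wpM2r ?cabs_ge0 ?BP.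
have h3 : cabs (P s - P t) * C < e / 2.
  by have := rH s s01 sr; rewrite ltr_pdivlMr ?mulr_gt0 //; lra.
have h4 : B * cabs (Q s - Q t) < e / 2.
  by have := qH s s01 sq; rewrite ltr_pdivlMr ?mulr_gt0 //; lra.
by lra.
Qed.

Section kernel.
Variables (c : R[i]) (rho : R) (psi : R -> R[i]).
Hypothesis rho0 : 0 < rho.
Hypothesis cpsi : cont01 psi.

(** Cauchy-type integral of an arbitrary continuous density, without the factor 1 / (2 pi i); the
    velocity of the circle is part of [psi]. Its smoothness in a owes nothing to where [psi] comes
    from. *)
Definition cauchy_int k a : R[i] :=
  xget 0 (has_int01 (fun t => psi t / (circ c rho t - a) ^+ k)).

Lemma circ_away a t : rho - cabs (a - c) <= cabs (circ c rho t - a).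
Proof.
by have := cabs_tri (circ c rho t) a c; rewrite cabs_circ ?(ltW rho0) // lerBlDr.
Qed.

Lemma circ_neq a t : cabs (a - c) < rho -> circ c rho t - a != 0.
Proof. by move=> ar; rewrite -cabs_gt0 (lt_le_trans _ (circ_away a t)) // subr_gt0. Qed.

Lemma rderiv_inv_circ a t : cabs (a - c) < rho ->
  rderiv (fun s => (circ c rho s - a)^-1) t (- dcirc rho t / (circ c rho t - a) ^+ 2).
Proof.
move=> ar.
have H : cderiv (fun w => (w - a)^-1) (circ c rho t) (- 1 / (circ c rho t - a) ^+ 2).
  apply: cderivV; last exact: circ_neq.
  rewrite -[1]subr0.
  by apply: cderivB; [exact: cderiv_id|exact: cderiv_cst].
have := rderiv_comp H (rderiv_circ c rho t).
by rewrite !mulNr mul1r [_^-1 * _]mulrC.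
Qed.

Lemma cauchy_intP k a : cabs (a - c) < rho ->
  has_int01 (fun t => psi t / (circ c rho t - a) ^+ k) (cauchy_int k a).
Proof.
move=> ar; rewrite /cauchy_int; case: xgetP => [//|H].
have [|I HI] := @has_int01_cont R (fun t => psi t / (circ c rho t - a) ^+ k); last by have := H I HI.
elim: k {H} => [|k IH].
  suff -> : (fun t => psi t / (circ c rho t - a) ^+ 0) = psi by [].
  by apply/funext => t; rewrite expr0 divr1.
have -> : (fun t => psi t / (circ c rho t - a) ^+ k.+1) =
    (fun t => (psi t / (circ c rho t - a) ^+ k) * (circ c rho t - a)^-1).
  by apply/funext => t; rewrite exprSr invfM mulrA.
apply: cont01M => //; apply: (cont01_rderiv (dP := fun t => - dcirc rho t / (circ c rho t - a) ^+ 2)).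
by move=> t _; exact: rderiv_inv_circ.
Qed.

(** Here x = 1 / (zeta - w), y = 1 / (zeta - a) and h = w - a, and x - y = h x y is the resolvent
    identity. The bound is a first order Taylor remainder, uniform in zeta; the crude constant k^2
    closes the induction because k^2 + (k + 1) <= (k + 1)^2. *)
Lemma inv_pow_taylor (x y h : R[i]) (M : R) k : 0 <= M -> cabs x <= M -> cabs y <= M ->
  x - y = h * x * y ->
  cabs (x ^+ k - y ^+ k - k%:R * h * y ^+ k.+1) <= k%:R ^+ 2 * M ^+ k.+2 * cabs h ^+ 2.
Proof.
move=> M0 xM yM xy; elim: k => [|k IH].
  by rewrite !expr0 subrr !mul0r subr0 Normc.normc0 !mulr_ge0 ?exprn_ge0 ?cabs_ge0.
have -> : x ^+ k.+1 - y ^+ k.+1 - k.+1%:R * h * y ^+ k.+2 =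
    x * (x ^+ k - y ^+ k - k%:R * h * y ^+ k.+1) + (k.+1%:R * h ^+ 2) * (x * y ^+ k.+2)
    + ((x - y) - h * x * y) * ( y ^+ k + k.+1%:R * h * y ^+ k.+1).
  by rewrite -natr1 !exprS; ring.
rewrite xy subrr mul0r addr0; apply: (le_trans (cabsD _ _)); rewrite cabsM (cabsM (_ * _)) (cabsM x (y ^+ _)) (cabsM _ (h ^+ 2)) !cabsX.
have kE m : cabs (m%:R : R[i]) = m%:R by rewrite -(rmorph_nat (real_complex R)) cabs_real normr_nat.
rewrite kE.
have h1 : cabs x * cabs (x ^+ k - y ^+ k - k%:R * h * y ^+ k.+1) <=
    M * (k%:R ^+ 2 * M ^+ k.+2 * cabs h ^+ 2).
  by apply: ler_pM; rewrite ?cabs_ge0.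
have h2 : k.+1%:R * cabs h ^+ 2 * (cabs x * cabs y ^+ k.+2) <=
    k.+1%:R * cabs h ^+ 2 * (M * M ^+ k.+2).
  apply: ler_wpM2l; first by rewrite mulr_ge0 ?exprn_ge0 ?cabs_ge0.
  by apply: ler_pM; rewrite ?exprn_ge0 ?cabs_ge0 // lerXn2r ?nnegrE ?cabs_ge0.
apply: (le_trans (lerD h1 h2)).
have -> : M * (k%:R ^+ 2 * M ^+ k.+2 * cabs h ^+ 2) + k.+1%:R * cabs h ^+ 2 * (M * M ^+ k.+2)
  = (k%:R ^+ 2 + k.+1%:R) * M ^+ k.+3 * cabs h ^+ 2 by rewrite [M ^+ k.+3]exprS; ring.
apply: ler_wpM2r; rewrite ?exprn_ge0 ?cabs_ge0 //.
apply: ler_wpM2r; rewrite ?exprn_ge0 // -natr1.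
by have : 0 <= k%:R :> R by []; nra.
Qed.

(** Differentiation under the integral sign: the remainder of [inv_pow_taylor] is quadratic in w -
    a, uniformly along the circle. *)
Lemma cauchy_int_deriv k a : cabs (a - c) < rho ->
  cderiv (cauchy_int k) a (k%:R * cauchy_int k.+1 a).
Proof.
move=> ar e e0.
have [B B0 Bpsi] := cont01_bounded cpsi.
(* Half the distance from a to the circle: a point w within d of a keeps distance at least d from
   the circle, so 1 / d bounds both inverses. *)
pose d := (rho - cabs (a - c)) / 2.
have d0 : 0 < d by rewrite divr_gt0 // subr_gt0.
pose M := d^-1; have M0 : 0 <= M by rewrite invr_ge0 ltW.
pose C := B * (k%:R ^+ 2 * M ^+ k.+2) + 1.
have C0 : 0 < C.
  apply: ltr_wpDl => //; apply: mulr_ge0; first exact: ltW.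
  by apply: mulr_ge0; apply: exprn_ge0.
exists (Num.min d (e / C)); first by rewrite lt_min d0 divr_gt0.
move=> w; rewrite lt_min => /andP[wd we].
have da : cabs (a - c) = rho - 2 * d by rewrite /d; field.
have wr : cabs (w - c) <= rho - d by apply: (le_trans (cabs_tri _ a _)); rewrite da; lra.
have wr' : cabs (w - c) < rho by lra.
have iM u t : cabs (u - c) <= rho - d -> cabs (circ c rho t - u)^-1 <= M.
  move=> ur; rewrite cabsV lef_pV2 ?posrE //; last first.
    by rewrite cabs_gt0 circ_neq //; lra.
  by have := circ_away u t; lra.
have := has_int01B (has_int01B (cauchy_intP k wr') (cauchy_intP k ar))
   (has_int01Z (k%:R * (w - a)) (cauchy_intP k.+1 ar)).
rewrite (_ : k%:R * (w - a) * _ = k%:R * cauchy_int k.+1 a * (w - a)); last by ring.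
move=> /has_int01_bound; apply => t t01.
set x := (circ c rho t - w)^-1; set y := (circ c rho t - a)^-1.
have -> : psi t / (circ c rho t - w) ^+ k - psi t / (circ c rho t - a) ^+ k -
   k%:R * (w - a) * (psi t / (circ c rho t - a) ^+ k.+1) =
   psi t * (x ^+ k - y ^+ k - k%:R * (w - a) * y ^+ k.+1).
  by rewrite /x /y !exprVn; ring.
rewrite cabsM.
have T : cabs (x ^+ k - y ^+ k - k%:R * (w - a) * y ^+ k.+1) <=
    k%:R ^+ 2 * M ^+ k.+2 * cabs (w - a) ^+ 2.
  apply: inv_pow_taylor => //; first exact: iM.
    by apply: iM; lra.
  by rewrite /x /y; field; rewrite !circ_neq.
apply: (le_trans (ler_pM (cabs_ge0 _) (cabs_ge0 _) (Bpsi _ t01) T)).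
rewrite expr2 !mulrA ler_wpM2r ?cabs_ge0 // -!mulrA.
apply: (@le_trans _ _ (C * cabs (w - a))).
  by rewrite /C mulrDl mul1r -!mulrA lerDl cabs_ge0.
by rewrite mulrC -ler_pdivlMr // ltW.
Qed.

End kernel.
End circle.

(** * Winding number, Cauchy's formula and Cauchy estimates *)

Section cauchy.
Context {R : realType}.
Implicit Types (a c w z : R[i]) (f g F : R[i] -> R[i]).

Lemma cderiv_unique f z d d' : cderiv f z d -> cderiv f z d' -> d = d'.
Proof. by move=> /cderiv_derive1 <- /cderiv_derive1. Qed.

Lemma open_disc c (r : R) : open [set z | cabs (z - c) < r].
Proof.
apply/open_cabsP => z /= zr; exists (r - cabs (z - c)); first by rewrite subr_gt0.
by move=> w wz; apply: (le_lt_trans (cabs_tri _ z _)); lra.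
Qed.

Section winding.
Variables (c : R[i]) (rho : R).
Hypothesis rho0 : 0 < rho.

Let cdcirc : cont01 (dcirc rho).
Proof. by apply: (cont01_rderiv (dP := fun t => rho%:C * (tau_i * (tau_i * turn t)))) => t _; exact: rderiv_dcirc. Qed.

(** As a function of a the integral has derivative zero, since the differentiated integrand has an
    antiderivative along the closed circle. It is therefore constant on the segment from the centre,
    where the integrand is identically [tau_i]. *)
Lemma winding_number a : cabs (a - c) < rho ->
  has_int01 (fun t => dcirc rho t / (circ c rho t - a)) tau_i.
Proof.
move=> ar; pose u := cauchy_int c rho (dcirc rho) 1.
have cc : cabs (c - c) < rho by rewrite subrr Normc.normc0.
have int2 w : cabs (w - c) < rho -> cauchy_int c rho (dcirc rho) 2 w = 0.
  move=> wr; apply: has_int01_unique (cauchy_intP rho0 cdcirc 2 wr) _.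
  exists (fun t => - (circ c rho t - w)^-1); last by rewrite circ01 subrr.
  move=> t t01; have := rderivZ (-1) (rderiv_inv_circ rho0 t wr).
  rewrite mulN1r mulNr opprK; congr (rderiv _ _ _).
  by apply/funext => s; rewrite mulN1r.
have uc : u c = tau_i.
  apply: has_int01_unique (cauchy_intP rho0 cdcirc 1 cc) _.
  exists (fun t => 0 + t%:C * tau_i); last by rewrite rmorph1 rmorph0; ring.
  move=> t t01; have -> : dcirc rho t / (circ c rho t - c) ^+ 1 = tau_i.
    have : rho%:C * turn t != 0.
      by rewrite -cabs_gt0 cabsM cabs_turn cabs_real mulr1 normr_gt0 gt_eqF.
    rewrite expr1 /dcirc /circ addrC addKr => h; field.
    by rewrite mulf_eq0 negb_or andbC in h.
  exact: rderiv_affine.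
suff <- : u a = tau_i by have := cauchy_intP rho0 cdcirc 1 ar.
apply/eqP; rewrite -subr_eq0 -cabs_eq0 eq_le cabs_ge0 andbT -uc.
have := @mean_value01 R (fun t => u (seg c a t)) (fun=> 0) 0; rewrite seg0 seg1; apply; last first.
  by move=> t _; rewrite Normc.normc0.
move=> t t01; rewrite -[X in rderiv _ _ X](mul0r (a - c)).
have sr : cabs (seg c a t - c) < rho.
  by apply: le_lt_trans ar; apply: seg_dist; rewrite // subrr Normc.normc0 cabs_ge0.
apply: rderiv_comp (seg_rderiv _ _ _).
by have := cauchy_int_deriv rho0 cdcirc 1 sr; rewrite int2 // mulr0.
Qed.

End winding.

Section formula.
Variables (c : R[i]) (r rho : R) (F f df : R[i] -> R[i]).
Hypotheses (rho0 : 0 < rho) (rho_r : rho < r).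
Hypothesis fd : forall z, cabs (z - c) < r -> cderiv f z (df z).
Hypothesis Fd : forall z, cabs (z - c) < r -> cderiv F z (f z).

(* Since F is twice differentiable at a, its difference quotient at a is
   holomorphic at a as well, so no exceptional point occurs in Goursat's lemma. *)
Let quot a z := if z == a then f a else (F z - F a) / (z - a).

Let quot_deriv a z : cabs (a - c) < r -> cabs (z - c) < r ->
  exists d, cderiv (quot a) z d.
Proof.
move=> ar zr; have [->|za] := eqVneq z a.
  (* The derivative at a is read off the second order expansion of F. Its remainder is bounded by
     the mean value inequality for F minus the quadratic polynomial [A]. *)
  exists (df a / 2) => e e0; have [s s0 sH] := fd ar e0.
  have /open_cabsP/(_ _ ar)[q q0 qH] := @open_disc c r.
  exists (Num.min s q); first by rewrite lt_min s0.
  move=> w; rewrite lt_min => /andP[ws wq]; rewrite /quot eqxx.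
  have [->|wa] := eqVneq w a; first by rewrite !subrr mulr0 subrr Normc.normc0 mulr0.
  have wa0 : w - a != 0 by rewrite subr_eq0.
  have cwa : 0 < cabs (w - a) by rewrite cabs_gt0.
  rewrite -(ler_pM2r cwa) -cabsM.
  rewrite (_ : _ * (w - a) = F w - F a - (f a * (w - a) + df a * ((w - a) ^+ 2 / 2))); last by field.
  pose A (z : R[i]) := f a * z + (df a / 2) * ((z - a) * (z - a)).
  have Ad u : cderiv A u (f a + df a * (u - a)).
    have H1 : cderiv (fun w => w - a) u 1.
      by rewrite -[1]subr0; apply: cderivB; [exact: cderiv_id|exact: cderiv_cst].
    have -> : f a + df a * (u - a) = f a * 1 + df a / 2 * (1 * (u - a) + (u - a) * 1) by field.
    by apply: cderivD; apply: cderivZ; [exact: cderiv_id|exact: cderivM].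
  have := @mean_value01 R (fun t => F (seg a w t) - A (seg a w t))
    (fun t => f (seg a w t) * (w - a) - (f a + df a * (seg a w t - a)) * (w - a))
    (e * cabs (w - a) * cabs (w - a)).
  rewrite seg0 seg1 => /(_ _ _) H.
  rewrite (_ : F w - F a - _ = F w - A w - (F a - A a)); last by rewrite /A expr2; field.
  apply: H => t t01.
    apply: rderivB; apply: rderiv_comp (seg_rderiv _ _ _) => //.
    apply: Fd; apply: qH; apply: le_lt_trans wq.
    by apply: seg_dist; rewrite // subrr Normc.normc0 cabs_ge0.
  have sw : cabs (seg a w t - a) <= cabs (w - a).
    by apply: seg_dist; rewrite // subrr Normc.normc0 cabs_ge0.
  rewrite -mulrBl cabsM opprD addrA ler_wpM2r ?cabs_ge0 //.
  apply: (le_trans (sH _ (le_lt_trans sw ws))).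
  by apply: ler_wpM2l => //; exact: ltW.
have za0 : z - a != 0 by rewrite subr_eq0.
have H1 : cderiv (fun w => w - a) z (1 - 0).
  by apply: cderivB; [exact: cderiv_id|exact: cderiv_cst].
have H2 := cderivM (cderivB (Fd zr) (cderiv_cst (F a) z)) (cderivV H1 za0).
have Dz : [set w | cabs (w - z) < cabs (z - a)] z.
  by rewrite /= subrr Normc.normc0 cabs_gt0.
exists ((f z - 0) * (z - a)^-1 + (F z - F a) * (- (1 - 0) / (z - a) ^+ 2)).
apply: cderiv_ext (@open_disc z (cabs (z - a))) Dz _ H2 => w /= wz.
rewrite /quot; case: eqP => [E|//].
by move: wz; rewrite E cabsBC ltxx.
Qed.

(** The difference quotient of F at a has a primitive around the circle, so its integral vanishes;
    what remains is F a times the winding number. *)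
Lemma cauchy_formula a : cabs (a - c) < rho ->
  has_int01 (fun t => F (circ c rho t) * dcirc rho t / (circ c rho t - a)) (tau_i * F a).
Proof.
move=> ar; have ar' : cabs (a - c) < r by apply: lt_trans rho_r.
(* Primitives are built from differentiability on a closed disc, hence a radius strictly between rho
   and r. *)
pose r' := (rho + r) / 2.
have r'1 : rho < r' by rewrite /r'; move: rho_r; lra.
have r'2 : r' < r by rewrite /r'; move: rho_r; lra.
have /choice[dq dqP] : forall z, exists d, cabs (z - c) < r -> cderiv (quot a) z d.
  move=> z; have [zr|zr] := pselect (cabs (z - c) < r); last by exists 0.
  by have [d dP] := quot_deriv ar' zr; exists d.
have [G GP] := @disc_primitive R c r' (quot a) dq (fun z zr => dqP z (le_lt_trans zr r'2)).
have I0 : has_int01 (fun t => quot a (circ c rho t) * dcirc rho t) 0.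
  exists (fun t => G (circ c rho t)); last by rewrite circ01 subrr.
  move=> t t01; apply: rderiv_comp (rderiv_circ _ _ _); apply: GP.
  by rewrite cabs_circ // ltW.
have := has_int01D I0 (has_int01Z (F a) (winding_number rho0 ar)).
rewrite add0r [F a * _]mulrC => I; apply: has_int01_eq I => t t01.
have n0 := circ_neq rho0 t ar.
rewrite /quot -subr_eq0 (negbTE n0); field.
exact: n0.
Qed.

End formula.

(** The second and third formulas are the derivatives of their predecessors. The third represents
    [df] by an integral although nothing is assumed about the differentiability of [df]. *)
Lemma cauchy_formula_deriv c (r rho : R) F f df : 0 < rho -> rho < r ->
  (forall z, cabs (z - c) < r -> cderiv f z (df z)) ->
  (forall z, cabs (z - c) < r -> cderiv F z (f z)) ->
  let psi t := F (circ c rho t) * dcirc rho t in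
  cont01 psi /\ forall a, cabs (a - c) < rho ->
  [/\ tau_i * F a = cauchy_int c rho psi 1 a, tau_i * f a = cauchy_int c rho psi 2 a &
      tau_i * df a = 2 * cauchy_int c rho psi 3 a].
Proof.
move=> rho0 rho_r fd Fd psi.
have cpsi : cont01 psi.
  apply: cont01M.
    apply: (cont01_rderiv (dP := fun t => f (circ c rho t) * dcirc rho t)) => t t01.
    by apply: rderiv_comp (rderiv_circ _ _ _); apply: Fd; rewrite cabs_circ // ltW.
  by apply: (cont01_rderiv (dP := fun t => rho%:C * (tau_i * (tau_i * turn t)))) => t _; exact: rderiv_dcirc.
split=> // a ar.
have E1 w : cabs (w - c) < rho -> tau_i * F w = cauchy_int c rho psi 1 w.
  move=> wr; apply: has_int01_unique (cauchy_formula rho0 rho_r fd Fd wr) _.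
  exact: (cauchy_intP rho0 cpsi 1 wr).
have E2 w : cabs (w - c) < rho -> tau_i * f w = cauchy_int c rho psi 2 w.
  move=> wr; apply: cderiv_unique (cderivZ tau_i (Fd _ (lt_trans wr rho_r))) _.
  rewrite -[cauchy_int _ _ _ _ _]mul1r.
  apply: cderiv_ext (@open_disc c rho) wr _ (cauchy_int_deriv rho0 cpsi 1 wr).
  by move=> u /E1.
split; [exact: E1|exact: E2|].
apply: cderiv_unique (cderivZ tau_i (fd _ (lt_trans ar rho_r))) _.
apply: cderiv_ext (@open_disc c rho) ar _ (cauchy_int_deriv rho0 cpsi 2 ar).
by move=> u /E2.
Qed.

Lemma open_closed_disc (D : set R[i]) z : open D -> D z ->
  exists2 r : R, 0 < r & forall w, cabs (w - z) <= r -> D w.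
Proof.
move=> /open_cabsP H /H[d d0 dD]; exists (d / 2); first by rewrite divr_gt0.
by move=> w wd; apply: dD; lra.
Qed.

(** With a local primitive F of f, the function f' is the second derivative of F, so it is a
    Cauchy-type integral of order 3 and thereby differentiable. *)
Theorem holomorphic_derive1 (D : set R[i]) f : open D -> holomorphic_on D f ->
  holomorphic_on D (derive1 f).
Proof.
move=> oD hf c Dc; have [r r0 rD] := open_closed_disc oD Dc.
have fd z : cabs (z - c) <= r -> cderiv f z (derive1 f z) by move=> /rD/hf/derivable_cderiv.
have [F Fd] := disc_primitive fd.
have rho0 : 0 < r / 2 by rewrite divr_gt0.
have rho_r : r / 2 < r by lra.
have [cpsi H] := cauchy_formula_deriv rho0 rho_r (fun z zr => fd z (ltW zr)) Fd.
have cc : cabs (c - c) < r / 2 by rewrite subrr Normc.normc0.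
apply: (@cderiv_derivable _ _ _ (2 / tau_i * (3 * cauchy_int c (r / 2)
   (fun t => F (circ c (r / 2) t) * dcirc (r / 2) t) 4 c))).
apply: cderiv_ext (@open_disc c (r / 2)) cc _ (cderivZ (2 / tau_i) (cauchy_int_deriv rho0 cpsi 3 cc)).
move=> w wr; have [_ _ E] := H _ wr.
by rewrite mulrAC -E mulrAC mulfV ?mul1r // tau_i_neq0.
Qed.

(** The formula is applied on the circle of radius r / 2, strictly inside the disc of holomorphy;
    this accounts for 2 / r in place of 1 / r. *)
Lemma cauchy_estimate (D : set R[i]) f c (r M : R) : open D -> holomorphic_on D f -> 0 < r ->
  (forall w, cabs (w - c) <= r -> D w) -> (forall w, cabs (w - c) <= r -> cabs (f w) <= M) ->
  cabs (derive1 f c) <= 2 / r * M.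
Proof.
move=> oD hf r0 rD fM; have hdf := holomorphic_derive1 oD hf.
have fd z : cabs (z - c) < r -> cderiv f z (derive1 f z) by move=> /ltW/rD/hf/derivable_cderiv.
have dfd z : cabs (z - c) < r -> cderiv (derive1 f) z (derive1 (derive1 f) z).
  by move=> /ltW/rD/hdf/derivable_cderiv.
have rho0 : 0 < r / 2 by rewrite divr_gt0.
have rho_r : r / 2 < r by lra.
have [cpsi H] := cauchy_formula_deriv rho0 rho_r dfd fd.
have cc : cabs (c - c) < r / 2 by rewrite subrr Normc.normc0.
have [_ E _] := H _ cc.
have t0 : 0 < cabs (tau_i : R[i]) by rewrite cabs_gt0 tau_i_neq0.
rewrite -(ler_pM2l t0) -cabsM E.
apply: has_int01_bound (cauchy_intP rho0 cpsi 2 cc) _ => t t01.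
rewrite /dcirc !cabsM cabsV cabsX (cabs_circ _ _ (ltW rho0)) cabs_turn cabs_real mulr1.
rewrite (ger0_norm (ltW rho0)).
have cr : cabs (circ c (r / 2) t - c) <= r by rewrite (cabs_circ _ _ (ltW rho0)) ltW.
have fm := fM _ cr.
rewrite (_ : _ * _ * _ = cabs tau_i * (2 / r) * cabs (f (circ c (r / 2) t))); last first.
  by field; rewrite gt_eqF.
by rewrite -mulrA; apply: ler_wpM2l; [exact: cabs_ge0|apply: ler_wpM2l => //; rewrite divr_ge0 ?ltW].
Qed.

(** The constant precedes the domain and the function, so it depends on n and r alone. Each
    derivative spends half of the remaining radius. *)
Lemma derive1n_estimate n (r : R) : 0 < r -> exists2 C : R, 0 <= C &
  forall (D : set R[i]) f c M, open D -> holomorphic_on D f ->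
  (forall w, cabs (w - c) <= r -> D w) -> (forall w, cabs (w - c) <= r -> cabs (f w) <= M) ->
  cabs (derive1n n f c) <= C * M.
Proof.
elim: n r => [|n IH] r r0.
  exists 1 => // D f c M oD hf rD; rewrite mul1r; apply.
  by rewrite subrr Normc.normc0 ltW.
have r2 : 0 < r / 2 by rewrite divr_gt0.
have [C C0 CH] := IH _ r2.
exists (C * (2 / (r / 2))); first by rewrite mulr_ge0 // divr_ge0 // ltW.
move=> D f c M oD hf rD fM; rewrite derive1Sn.
have -> : C * (2 / (r / 2)) * M = C * (2 / (r / 2) * M) by exact: (esym (mulrA _ _ _)).
apply: (CH D _ _ _ oD (holomorphic_derive1 oD hf)).
  by move=> w wr; apply: rD; lra.
move=> w wr; apply: (cauchy_estimate oD hf r2) => u uw.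
  by apply: rD; apply: (le_trans (cabs_tri _ w _)); lra.
by apply: fM; apply: (le_trans (cabs_tri _ w _)); lra.
Qed.

End cauchy.

(** * Weighted integrals over plane domains *)

Import HBNNSimple.

Section nonmeasurable_integrals.
Local Open Scope ereal_scope.
Context d (T : measurableType d) (R : realType) (m : {measure set T -> \bar R}).
Implicit Types (D E N : set T) (f g : T -> \bar R).

(* The integral of a nonnegative function is the supremum over measurable
   simple minorants, hence it is monotone and insensitive to null sets even for
   nonmeasurable integrands. *)
Lemma ge0_ae_le_integral D E N f g : measurable N -> m N = 0 ->
  (forall x, D x -> 0 <= f x) -> (forall x, E x -> 0 <= g x) ->
  (forall x, ~ N x -> D x -> E x /\ f x <= g x) ->
  \int[m]_(x in D) f x <= \int[m]_(x in E) g x.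
Proof.
move=> mN N0 f0 g0 fg.
have fD0 x : 0 <= (f \_ D) x by rewrite patchE; case: ifPn => // /set_mem /f0.
have gE0 x : 0 <= (g \_ E) x by rewrite patchE; case: ifPn => // /set_mem /g0.
rewrite integral_mkcond [leRHS]integral_mkcond !ge0_integralTE //.
apply: ge_ereal_sup => _ [h /= hf <-].
have mNC : measurable (~` N) by exact: measurableC.
(* Cutting the simple minorant h off on the null set N keeps its integral and makes it a minorant of
   g. *)
have -> : sintegral m h = sintegral m (proj_nnsfun h mNC).
  rewrite -!integralT_nnsfun; apply: ge0_ae_eq_integral => //.
  - exact/measurable_EFinP.
  - exact/measurable_EFinP.
  - by move=> x _; rewrite lee_fin.
  - by move=> x _; rewrite lee_fin.
  exists N; split => // x /=; apply: contra_notP => Nx _.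
  by rewrite /= /mindic indicE mem_set //= mulr1.
apply: ereal_sup_ubound; exists (proj_nnsfun h mNC) => //= x.
rewrite /mindic indicE; have [xN|xN] := boolP (x \in ~` N); last by rewrite mulr0.
rewrite mulr1; apply: le_trans (hf x) _; rewrite !patchE.
have [xD|xD] := boolP (x \in D).
  by have [Ex fgx] := fg x (set_mem xN) (set_mem xD); rewrite mem_set.
by case: ifPn => // /set_mem /g0.
Qed.

Lemma ae_eq_set_integral D E N f : measurable N -> m N = 0 -> E `<=` D -> D `\` E `<=` N ->
  \int[m]_(x in D) f x = \int[m]_(x in E) f x.
Proof.
move=> mN N0 ED DEN; rewrite integralE [RHS]integralE.
have H (g : T -> \bar R) : (forall x, 0 <= g x) -> \int[m]_(x in D) g x = \int[m]_(x in E) g x.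
  move=> g0; apply/eqP; rewrite eq_le; apply/andP; split.
    apply: (@ge0_ae_le_integral _ _ N) => // x Nx Dx; split => //.
    by apply: contrapT => nE; apply/Nx/DEN.
  by apply: (@ge0_ae_le_integral _ _ N) => // x Nx Ex; split => //; exact: ED.
by rewrite !H.
Qed.

End nonmeasurable_integrals.

(** * Borel and Lebesgue measurability in the plane *)

Section plane_measurability.
Context {R : realType}.
Notation MR := (measurableTypeR R).
Implicit Types (D : set R[i]) (f g : R[i] -> R[i]) (mu : R[i] -> R).

Lemma bigcup_count_measurable (I : countType) (F : I -> set (MR * MR)) :
  (forall i, measurable (F i)) -> measurable (\bigcup_i F i).
Proof.
move=> mF.
have -> : \bigcup_i F i = \bigcup_(n : nat) (if unpickle n is Some i then F i else set0).
  apply/seteqP; split => [x [i _ Fx]|x [n _]].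
    by exists (pickle i) => //; rewrite pickleK.
  by case: unpickle => // i Fx; exists i.
by apply: bigcup_measurable => n _; case: unpickle.
Qed.

Lemma bigcup_count_negligible (I : countType) (F : I -> set (MR * MR)) :
  (forall i, (@area R).-negligible (F i)) -> (@area R).-negligible (\bigcup_i F i).
Proof.
move=> nF.
have -> : \bigcup_i F i = \bigcup_(n : nat) (if unpickle n is Some i then F i else set0).
  apply/seteqP; split => [x [i _ Fx]|x [n _]].
    by exists (pickle i) => //; rewrite pickleK.
  by case: unpickle => // i Fx; exists i.
by apply: negligible_bigcup => n; case: unpickle => [i|]; [exact: nF|exact: negligible_set0].
Qed.

(** An open set is the union of the countably many rational squares that it contains, and each
    square is a product of intervals. *)
Lemma open_plane_measurable D : open D -> measurable (@toC R @^-1` D : set (MR * MR)).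
Proof.
move=> /open_cabsP oD.
pose sq (i : rat * rat * rat) : set (MR * MR) :=
  [set x | `|ratr i.1.1 - x| < ratr i.2] `*` [set x | `|ratr i.1.2 - x| < ratr i.2].
pose F i := if pselect (sq i `<=` @toC R @^-1` D) then sq i else set0.
have -> : @toC R @^-1` D = \bigcup_i F i.
  apply/seteqP; split => [[x y] Dxy|p [i _]]; last first.
    by rewrite /F; case: pselect => // sD; exact: sD.
  have [d d0 dD] := oD _ Dxy.
  (* Two points of a square of half-side q differ by less than 2 q in each coordinate, hence by less
     than 4 q < d in modulus. *)
  have d4 : 0 < d / 4 by rewrite divr_gt0.
  have [q] := rat_in_itvoo d4; rewrite in_itv /= => /andP[q0 qd].
  have /rat_in_itvoo[a] : x - ratr q < x + ratr q by lra.
  rewrite in_itv /= => /andP[a1 a2].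
  have /rat_in_itvoo[b] : y - ratr q < y + ratr q by lra.
  rewrite in_itv /= => /andP[b1 b2].
  have ax : `|ratr a - x| < ratr q by rewrite ltr_norml; apply/andP; split; lra.
  have by_ : `|ratr b - y| < ratr q by rewrite ltr_norml; apply/andP; split; lra.
  exists (a, b, q) => //; rewrite /F; case: pselect => [sD|[]]; first by split.
  move=> [x' y'] [/= ax' by'] /=; apply: dD.
  apply: (le_lt_trans (cabs_le_ReIm _)) => /=.
  have hx : `|x' - x| <= `|ratr a - x'| + `|ratr a - x|.
    by rewrite (distrC (ratr a) x'); exact: ler_distD.
  have hy : `|y' - y| <= `|ratr b - y'| + `|ratr b - y|.
    by rewrite (distrC (ratr b) y'); exact: ler_distD.
  by lra.
apply: bigcup_count_measurable => i; rewrite /F; case: (pselect _) => ?; last exact: measurable0.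
have mb (a q : R) : measurable ([set x | `|a - x| < q] : set MR).
  have -> : [set x : R | `|a - x| < q] = `]a - q, a + q[%classic.
    by apply/seteqP; split => x /=; rewrite in_itv /= distrC ltr_distl.
  exact: measurable_itv.
by apply: measurableX; exact: mb.
Qed.

Lemma real_part_open (h : R[i] -> R) D f y : open D -> holomorphic_on D f ->
  (forall z w, `|h z - h w| <= cabs (z - w)) -> open [set z | D z /\ y < h (f z)].
Proof.
move=> oD hf hl; apply/open_cabsP => z [Dz yz].
have e0 : 0 < h (f z) - y by rewrite subr_gt0.
have [r r0 rH] := cderiv_continuous (derivable_cderiv (hf _ Dz)) e0.
have [q q0 qH] := (open_cabsP D).1 oD z Dz.
exists (Num.min r q); first by rewrite lt_min r0.
move=> w; rewrite lt_min => /andP[wr wq]; split; first exact: qH.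
have := le_lt_trans (hl _ _) (rH _ wr); rewrite ltr_norml => /andP[H _]; lra.
Qed.

(** Stronger than the Lebesgue measurability in [L2]; holomorphic functions and their pointwise
    limits have it, and it matches the Borel measure [area]. *)
Definition borel_on D f :=
  measurable_fun (@toC R @^-1` D : set (MR * MR)) (fun p : MR * MR => complex.Re (f (toC p)) : MR) /\
  measurable_fun (@toC R @^-1` D : set (MR * MR)) (fun p : MR * MR => complex.Im (f (toC p)) : MR).

Lemma Re_lip (z w : R[i]) : `|complex.Re z - complex.Re w| <= cabs (z - w).
Proof. by case: z w => [a b] [c d]; exact: (Re_le_cabs ((a +i* b) - (c +i* d))). Qed.

Lemma Im_lip (z w : R[i]) : `|complex.Im z - complex.Im w| <= cabs (z - w).
Proof. by case: z w => [a b] [c d]; exact: (Im_le_cabs ((a +i* b) - (c +i* d))). Qed.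

Lemma holomorphic_borel D f : open D -> holomorphic_on D f -> borel_on D f.
Proof.
move=> oD hf.
have H (h : R[i] -> R) : (forall z w, `|h z - h w| <= cabs (z - w)) ->
    measurable_fun (@toC R @^-1` D : set (MR * MR)) (fun p : MR * MR => h (f (toC p)) : MR).
  move=> hl mD; apply: (measurability _ (RGenOInfty.measurableE R)) => //.
  move=> _ [_ [y ->] <-].
  have -> : @toC R @^-1` D `&` (fun p => h (f (toC p))) @^-1` `]y, +oo[%classic =
      @toC R @^-1` [set z | D z /\ y < h (f z)].
    by apply/seteqP; split => p /=; rewrite in_itv /= andbT.
  by apply: open_plane_measurable; exact: real_part_open.
by split; apply: H; [exact: Re_lip|exact: Im_lip].
Qed.

Lemma borel_lebesgue D (h : R[i] -> R) :
  measurable (@toC R @^-1` D : set (MR * MR)) ->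
  measurable_fun (@toC R @^-1` D : set (MR * MR)) (fun p : MR * MR => h (toC p) : MR) ->
  lebesgue_measurable_on D h.
Proof.
move=> mD mh Y mY; exists (@toC R @^-1` (D `&` h @^-1` Y)); first exact: mh.
by exists set0; [exact: negligible_set0|rewrite setU0].
Qed.

(** Each superlevel set of mu at a rational height is Borel up to a null set. Removing one null set
    N that covers these countably many exceptions leaves a Borel set E on which mu is Borel. *)
Lemma weight_borel D mu : open D -> weight D mu ->
  exists E : set (MR * MR), exists N : set (MR * MR),
  [/\ measurable E, measurable_fun E (fun p : MR * MR => mu (toC p) : MR),
      E `<=` @toC R @^-1` D, measurable N /\ @area R N = 0%E &
      (@toC R @^-1` D) `\` E `<=` N].
Proof.
move=> oD [lmu mu0].
pose A (q : rat) := @toC R @^-1` (D `&` mu @^-1` `]ratr q, +oo[%classic).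
have /choice[B HB] : forall q, exists B : set (MR * MR) * set (MR * MR),
    [/\ measurable B.1, (@area R).-negligible B.2 & A q = B.1 `|` B.2].
  move=> q; have [B mB [N nN BN]] := lmu _ (measurable_itv `]ratr q, +oo[).
  by exists (B, N); split.
have nN : (@area R).-negligible (\bigcup_q (B q).2).
  by apply: bigcup_count_negligible => q; have [] := HB q.
have [N [mN N0 subN]] := nN.
have subN' q : (B q).2 `<=` N.
  by move=> x Bx; apply: subN; exists q.
have mD := open_plane_measurable oD.
exists ((@toC R @^-1` D) `\` N), N; split => //.
- exact: measurableD.
- move=> mE; apply: (measurability _ (RGenOInfty.measurableE R)) => //.
  move=> _ [_ [y ->] <-].
  have -> : (@toC R @^-1` D `\` N) `&` (fun p => mu (toC p)) @^-1` `]y, +oo[%classic =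
     (\bigcup_(q : rat) (if y < ratr q then (B q).1 else set0)) `\` N.
    apply/seteqP; split => [p [[Dp Np]] /=|p /= [[q _] Bq Np]].
      rewrite in_itv /= andbT => ymu; split => //.
      have [q] := rat_in_itvoo ymu; rewrite in_itv /= => /andP[yq qmu].
      exists q => //; rewrite yq; have [_ _ Aq] := HB q.
      have : A q p by split => //=; rewrite in_itv /= qmu.
      by rewrite Aq => -[//|/subN'].
    case: ifPn Bq => // yq Bq; have [_ _ Aq] := HB q.
    have : A q p by rewrite Aq; left.
    move=> [Dp] /=; rewrite !in_itv /= !andbT => qmu; split => //.
    exact: lt_trans qmu.
  apply: measurableD => //; apply: bigcup_count_measurable => q.
  by case: ifPn => // _; have [] := HB q.
- by move=> p [Dp] H; apply: contrapT => Np; apply: H.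
Qed.

End plane_measurability.

(** * The weighted inner product and its linearity *)

Section weighted_form.
Context {R : realType}.
Notation MR := (measurableTypeR R).
Implicit Types (D : set R[i]) (f g h : R[i] -> R[i]) (mu : R[i] -> R).

(* The real part of the inner product of L^2_mu(D); all of the Hilbert space theory
   below is done with this real form. *)
Definition ipw D mu f g : R :=
  (\int[@area R]_(p in @toC R @^-1` D) (complex.Re (f (toC p) * (g (toC p))^*%C) * mu (toC p)))%R.

Definition sqi D mu f := borel_on D f /\ (sqnormL2 D mu f < +oo)%E.

Lemma Re_mul_conj (z w : R[i]) : complex.Re (z * w^*%C) =
  complex.Re z * complex.Re w + complex.Im z * complex.Im w.
Proof. by case: z w => [a b] [c d] /=; rewrite mulrN opprK. Qed.

Lemma eq_ipw D mu f f' g g' : (forall z, D z -> f z = f' z) -> (forall z, D z -> g z = g' z) ->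
  ipw D mu f g = ipw D mu f' g'.
Proof. by move=> ff gg; apply: eq_Rintegral => p /set_mem /= Dp; rewrite ff ?gg. Qed.

Lemma eq_sqnormL2 D mu f f' : (forall z, D z -> f z = f' z) ->
  sqnormL2 D mu f = sqnormL2 D mu f'.
Proof. by move=> ff; apply: eq_integral => p /set_mem /= Dp; rewrite ff. Qed.

Lemma eq_borel_on D f f' : (forall z, D z -> f z = f' z) -> borel_on D f -> borel_on D f'.
Proof.
move=> ff [mR mI]; split.
  by apply: eq_measurable_fun mR => p /set_mem /= Dp; rewrite ff.
by apply: eq_measurable_fun mI => p /set_mem /= Dp; rewrite ff.
Qed.

Lemma eq_sqi D mu f f' : (forall z, D z -> f z = f' z) -> sqi D mu f -> sqi D mu f'.
Proof. by move=> ff [bf nf]; split; [exact: eq_borel_on bf|rewrite -(eq_sqnormL2 _ ff)]. Qed.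

Lemma ipwC D mu f g : ipw D mu f g = ipw D mu g f.
Proof.
apply: eq_Rintegral => p _; rewrite !Re_mul_conj; congr (_ * _).
by rewrite mulrC [X in _ + X]mulrC.
Qed.

Lemma ipw_scale_l D mu c f g : ipw D mu (fun z => c * f z) g = ipw D mu f (fun z => c^*%C * g z).
Proof.
apply: eq_Rintegral => p _; congr (_ * _); rewrite !Re_mul_conj.
by case: c (f _) (g _) => [a b] [x y] [z w] /=; ring.
Qed.

Lemma borel_onD D f g : borel_on D f -> borel_on D g -> borel_on D (fun z => f z + g z).
Proof.
move=> [fR fI] [gR gI]; split.
  apply: eq_measurable_fun (measurable_funD fR gR) => p _ /=.
  by case: (f _) (g _) => [a b] [c d].
apply: eq_measurable_fun (measurable_funD fI gI) => p _ /=.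
by case: (f _) (g _) => [a b] [c d].
Qed.

Lemma borel_onZ D c f : borel_on D f -> borel_on D (fun z => c * f z).
Proof.
move=> [fR fI]; case: c => a b; split.
  apply: eq_measurable_fun (measurable_funB (measurable_funM (measurable_cst a) fR)
     (measurable_funM (measurable_cst b) fI)) => p _ /=.
  by case: (f _).
apply: eq_measurable_fun (measurable_funD (measurable_funM (measurable_cst a) fI)
     (measurable_funM (measurable_cst b) fR)) => p _ /=.
by case: (f _).
Qed.

Section fixed_weight.
Variables (D : set R[i]) (mu : R[i] -> R).
Hypotheses (oD : open D) (wD : weight D mu).

Let mu0 z : D z -> 0 < mu z. Proof. by case: wD => _; apply. Qed.

Lemma sqi_integrable (E : set (MR * MR)) f : measurable E -> E `<=` @toC R @^-1` D ->
  measurable_fun E (fun p : MR * MR => mu (toC p) : MR) ->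
  sqi D mu f ->
  (@area R).-integrable E (fun p => (cabs (f (toC p)) ^+ 2 * mu (toC p))%:E).
Proof.
move=> mE ED mmu [bf nf].
have mD := open_plane_measurable oD.
have mm : measurable_fun E (fun p : MR * MR => cabs (f (toC p)) ^+ 2 * mu (toC p) : MR).
  apply: measurable_funM => //.
  have [fR fI] := bf.
  have fR' := measurable_funS mD ED fR; have fI' := measurable_funS mD ED fI.
  apply: eq_measurable_fun (measurable_funD (measurable_funM fR' fR') (measurable_funM fI' fI')).
  by move=> p _; rewrite /= cabs_sqr !expr2.
have p0 p : E p -> 0 <= cabs (f (toC p)) ^+ 2 * mu (toC p).
  by move=> Ep; rewrite mulr_ge0 ?sqr_ge0 // ltW // mu0 //; exact: ED.
apply/integrableP; split; first exact/measurable_EFinP.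
apply: le_lt_trans nf.
apply: (@ge0_ae_le_integral _ _ _ _ _ _ set0) => //.
- by move=> p Dp; rewrite lee_fin mulr_ge0 ?sqr_ge0 // ltW // mu0.
- move=> p _ Ep; split; first exact: ED.
  by rewrite gee0_abs // lee_fin p0.
Qed.

Lemma ipw_integrable (E : set (MR * MR)) f g : measurable E -> E `<=` @toC R @^-1` D ->
  measurable_fun E (fun p : MR * MR => mu (toC p) : MR) ->
  sqi D mu f -> sqi D mu g ->
  (@area R).-integrable E (fun p => (complex.Re (f (toC p) * (g (toC p))^*%C) * mu (toC p))%:E).
Proof.
move=> mE ED mmu sf sg.
have mD := open_plane_measurable oD.
have I := integrableD mE (sqi_integrable mE ED mmu sf) (sqi_integrable mE ED mmu sg).
apply: le_integrable I => //.
  apply/measurable_EFinP; apply: measurable_funM => //.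
  have [[fR fI] _] := sf; have [[gR gI] _] := sg.
  have fR' := measurable_funS mD ED fR; have fI' := measurable_funS mD ED fI.
  have gR' := measurable_funS mD ED gR; have gI' := measurable_funS mD ED gI.
  apply: eq_measurable_fun (measurable_funD (measurable_funM fR' gR') (measurable_funM fI' gI')).
  by move=> p _; rewrite /= Re_mul_conj.
move=> p Ep; have m0 : 0 <= mu (toC p) by rewrite ltW // mu0 //; exact: ED.
rewrite /= lee_fin normrM (ger0_norm m0) [leRHS]ger0_norm; last first.
  by rewrite addr_ge0 // mulr_ge0 // sqr_ge0.
rewrite -mulrDl ler_wpM2r // !cabs_sqr Re_mul_conj.
case: (f _) (g _) => [a b] [c d] /=.
move: (sqr_ge0 (a + c)) (sqr_ge0 (b + d)) (sqr_ge0 (a - c)) (sqr_ge0 (b - d)).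
move: (sqr_ge0 a) (sqr_ge0 b) (sqr_ge0 c) (sqr_ge0 d).
by rewrite ler_norml => *; apply/andP; split; lra.
Qed.

(** Additivity of the integral requires measurable integrands, and mu is Borel only on part of D.
    Integrals over D are moved to this full-measure part E, whatever the integrand. *)
Lemma ipw_restrict : exists2 E : set (MR * MR), 
  [/\ measurable E, E `<=` @toC R @^-1` D & measurable_fun E (fun p : MR * MR => mu (toC p) : MR)] &
  forall F : MR * MR -> \bar R, (\int[@area R]_(p in @toC R @^-1` D) F p = \int[@area R]_(p in E) F p)%E.
Proof.
have [E [N [mE mmu ED [mN N0] DEN]]] := weight_borel oD wD.
by exists E => // F; exact: ae_eq_set_integral mN N0 ED DEN.
Qed.

Lemma sqnormL2_ge0 f : (0 <= sqnormL2 D mu f)%E.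
Proof. by apply: integral_ge0 => p Dp; rewrite lee_fin mulr_ge0 ?sqr_ge0 // ltW // mu0. Qed.

Lemma ipw_ge0 f : 0 <= ipw D mu f f.
Proof.
apply: Rintegral_ge0 => p Dp; rewrite Re_mul_conj -!expr2.
by rewrite mulr_ge0 ?addr_ge0 ?sqr_ge0 // ltW // mu0.
Qed.

Lemma sqnormL2E f : sqi D mu f -> sqnormL2 D mu f = (ipw D mu f f)%:E.
Proof.
move=> [_ nf]; rewrite /ipw /Rintegral fineK.
  by apply: eq_integral => p _; rewrite Re_mul_conj -!expr2 -cabs_sqr.
rewrite (_ : (\int[_]_(_ in _) _)%E = sqnormL2 D mu f).
  by rewrite ge0_fin_numE // sqnormL2_ge0.
by apply: eq_integral => p _; rewrite Re_mul_conj -!expr2 -cabs_sqr.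
Qed.

Lemma sqiZ c f : sqi D mu f -> sqi D mu (fun z => c * f z).
Proof.
move=> [bf nf]; split; first exact: borel_onZ.
have [E [mE ED mmu] EI] := ipw_restrict.
have I := sqi_integrable mE ED mmu (conj bf nf).
rewrite /sqnormL2 EI.
have -> : (\int[@area R]_(p in E) (cabs (c * f (toC p)) ^+ 2 * mu (toC p))%:E =
   \int[@area R]_(p in E) ((cabs c ^+ 2)%:E * (cabs (f (toC p)) ^+ 2 * mu (toC p))%:E))%E.
  by apply: eq_integral => p _; rewrite -EFinM; congr (_%:E); rewrite cabsM exprMn; ring.
by rewrite integralZl // lte_mul_pinfty ?lee_fin ?sqr_ge0 // -EI.
Qed.

Lemma sqiD f g : sqi D mu f -> sqi D mu g -> sqi D mu (fun z => f z + g z).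
Proof.
move=> sf sg; have [bf nf] := sf; have [bg ng] := sg; split; first exact: borel_onD.
have [E [mE ED mmu] EI] := ipw_restrict.
have I := integrableD mE (sqi_integrable mE ED mmu sf) (sqi_integrable mE ED mmu sg).
have I2 := integrableZl mE 2 I.
rewrite /sqnormL2 EI; have /integrableP[_] := I2; apply: le_lt_trans.
apply: (@ge0_ae_le_integral _ _ _ _ _ _ set0) => //.
  by move=> p Ep; rewrite lee_fin mulr_ge0 ?sqr_ge0 // ltW // mu0 //; exact: ED.
move=> p _ Ep; split => //.
have m0 : 0 <= mu (toC p) by rewrite ltW // mu0 //; exact: ED.
rewrite /= lee_fin ger0_norm; last by rewrite mulr_ge0 // addr_ge0 // mulr_ge0 // sqr_ge0.
rewrite -mulrDl mulrA ler_wpM2r // !cabs_sqr.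
case: (f _) (g _) => [a b] [c d] /=.
by move: (sqr_ge0 (a - c)) (sqr_ge0 (b - d)); lra.
Qed.

Lemma ipwDl f g h : sqi D mu f -> sqi D mu g -> sqi D mu h ->
  ipw D mu (fun z => f z + g z) h = ipw D mu f h + ipw D mu g h.
Proof.
move=> sf sg sh; have [E [mE ED mmu] EI] := ipw_restrict.
rewrite /ipw /Rintegral !EI.
have If := ipw_integrable mE ED mmu sf sh; have Ig := ipw_integrable mE ED mmu sg sh.
rewrite -fineD ?integrable_fin_num // -integralD //; congr fine.
by apply: eq_integral => p _; rewrite -EFinD -mulrDl !Re_mul_conj; case: (f _) (g _) => [a b] [c d] /=;
  congr (_ * _)%:E; ring.
Qed.

Lemma ipwZl (a : R) f h : sqi D mu f -> sqi D mu h ->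
  ipw D mu (fun z => a%:C * f z) h = a * ipw D mu f h.
Proof.
move=> sf sh; have [E [mE ED mmu] EI] := ipw_restrict.
rewrite /ipw /Rintegral !EI.
have If := ipw_integrable mE ED mmu sf sh.
rewrite -[X in X * _]/(fine a%:E) -fineM ?integrable_fin_num // -integralZl //; congr fine.
by apply: eq_integral => p _; rewrite -EFinM !Re_mul_conj; case: (f _) => [b c] /=;
  congr (_%:E); ring.
Qed.

End fixed_weight.

Lemma le_sqnormL2 D D' mu mu' f : D `<=` D' -> (forall z, D z -> 0 <= mu z <= mu' z) ->
  (forall z, D' z -> 0 <= mu' z) -> (sqnormL2 D mu f <= sqnormL2 D' mu' f)%E.
Proof.
move=> DD mm m0; apply: (@ge0_ae_le_integral _ _ _ _ _ _ set0) => //.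
- by move=> p Dp; rewrite lee_fin mulr_ge0 ?sqr_ge0 //; case/andP: (mm _ Dp).
- by move=> p Dp; rewrite lee_fin mulr_ge0 ?sqr_ge0 // m0.
- move=> p _ Dp; split; first exact: DD.
  by rewrite lee_fin ler_wpM2l ?sqr_ge0 //; case/andP: (mm _ Dp).
Qed.

Lemma borel_onS D D' f : open D' -> D `<=` D' -> borel_on D' f -> borel_on D f.
Proof.
move=> oD' DD [fR fI]; have mD := open_plane_measurable oD'.
by split; [apply: measurable_funS fR|apply: measurable_funS fI] => // p; exact: DD.
Qed.

End weighted_form.

(** * Real bilinear forms and Riesz representation *)

Section hermitian.
Context {R : realType} {V : lmodType R[i]}.
Implicit Types (f g h : V) (U : V -> Prop).

(** A positive semidefinite form on a complex subspace W given as a predicate. [ip_adj] is what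
    remains of sesquilinearity when only the real part of a Hermitian form is kept. Definiteness is
    not demanded, since functions are total and those vanishing on D have norm zero. *)
Record real_form (W : V -> Prop) (ip : V -> V -> R) : Prop := RealForm {
  rf_D : forall f g, W f -> W g -> W (f + g);
  rf_Z : forall c f, W f -> W (c *: f);
  ip_sym : forall f g, W f -> W g -> ip f g = ip g f;
  ip_Dl : forall f g h, W f -> W g -> W h -> ip (f + g) h = ip f h + ip g h;
  ip_Zl : forall (a : R) f g, W f -> W g -> ip (a%:C *: f) g = a * ip f g;
  ip_adj : forall c f g, W f -> W g -> ip (c *: f) g = ip f (c^*%C *: g);
  ip_ge0 : forall f, W f -> 0 <= ip f f }.

Variables (W : V -> Prop) (ip : V -> V -> R).
Hypothesis form : real_form W ip.

Let WD := rf_D form.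
Let WZ := rf_Z form.

Lemma rf_N f : W f -> W (- f).
Proof. by rewrite -scaleN1r; exact: WZ. Qed.

Lemma rf_B f g : W f -> W g -> W (f - g).
Proof. by move=> Wf Wg; apply: WD => //; exact: rf_N. Qed.

Lemma ip_Nl f g : W f -> W g -> ip (- f) g = - ip f g.
Proof.
move=> Wf Wg; have := ip_Zl form (-1) Wf Wg.
by rewrite rmorphN rmorph1 scaleN1r mulN1r.
Qed.

Lemma ip_Bl f g h : W f -> W g -> W h -> ip (f - g) h = ip f h - ip g h.
Proof. by move=> Wf Wg Wh; rewrite (ip_Dl form) ?ip_Nl //; exact: rf_N. Qed.

Lemma ip_Br f g h : W f -> W g -> W h -> ip h (f - g) = ip h f - ip h g.
Proof.
move=> Wf Wg Wh; rewrite (ip_sym form Wh (rf_B Wf Wg)) ip_Bl //.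
by rewrite (ip_sym form Wf Wh) (ip_sym form Wg Wh).
Qed.

Lemma ip_Dr f g h : W f -> W g -> W h -> ip h (f + g) = ip h f + ip h g.
Proof.
move=> Wf Wg Wh; rewrite (ip_sym form Wh (WD Wf Wg)) (ip_Dl form) //.
by rewrite (ip_sym form Wf Wh) (ip_sym form Wg Wh).
Qed.

Lemma ip_Zr (a : R) f g : W f -> W g -> ip f (a%:C *: g) = a * ip f g.
Proof.
move=> Wf Wg; rewrite (ip_sym form Wf (WZ _ Wg)) (ip_Zl form) //.
by rewrite (ip_sym form Wf Wg).
Qed.

Lemma ip_sqB f g : W f -> W g -> ip (f - g) (f - g) = ip f f - 2 * ip f g + ip g g.
Proof.
move=> Wf Wg; rewrite (ip_Bl Wf Wg (rf_B Wf Wg)) !ip_Br //.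
by rewrite (ip_sym form Wg Wf); ring.
Qed.

Lemma ip_sqD f g : W f -> W g -> ip (f + g) (f + g) = ip f f + 2 * ip f g + ip g g.
Proof.
move=> Wf Wg; rewrite (ip_Dl form Wf Wg (WD Wf Wg)) !ip_Dr //.
by rewrite (ip_sym form Wg Wf); ring.
Qed.

Lemma ip_sqZ c f : W f -> ip (c *: f) (c *: f) = cabs c ^+ 2 * ip f f.
Proof.
move=> Wf; rewrite (ip_adj form c Wf (WZ c Wf)) scalerA.
have -> : c^*%C * c = (cabs c ^+ 2)%:C.
  by rewrite cabs_sqr; case: (c) => a b; apply/eqP; rewrite eq_complex /=; apply/andP; split; apply/eqP; ring.
by rewrite ip_Zr.
Qed.

(** Evaluation at t = - b / (F + 1) instead of the minimiser - b / F covers F = 0 as well. *)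
Lemma quadratic_bound (d b F : R) : 0 <= F ->
  (forall t, 0 <= d + 2 * t * b + t ^+ 2 * F) -> b ^+ 2 <= d * (F + 1).
Proof.
move=> F0 /(_ (- b / (F + 1))) H.
have F1 : 0 < F + 1 by rewrite ltr_wpDl.
have E : (d + 2 * (- b / (F + 1)) * b + (- b / (F + 1)) ^+ 2 * F) * (F + 1) =
  d * (F + 1) - b ^+ 2 - b ^+ 2 / (F + 1) by field; rewrite gt_eqF.
have := mulr_ge0 H (ltW F1); rewrite E.
have h : 0 <= b ^+ 2 / (F + 1) by rewrite divr_ge0 ?sqr_ge0 ?(ltW F1).
by lra.
Qed.

Lemma ip_CS f g : W f -> W g -> ip f g ^+ 2 <= ip f f * ip g g.
Proof.
move=> Wf Wg.
have H (s : R) : 0 <= s ^+ 2 * ip f f + 2 * s * ip f g + ip g g.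
  have Wsf := WZ s%:C Wf.
  have := ip_ge0 form (WD Wsf Wg).
  by rewrite ip_sqD // (ip_Zl form) // ip_Zr // (ip_Zl form) // expr2 !mulrA.
have F0 := ip_ge0 form Wf; have G0 := ip_ge0 form Wg.
have [F00|Fn0] := eqVneq (ip f f) 0.
  rewrite F00 mul0r; have B : ip f g ^+ 2 <= 0.
    apply/ler_addgt0Pr => e e0; rewrite add0r.
    (* For a null vector f the quadratic in s is affine; at this s it is negative as soon as ip f g
       ^+ 2 exceeds e. *)
    have := H (- (ip g g + 1) * ip f g / e).
    rewrite F00 mulr0 add0r => {}H; rewrite leNgt; apply/negP => lt.
    have : 2 * (- (ip g g + 1) * ip f g / e) * ip f g + ip g g =
      - 2 * (ip g g + 1) * (ip f g ^+ 2 / e) + ip g g by field; rewrite gt_eqF.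
    move=> E; rewrite E in H.
    have : 1 < ip f g ^+ 2 / e by rewrite ltr_pdivlMr // mul1r.
    by move=> h1; nra.
  exact: B.
have Fp : 0 < ip f f by rewrite lt_def Fn0.
have := H (- ip f g / ip f f).
have -> : (- ip f g / ip f f) ^+ 2 * ip f f + 2 * (- ip f g / ip f f) * ip f g + ip g g
  = (ip f f * ip g g - ip f g ^+ 2) / ip f f by field.
by rewrite pmulr_lge0 ?invr_gt0 // subr_ge0.
Qed.

Definition nrm f : R := Num.sqrt (ip f f).

Lemma nrm_ge0 f : 0 <= nrm f. Proof. exact: sqrtr_ge0. Qed.

Lemma nrm_sqr f : W f -> nrm f ^+ 2 = ip f f.
Proof. by move=> Wf; rewrite sqr_sqrtr //; exact: (ip_ge0 form). Qed.

Lemma nrm_CS f g : W f -> W g -> `|ip f g| <= nrm f * nrm g.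
Proof.
move=> Wf Wg; rewrite -(@ler_pXn2r _ 2) ?nnegrE ?mulr_ge0 ?nrm_ge0 //.
by rewrite real_normK ?num_real // exprMn !nrm_sqr //; exact: ip_CS.
Qed.

Lemma nrm_D f g : W f -> W g -> nrm (f + g) <= nrm f + nrm g.
Proof.
move=> Wf Wg; rewrite -(@ler_pXn2r _ 2) ?nnegrE ?addr_ge0 ?nrm_ge0 //.
rewrite nrm_sqr; last exact: WD.
rewrite ip_sqD // sqrrD !nrm_sqr // lerD2r lerD2l mulr_natl lerMn2r /=.
exact: le_trans (ler_norm _) (nrm_CS _ _).
Qed.

Lemma nrm_Z c f : W f -> nrm (c *: f) = cabs c * nrm f.
Proof.
by move=> Wf; rewrite /nrm ip_sqZ // sqrtrM ?sqr_ge0 // sqrtr_sqr ger0_norm // cabs_ge0.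
Qed.

Lemma nrm_B f g : W f -> W g -> nrm (f - g) <= nrm f + nrm g.
Proof.
move=> Wf Wg; apply: le_trans (nrm_D Wf (rf_N Wg)) _.
by rewrite -scaleN1r nrm_Z // cabsN Normc.normc1 mul1r.
Qed.

Lemma nrm_le f (e : R) : W f -> 0 <= e -> ip f f <= e ^+ 2 -> nrm f <= e.
Proof. by move=> Wf e0 fe; rewrite -(@ler_pXn2r _ 2) ?nnegrE ?nrm_ge0 // nrm_sqr. Qed.

Definition cauchy_in (w : nat -> V) := forall e : R, 0 < e -> exists N,
  forall m n, (N <= m)%N -> (N <= n)%N -> ip (w m - w n) (w m - w n) <= e.

Definition cvg_in (w : nat -> V) l := forall e : R, 0 < e -> exists N,
  forall n, (N <= n)%N -> ip (w n - l) (w n - l) <= e.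

Definition complete_form := forall w, (forall n, W (w n)) -> cauchy_in w ->
  exists2 l, W l & cvg_in w l.

Lemma cvg_in_ip w l f : (forall n, W (w n)) -> W l -> W f -> cvg_in w l ->
  forall e : R, 0 < e -> exists N, forall n, (N <= n)%N -> `|ip f (w n) - ip f l| <= e.
Proof.
move=> Ww Wl Wf wl e e0.
have F1 : 0 < ip f f + 1 by rewrite ltr_wpDl ?(ip_ge0 form).
have [N NH] := wl (e ^+ 2 / (ip f f + 1)) (divr_gt0 (exprn_gt0 2 e0) F1).
exists N => n Nn; rewrite -ip_Br // -(@ler_pXn2r _ 2) ?nnegrE ?(ltW e0) //.
rewrite real_normK ?num_real //.
have Wwl := rf_B (Ww n) Wl.
apply: (le_trans (ip_CS Wf Wwl)).
have := NH _ Nn; rewrite ler_pdivlMr // mulrDr mulr1.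
by have := ip_ge0 form Wwl; lra.
Qed.

Section riesz.
Variables (U : V -> Prop) (phi : V -> R) (C : R).
Hypotheses (UW : forall f, U f -> W f) (U0 : exists f, U f).
Hypothesis UD : forall f g, U f -> U g -> U (f + g).
Hypothesis UZ : forall (a : R) f, U f -> U (a%:C *: f).
Hypothesis phiD : forall f g, U f -> U g -> phi (f + g) = phi f + phi g.
Hypothesis phiZ : forall (a : R) f, U f -> phi (a%:C *: f) = a * phi f.
Hypothesis phiC : forall f, U f -> phi f ^+ 2 <= C * ip f f.

Let Q w := ip w w - 2 * phi w.

(* Minimizing Q produces the representing vector of phi. *)
Lemma riesz_sequence : exists w, [/\ forall n, U (w n), cauchy_in w &
  forall f, U f -> forall e : R, 0 < e -> exists N, forall n, (N <= n)%N ->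
    `|ip f (w n) - phi f| <= e].
Proof.
have C0 : exists2 C', 0 <= C' & forall f, U f -> phi f ^+ 2 <= C' * ip f f.
  exists `|C| => // f Uf; apply: (le_trans (phiC Uf)).
  by rewrite ler_wpM2r ?ler_norm // (ip_ge0 form) //; exact: UW.
have [C' C'0 phiC'] := C0.
(* The bound phi^2 <= C' F and the inequality of the means give 2 phi <= F + C'. *)
have Qlb f : U f -> - C' <= Q f.
  move=> Uf; rewrite /Q; have F0 := ip_ge0 form (UW Uf); have := phiC' _ Uf.
  set F := ip f f in F0 *; set p := phi f => pc.
  rewrite leNgt; apply/negP => lt.
  have h : (F + C') < 2 * p by lra.
  have h2 : (F + C') ^+ 2 < (2 * p) ^+ 2 by rewrite ltrXn2r ?nnegrE //; lra.
  have := sqr_ge0 (F - C'); move: h2; rewrite exprMn sqrrD sqrrB; lra.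
pose S := [set Q f | f in U].
have hS : has_inf S.
  split; first by have [f Uf] := U0; exists (Q f), f.
  by exists (- C') => _ [f Uf <-]; exact: Qlb.
have Qinf f : U f -> inf S <= Q f by move=> Uf; apply: ge_inf; [have [] := hS|exists f].
have /choice[w wP] : forall n : nat, exists w, U w /\ Q w < inf S + n.+1%:R^-1.
  move=> n; have e0 : 0 < n.+1%:R^-1 :> R by rewrite invr_gt0.
  by have [_ [f Uf <-] fS] := inf_adherent e0 hS; exists f.
have wd (e : R) : 0 < e -> exists N, forall n, (N <= n)%N -> Q (w n) <= inf S + e.
  move=> e0; exists (Num.Def.archi_bound e^-1) => n Nn.
  have [_ /ltW H] := wP n; apply: (le_trans H); rewrite lerD2l.
  rewrite -[leRHS]invrK lef_pV2 ?posrE ?invr_gt0 //.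
  apply: le_trans (ltW (archi_boundP (ltW _))) _; first by rewrite invr_gt0.
  by rewrite ler_nat (leq_trans Nn).
exists w; split; first by move=> n; have [] := wP n.
  move=> e e0; have e4 : 0 < e / 4 by rewrite divr_gt0.
  have [N NH] := wd _ e4; exists N => m n Nm Nn.
  have [Um _] := wP m; have [Un _] := wP n.
  have Wm := UW Um; have Wn := UW Un.
  (* By the parallelogram identity, Q at the midpoint is the mean of the two values of Q minus a
     quarter of the squared distance; as it is at least [inf S], an excess of e / 4 at both ends
     bounds the squared distance by e. *)
  have Us : U ((2^-1)%:C *: (w m + w n)) by apply: UZ; exact: UD.
  have := Qinf _ Us; rewrite /Q phiZ ?phiD //; last exact: UD.
  rewrite (ip_sqZ _ (WD Wm Wn)) (ip_sqD Wm Wn).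
  rewrite cabs_real ger0_norm ?invr_ge0 //.
  have := NH _ Nm; have := NH _ Nn; rewrite /Q (ip_sqB Wm Wn) exprVn -natrX.
  by lra.
move=> f Uf e e0; have Wf := UW Uf.
have F0 := ip_ge0 form Wf; have F1 : 0 < ip f f + 1 by rewrite ltr_wpDl.
have [N NH] := wd (e ^+ 2 / (ip f f + 1)) (divr_gt0 (exprn_gt0 2 e0) F1).
exists N => n Nn; have [Un _] := wP n; have Wn := UW Un.
rewrite -(@ler_pXn2r _ 2) ?nnegrE ?(ltW e0) // real_normK ?num_real //.
(* Along w n + t f the excess of Q over its infimum is a nonnegative quadratic in t, with linear
   coefficient twice ip f (w n) - phi f. *)
have := @quadratic_bound (Q (w n) - inf S) (ip f (w n) - phi f) (ip f f) F0.
move=> /(_ _)/le_trans; apply; last first.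
  by rewrite -ler_pdivlMr // lerBlDl; exact: NH.
move=> t; have := Qinf _ (UD Un (UZ t Uf)).
rewrite /Q phiD ?phiZ ?ip_sqD ?ip_Zr ?(ip_Zl form) //; [|exact: WZ..|exact: UZ].
by rewrite (ip_sym form Wn Wf); lra.
Qed.

End riesz.

Lemma riesz (phi : V -> R) (C : R) : complete_form -> (exists f, W f) ->
  (forall f g, W f -> W g -> phi (f + g) = phi f + phi g) ->
  (forall (a : R) f, W f -> phi (a%:C *: f) = a * phi f) ->
  (forall f, W f -> phi f ^+ 2 <= C * ip f f) ->
  exists2 l, W l & forall f, W f -> ip f l = phi f.
Proof.
move=> cW W0 phiD phiZ phiC.
have [w [Ww cw wphi]] := riesz_sequence (fun f Wf => Wf) W0 WD (fun a f => @WZ a%:C f) phiD phiZ phiC.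
have [l Wl wl] := cW w Ww cw; exists l => // f Wf.
apply/eqP; rewrite -subr_eq0 -normr_eq0 eq_le normr_ge0 andbT.
apply/ler_addgt0Pr => e e0; rewrite add0r; have e2 : 0 < e / 2 by rewrite divr_gt0.
have [N NH] := wphi f Wf _ e2; have [M MH] := cvg_in_ip Ww Wl Wf wl e2.
have := NH (maxn N M) (leq_maxl _ _); have := MH (maxn N M) (leq_maxr _ _).
rewrite distrC; have := ler_distD (ip f (w (maxn N M))) (ip f l) (phi f); lra.
Qed.

(** The minimizing sequence in U for the functional [ip^~ f] converges to a projection l of f on the
    closure of U. Then l - f is orthogonal to U, hence a null vector, and the sequence itself
    approximates f. *)
Lemma dense_of_orthogonal U : complete_form -> (exists f, U f) ->
  (forall f, U f -> W f) -> (forall f g, U f -> U g -> U (f + g)) ->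
  (forall (a : R) f, U f -> U (a%:C *: f)) ->
  (forall g, W g -> (forall s, U s -> ip s g = 0) -> ip g g = 0) ->
  forall f (e : R), W f -> 0 < e -> exists2 s, U s & ip (s - f) (s - f) <= e.
Proof.
move=> cW U0 UW UD UZ Uperp f e Wf e0.
have ip_CS' g : U g -> ip g f ^+ 2 <= ip f f * ip g g.
  by move=> Ug; rewrite mulrC; exact: ip_CS (UW _ Ug) Wf.
have [w [Uw cw wf]] := riesz_sequence (phi := ip^~ f) (C := ip f f) UW U0 UD UZ
  (fun g h Ug Uh => ip_Dl form (UW _ Ug) (UW _ Uh) Wf) (fun a g Ug => ip_Zl form a (UW _ Ug) Wf)
  ip_CS'.
have Ww n : W (w n) by exact/UW.
have [l Wl wl] := cW w Ww cw.
have lf : ip (l - f) (l - f) = 0.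
  apply: Uperp; first exact: rf_B.
  move=> s Us; have Ws := UW _ Us; rewrite ip_Br //.
  apply/eqP; rewrite -normr_eq0 eq_le normr_ge0 andbT.
  apply/ler_addgt0Pr => d d0; rewrite add0r; have d2 : 0 < d / 2 by rewrite divr_gt0.
  have [N NH] := wf s Us _ d2; have [M MH] := cvg_in_ip Ww Wl Ws wl d2.
  have := NH (maxn N M) (leq_maxl _ _); have := MH (maxn N M) (leq_maxr _ _).
  rewrite distrC; have := ler_distD (ip s (w (maxn N M))) (ip s l) (ip s f); lra.
have [N NH] := wl (e / 4) (divr_gt0 e0 (ltr0n _ 4)).
exists (w N); first exact: Uw.
have := NH N (leqnn N); have Wwl := rf_B (Ww N) Wl; have Wlf := rf_B Wl Wf.
rewrite (_ : w N - f = (w N - l) + (l - f)); last by rewrite addrA subrK.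
rewrite (ip_sqD Wwl Wlf) lf; have := ip_CS Wwl Wlf; rewrite lf mulr0 addr0 => h.
have -> : ip (w N - l) (l - f) = 0 by apply/eqP; rewrite -sqrf_eq0 eq_le h sqr_ge0.
by lra.
Qed.

End hermitian.

(** * Weighted Bergman spaces *)

Section fatou_varying.
Context {R : realType}.
Notation MR := (measurableTypeR R).
Implicit Types (D : set R[i]) (mu : R[i] -> R).

Lemma limn_einf_le (u : (\bar R)^nat) c : (forall n, (u n <= c)%E) -> (limn_einf u <= c)%E.
Proof.
move=> uc; rewrite limn_einf_lim; apply: lime_le; first exact: is_cvg_einfs.
near=> n; apply: le_trans (uc n); apply: ereal_inf_lbound; exists n => /=.
Unshelve. all: by end_near. Qed.

(** Fatou's lemma with domain, weight and function all varying; of the domains it uses only that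
    each point of D lies in all but finitely many of them. *)
Lemma fatou_sqnormL2 D mu (Ds : nat -> set R[i]) (mus : nat -> R[i] -> R) 
    (fs : nat -> R[i] -> R[i]) f (c : \bar R) :
  open D -> weight D mu -> (forall k, open (Ds k)) -> (forall k, weight (Ds k) (mus k)) ->
  (forall k, borel_on (Ds k) (fs k)) ->
  (forall z, D z -> \forall k \near \oo, Ds k z) ->
  ae_on D (fun z => mus k z @[k --> \oo] --> mu z) ->
  (forall z, D z -> cabs (fs k z) @[k --> \oo] --> cabs (f z)) ->
  (forall k, (sqnormL2 (Ds k) (mus k) (fs k) <= c)%E) -> (sqnormL2 D mu f <= c)%E.
Proof.
move=> oD wD oDs wDs bfs DDs [Na [mNa Na0 subNa]] fsf fsc.
have mu0 z : D z -> 0 < mu z by case: wD => _; apply.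
have mus0 k z : Ds k z -> 0 < mus k z by case: (wDs k) => _; apply.
have /choice[EN HEN] : forall k, exists EN : set (MR * MR) * set (MR * MR),
    [/\ measurable EN.1, measurable_fun EN.1 (fun p : MR * MR => mus k (toC p) : MR),
      EN.1 `<=` @toC R @^-1` (Ds k), measurable EN.2 /\ @area R EN.2 = 0%E &
      (@toC R @^-1` (Ds k)) `\` EN.1 `<=` EN.2].
  by move=> k; have [E [N HE]] := weight_borel (oDs k) (wDs k); exists (E, N).
have : (@area R).-negligible (Na `|` \bigcup_(k : nat) (EN k).2).
  apply: negligibleU; first by exists Na; split.
  apply: negligible_bigcup => k; have [_ _ _ [mN N0] _] := HEN k.
  by exists (EN k).2; split.
move=> [N [mN N0 subN]].
(* Extension by zero off the Borel part of [Ds k] makes the integrands Borel on the whole plane. Off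
   the null set N, a point of D lies in these Borel parts for all large k. *)
pose g k (p : MR * MR) : \bar R :=
  if p \in (EN k).1 then (cabs (fs k (toC p)) ^+ 2 * mus k (toC p))%:E else 0%E.
have mg k : measurable_fun setT (g k).
  have [mE mmu ED _ _] := HEN k.
  have mD := open_plane_measurable (oDs k).
  have m1 : measurable_fun (EN k).1 (fun p : MR * MR => (cabs (fs k (toC p)) ^+ 2 * mus k (toC p))%:E).
    apply/measurable_EFinP; apply: measurable_funM => //.
    have [fR fI] := bfs k.
    have fR' := measurable_funS mD ED fR; have fI' := measurable_funS mD ED fI.
    apply: eq_measurable_fun (measurable_funD (measurable_funM fR' fR') (measurable_funM fI' fI')).
    by move=> p _; rewrite /= cabs_sqr !expr2.
  have := (measurable_restrictT _ mE).1 m1; apply: eq_measurable_fun => p _.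
  by rewrite /patch.
have g0 k p : setT p -> (0 <= g k p)%E.
  move=> _; rewrite /g; case: ifPn => // /set_mem Ep; rewrite lee_fin mulr_ge0 ?sqr_ge0 //.
  by apply/ltW/mus0; have [_ _ ED _ _] := HEN k; exact: ED.
have gc k : (\int[@area R]_p g k p <= c)%E.
  apply: le_trans (fsc k); have [mE _ ED _ _] := HEN k.
  rewrite (_ : (\int[_]_p _)%E = (\int[@area R]_(p in (EN k).1)
     (cabs (fs k (toC p)) ^+ 2 * mus k (toC p))%:E)%E); last first.
    by rewrite [RHS]integral_mkcond; apply: eq_integral => p _; rewrite /patch.
  apply: (@ge0_ae_le_integral _ _ _ _ _ _ set0) => //.
  - by move=> p Ep; rewrite lee_fin mulr_ge0 ?sqr_ge0 //; apply/ltW/mus0; exact: ED.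
  - by move=> p Dp; rewrite lee_fin mulr_ge0 ?sqr_ge0 //; apply/ltW/mus0.
  - by move=> p _ Ep; split => //; exact: ED.
apply: le_trans (limn_einf_le gc).
apply: le_trans (fatou (@area R) measurableT mg g0).
apply: (@ge0_ae_le_integral _ _ _ _ _ _ N) => //.
- by move=> p Dp; rewrite lee_fin mulr_ge0 ?sqr_ge0 //; apply/ltW/mu0.
- move=> p _; rewrite limn_einf_lim; apply: lime_ge; first exact: is_cvg_einfs.
  by near=> n; apply: le_ereal_inf_tmp => _ [k _ <-]; exact: g0.
move=> p Np Dp; split => //.
have cg : g k p @[k --> \oo] --> (cabs (f (toC p)) ^+ 2 * mu (toC p))%:E.
  have : (cabs (fs k (toC p)) * cabs (fs k (toC p)) * mus k (toC p))%:E @[k --> \oo]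
      --> (cabs (f (toC p)) * cabs (f (toC p)) * mu (toC p))%:E.
    apply: cvg_EFin; first exact: nearW.
    apply: cvgM; first by apply: cvgM; exact: fsf.
    have : ~ Na p by move=> H; apply/Np/subN; left.
    by apply: contra_notP => H; apply: subNa => /= /(_ Dp).
  rewrite -expr2; apply: cvg_trans; apply: near_eq_cvg.
  near=> k; rewrite /g mem_set ?expr2 //.
  have Dk : Ds k (toC p) by near: k; exact: DDs.
  apply: contrapT => nE; have [_ _ _ _ sub] := HEN k.
  by apply/Np/subN; right; exists k => //; apply: sub.
rewrite is_cvg_limn_einfE; last by apply/cvg_ex; eexists; exact: cg.
by have /cvg_lim -> := cg.
Unshelve. all: by end_near. Qed.

End fatou_varying.

(** * Linearity and locality of iterated derivatives *)

Section holomorphic_linear.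
Context {R : realType}.
Implicit Types (D : set R[i]) (f g : R[i] -> R[i]).

Lemma holomorphicD D f g : holomorphic_on D f -> holomorphic_on D g -> holomorphic_on D (f + g).
Proof.
move=> hf hg z Dz.
exact: cderiv_derivable (cderivD (derivable_cderiv (hf z Dz)) (derivable_cderiv (hg z Dz))).
Qed.

Lemma holomorphicZ D c f : holomorphic_on D f -> holomorphic_on D (c *: f).
Proof.
move=> hf z Dz; exact: cderiv_derivable (cderivZ c (derivable_cderiv (hf z Dz))).
Qed.

Lemma holomorphicS D D' f : D `<=` D' -> holomorphic_on D' f -> holomorphic_on D f.
Proof. by move=> DD hf z /DD /hf. Qed.

Lemma derive1_add f g z : derivable f z 1 -> derivable g z 1 ->
  derive1 (f + g) z = derive1 f z + derive1 g z.
Proof.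
move=> df dg; exact: cderiv_derive1 (cderivD (derivable_cderiv df) (derivable_cderiv dg)).
Qed.

Lemma derive1_scale c f z : derivable f z 1 -> derive1 (c *: f) z = c * derive1 f z.
Proof. by move=> df; exact: cderiv_derive1 (cderivZ c (derivable_cderiv df)). Qed.

Lemma eq_holomorphic D f g : open D -> (forall z, D z -> f z = g z) ->
  holomorphic_on D f -> holomorphic_on D g.
Proof.
move=> oD fg hf z Dz; apply: cderiv_derivable.
exact: cderiv_ext oD Dz fg (derivable_cderiv (hf z Dz)).
Qed.

Lemma eq_derive1_on D f g : open D -> holomorphic_on D f -> (forall z, D z -> f z = g z) ->
  forall z, D z -> derive1 f z = derive1 g z.
Proof.
move=> oD hf fg z Dz; apply/esym/cderiv_derive1.
exact: cderiv_ext oD Dz fg (derivable_cderiv (hf z Dz)).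
Qed.

Lemma holomorphic_derive1n D n f : open D -> holomorphic_on D f ->
  holomorphic_on D (derive1n n f).
Proof. by move=> oD hf; elim: n => [//|n IH]; rewrite derive1nS; exact: holomorphic_derive1. Qed.

Lemma eq_derive1n_on D n f g : open D -> holomorphic_on D f -> (forall z, D z -> f z = g z) ->
  forall z, D z -> derive1n n f z = derive1n n g z.
Proof.
move=> oD hf fg; elim: n => [//|n IH] z Dz; rewrite !derive1nS.
have H := @holomorphic_derive1n D n _ oD hf.
exact (eq_derive1_on oD H IH Dz).
Qed.

Lemma derive1n_add D n f g z : open D -> holomorphic_on D f -> holomorphic_on D g -> D z ->
  derive1n n (f + g) z = derive1n n f z + derive1n n g z.
Proof.
move=> oD hf hg; elim: n z => [//|n IH] z Dz; rewrite !derive1nS.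
have Hf := @holomorphic_derive1n D n _ oD hf; have Hg := @holomorphic_derive1n D n _ oD hg.
have Hfg := @holomorphic_derive1n D n _ oD (holomorphicD hf hg).
by rewrite (eq_derive1_on oD Hfg IH Dz) (derive1_add (Hf z Dz) (Hg z Dz)).
Qed.

Lemma derive1n_scale D n c f z : open D -> holomorphic_on D f -> D z ->
  derive1n n (c *: f) z = c * derive1n n f z.
Proof.
move=> oD hf; elim: n z => [//|n IH] z Dz; rewrite !derive1nS.
have Hf := @holomorphic_derive1n D n _ oD hf.
have Hcf := @holomorphic_derive1n D n _ oD (@holomorphicZ D c f hf).
by rewrite (eq_derive1_on oD Hcf IH Dz) (derive1_scale c (Hf z Dz)).
Qed.

End holomorphic_linear.

(** * The space A^2 and its evaluations *)

Section bergman.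
Context {R : realType}.
Notation MR := (measurableTypeR R).
Variables (D : set R[i]) (mu : R[i] -> R).
Hypotheses (oD : open D) (adm : admissible D mu).
Implicit Types (f g : R[i] -> R[i]).

Let wD : weight D mu. Proof. by case: adm. Qed.

(** Equivalent to [A2] on an open D, the measurability clauses being automatic for holomorphic
    functions. *)
Definition bergman f := holomorphic_on D f /\ (sqnormL2 D mu f < +oo)%E.

Lemma bergman_sqi f : bergman f -> sqi D mu f.
Proof. by move=> [hf nf]; split => //; exact: holomorphic_borel. Qed.

Lemma borel_L2 f : sqi D mu f -> L2 D mu f.
Proof.
move=> [[fR fI] nf]; have mD := open_plane_measurable oD.
by split => //; exact: borel_lebesgue.
Qed.

Lemma bergman_A2 f : bergman f -> A2 D mu f.
Proof. by move=> bf; split; [exact/borel_L2/bergman_sqi|case: bf]. Qed.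

Lemma A2_bergman f : A2 D mu f -> bergman f.
Proof. by move=> [[_ _ nf] hf]. Qed.

Lemma bergmanD f g : bergman f -> bergman g -> bergman (f + g).
Proof.
move=> bf bg; split; first by apply: holomorphicD; [case: bf|case: bg].
by have [] := sqiD oD wD (bergman_sqi bf) (bergman_sqi bg).
Qed.

Lemma bergmanZ c f : bergman f -> bergman (c *: f).
Proof.
move=> bf; split; first by apply: holomorphicZ; case: bf.
by have [] := sqiZ oD wD c (bergman_sqi bf).
Qed.

Lemma bergman_form : real_form bergman (ipw D mu).
Proof.
split.
- exact: bergmanD.
- exact: bergmanZ.
- by move=> f g _ _; exact: ipwC.
- move=> f g h bf bg bh.
  exact: (ipwDl oD wD (bergman_sqi bf) (bergman_sqi bg) (bergman_sqi bh)).
- by move=> a f g bf bg; exact: (ipwZl oD wD a (bergman_sqi bf) (bergman_sqi bg)).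
- by move=> c f g _ _; exact: ipw_scale_l.
- by move=> f _; exact: ipw_ge0.
Qed.

Let form := bergman_form.
Local Notation nr := (nrm (ipw D mu)).

Lemma normL2E f : sqi D mu f -> normL2 D mu f = (nr f)%:E.
Proof. by move=> sf; rewrite /normL2 (sqnormL2E wD sf). Qed.

Lemma bergman0 : bergman (cst 0).
Proof.
split; first by move=> z _; exact: cderiv_derivable (cderiv_cst 0 z).
rewrite /sqnormL2 (_ : (\int[_]_(_ in _) _)%E = 0%E) ?ltry //.
by apply: integral0_eq => p _; rewrite (_ : cabs _ = 0) ?expr0n ?mul0r //; exact: Normc.normc0.
Qed.

(** Continuity of the evaluation at the zero function, with epsilon 1, gives a radius d; homogeneity
    does the rest after f is scaled to norm below d. *)
Lemma eval_bounded z : D z -> exists2 C : R, 0 <= C & forall f, bergman f ->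
  cabs (f z) ^+ 2 <= C * ipw D mu f f.
Proof.
move=> Dz; have [_ _ /(_ z Dz) ev] := adm.
have [d d0 dH] := ev _ (bergman_A2 bergman0) 1 ltr01.
exists (4 / d ^+ 2); first by rewrite divr_ge0 // exprn_ge0 // ltW.
move=> f bf; have N0 := ip_ge0 form bf; set N := ipw D mu f f in N0 *.
apply/ler_addgt0Pr => e e0.
(* Slightly more than the norm of f, so that division by s is possible for a null f; the slack
   becomes exactly e in the final bound 4 s^2 / d^2. *)
pose s := Num.sqrt (N + e * d ^+ 2 / 4).
have s2 : s ^+ 2 = N + e * d ^+ 2 / 4.
  by rewrite sqr_sqrtr // addr_ge0 // divr_ge0 // mulr_ge0 ?exprn_ge0 // ltW.
have sN : N < s ^+ 2 by rewrite s2 ltrDl divr_gt0 // mulr_gt0 // exprn_gt0.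
have s0 : 0 < s.
  by rewrite lt_def sqrtr_ge0 andbT; apply: contraTneq sN => ->; rewrite expr0n -leNgt.
pose l : R := d / (2 * s).
have l0 : 0 < l by rewrite divr_gt0 // mulr_gt0.
have bl := bergmanZ l%:C bf.
have nl : nr (l%:C *: f) < d.
  rewrite (nrm_Z form) // cabs_real gtr0_norm //.
  have nf : nr f < s by rewrite -(@ltr_pXn2r _ 2) ?nnegrE ?nrm_ge0 ?(ltW s0) // (nrm_sqr form).
  rewrite /l mulrAC ltr_pdivrMr ?mulr_gt0 //.
  have := nrm_ge0 (ipw D mu) f; nra.
have := dH _ (bergman_A2 bl).
rewrite (_ : (l%:C *: f \- cst 0) = l%:C *: f); last by apply/funext => w /=; rewrite subr0.
rewrite normL2E ?lte_fin; last exact: bergman_sqi.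
move=> /(_ nl); rewrite subr0 /= -[(l%:C *: f) z]/(l%:C * f z) cabsM cabs_real gtr0_norm // => H.
have {}H : cabs (f z) <= 2 * s / d.
  move: H; rewrite /l mulrAC ltr_pdivrMr ?mulr_gt0 // mul1r => /ltW H.
  by rewrite ler_pdivlMr // mulrC.
have -> : 4 / d ^+ 2 * N + e = (2 * s / d) ^+ 2.
  by rewrite !exprMn s2 exprVn; field; rewrite gt_eqF.
by rewrite lerXn2r ?nnegrE ?cabs_ge0 // divr_ge0 ?mulr_ge0 ?ltW.
Qed.

End bergman.

Lemma dependent_choice_from (T : Type) (P : T -> Prop) (r : T -> T -> Prop) (x0 : T) :
  P x0 -> (forall x, P x -> exists2 y, P y & r x y) ->
  exists u : nat -> T, [/\ u 0%N = x0, forall n, P (u n) & forall n, r (u n) (u n.+1)].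
Proof.
move=> P0 H; have /choice[s sP] : forall x, exists y, P x -> P y /\ r x y.
  move=> x; have [Px|nPx] := pselect (P x); last by exists x.
  by have [y Py rxy] := H x Px; exists y.
pose u n := iter n s x0.
have Pu n : P (u n) by elim: n => [//|n IH] /=; have [] := sP _ IH.
by exists u; split => // n; have [] := sP _ (Pu n).
Qed.

Lemma step_arith (F : realFieldType) (A B C s s' s0 : F) :
  A + s <= s0 -> s' <= s / 2 -> B <= s / 2 -> C <= B + A -> C + s' <= s0.
Proof. by lra. Qed.

(** * Completeness and locally uniform bounds for evaluations *)

Section bergman_complete.
Context {R : realType}.
Notation MR := (measurableTypeR R).
Variables (D : set R[i]) (mu : R[i] -> R).
Hypotheses (oD : open D) (adm : admissible D mu).
Implicit Types (f g : R[i] -> R[i]).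

Let wD : weight D mu. Proof. by case: adm. Qed.
Let form := bergman_form oD adm.
Local Notation nr := (nrm (ipw D mu)).
Local Notation berg := (bergman D mu).

Lemma cvg_of_dist (V : R[i] -> R) (u : nat -> R[i]) l :
  (forall z w, `|V z - V w| <= cabs (z - w)) ->
  (forall e : R, 0 < e -> exists N, forall n, (N <= n)%N -> cabs (u n - l) <= e) ->
  V (u n) @[n --> \oo] --> V l.
Proof.
move=> Vl ul; apply/cvgrPdist_le => e e0; have [N NH] := ul e e0.
exists N => // n /= Nn; rewrite distrC; exact: le_trans (Vl _ _) (NH n Nn).
Qed.

Lemma cabs_lip (z w : R[i]) : `|cabs z - cabs w| <= cabs (z - w).
Proof.
rewrite ler_norml.
by have := cabs_tri z w 0; have := cabs_tri w z 0; rewrite !subr0 (cabsBC w); lra.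
Qed.

Lemma ae_weightedL2_eq f g : ae_on D (fun z => f z = g z) ->
  (sqnormL2 D mu f <= sqnormL2 D mu g)%E.
Proof.
move=> [N [mN N0 fg]]; have [_ mu0] := wD.
apply: (@ge0_ae_le_integral _ _ _ _ _ _ N) => //.
- by move=> p Dp; rewrite lee_fin mulr_ge0 ?sqr_ge0 //; apply/ltW/mu0.
- by move=> p Dp; rewrite lee_fin mulr_ge0 ?sqr_ge0 //; apply/ltW/mu0.
move=> p Np Dp; split => //; suff -> : f (toC p) = g (toC p) by [].
by move: Np; apply: contra_notP => H; apply: fg => /= /(_ Dp).
Qed.

(* Evaluations are continuous, so a Cauchy sequence converges pointwise and Fatou
   turns the pointwise limit into an L^2 limit: Riesz-Fischer is not needed. *)
Lemma bergman_complete : complete_form berg (ipw D mu).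
Proof.
move=> w bw cw.
have /choice[h hP] : forall z, exists l, D z ->
    forall e : R, 0 < e -> exists N, forall n, (N <= n)%N -> cabs (w n z - l) <= e.
  move=> z; have [Dz|nDz] := pselect (D z); last by exists 0.
  have [C C0 CH] := eval_bounded oD adm Dz.
  have C1 : 0 < C + 1 by rewrite ltr_wpDl.
  have [|l lH] := @complex_cauchy_cvg R (fun n => w n z); last by exists l.
  move=> e e0; have [N NH] := cw (e ^+ 2 / (C + 1)) (divr_gt0 (exprn_gt0 2 e0) C1).
  exists N => m n Nm Nn.
  rewrite -(@ler_pXn2r _ 2) ?nnegrE ?cabs_ge0 ?(ltW e0) //.
  apply: (le_trans (CH _ (rf_B form (bw m) (bw n)))).
  have := NH m n Nm Nn; rewrite ler_pdivlMr // mulrDr mulr1 mulrC => H.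
  have := ip_ge0 form (rf_B form (bw m) (bw n)); lra.
have bh : borel_on D h.
  have hc (V : R[i] -> R) z : (forall z w, `|V z - V w| <= cabs (z - w)) -> D z ->
      V (w n z) @[n --> \oo] --> V (h z).
    by move=> Vl Dz; apply: cvg_of_dist => //; exact: hP.
  have mw n := bergman_sqi oD (bw n).
  split.
    apply: (@measurable_fun_cvg _ _ _ _ (fun n p => complex.Re (w n (toC p)))).
      by move=> n; have [[]] := mw n.
    by move=> p Dp; apply: hc => //; exact: Re_lip.
  apply: (@measurable_fun_cvg _ _ _ _ (fun n p => complex.Im (w n (toC p)))).
    by move=> n; have [[]] := mw n.
  by move=> p Dp; apply: hc => //; exact: Im_lip.
(* For fixed n, Fatou is applied to w n - w (N + k), which tends pointwise to w n - h as k grows. *)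
have wh (e : R) : 0 < e -> exists N, forall n, (N <= n)%N -> (sqnormL2 D mu (w n - h)%R <= e%:E)%E.
  move=> e0; have [N NH] := cw e e0; exists N => n Nn.
  apply: (@fatou_sqnormL2 R D mu (fun=> D) (fun=> mu) (fun k => w n - w (N + k)%N)) => //.
  - by move=> k; have [] := bergman_sqi oD (rf_B form (bw n) (bw (N + k)%N)).
  - by move=> z Dz; exact: nearW.
  - by apply: aeW => p _; exact: cvg_cst.
  - move=> z Dz; apply: cvg_of_dist; first exact: cabs_lip.
    move=> d d0; have [M MH] := hP z Dz d d0; exists M => k Mk.
    rewrite (_ : _ - _ = h z - w (N + k)%N z); last by rewrite !fctE; ring.
    by rewrite cabsBC; apply: MH; rewrite (leq_trans Mk) // leq_addl.
  move=> k; have bwk := rf_B form (bw n) (bw (N + k)%N).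
  rewrite (sqnormL2E wD (bergman_sqi oD bwk)) lee_fin; apply: NH => //.
  exact: leq_addr.
have sh : sqi D mu h.
  have [N NH] := wh 1 ltr01.
  have swh : sqi D mu (w N - h).
    split; last by apply: le_lt_trans (NH N (leqnn N)) _; rewrite ltry.
    have := borel_onD (proj1 (bergman_sqi oD (bw N))) (borel_onZ (-1) bh).
    by apply: eq_borel_on => z _; rewrite !fctE mulN1r.
  have := sqiD oD wD (bergman_sqi oD (bw N)) (sqiZ oD wD (-1) swh).
  by apply: eq_sqi => z _; rewrite !fctE; ring.
have swh n : sqi D mu (h - w n).
  have := sqiD oD wD sh (sqiZ oD wD (-1) (bergman_sqi oD (bw n))).
  by apply: eq_sqi => z _; rewrite !fctE; ring.
have swh' n : sqnormL2 D mu (h - w n) = sqnormL2 D mu (w n - h).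
  by apply: eq_integral => p _; rewrite !fctE cabsBC.
(* The pointwise limit h is not known to be holomorphic; closedness supplies a holomorphic g equal
   to it almost everywhere. *)
have [_ /(_ h (borel_L2 oD sh)) cl _] := adm.
have [|g Ag hg] := cl.
  move=> e e0; have e2 : 0 < e / 2 by rewrite divr_gt0.
  have [N NH] := wh ((e / 2) ^+ 2) (exprn_gt0 2 e2); exists (w N).
    exact: bergman_A2.
  rewrite [normL2 _ _ _](normL2E adm (swh N)) lte_fin.
  apply: (@le_lt_trans _ _ (e / 2)); last by lra.
  have := NH N (leqnn N); rewrite -swh' (sqnormL2E wD (swh N)) lee_fin => H.
  rewrite -(@ler_pXn2r _ 2) ?nnegrE ?nrm_ge0 ?(ltW e2) // sqr_sqrtr //.
  exact: ipw_ge0.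
have bg := A2_bergman Ag; exists g => // e e0; have [N NH] := wh e e0; exists N => n Nn.
have bwg := rf_B form (bw n) bg.
rewrite -lee_fin -(sqnormL2E wD (bergman_sqi oD bwg)); apply: le_trans (NH n Nn).
apply: ae_weightedL2_eq; case: hg => M [mM M0 MH]; exists M; split => // p Hp.
by apply: MH => H; apply: Hp => Dp; rewrite !fctE H.
Qed.

(* Uniform boundedness by nested balls: if the bound fails near a, one finds balls
   shrinking to some l in the space and points z_k -> a with |g z_k| > k for all g
   in the k-th ball; then l is unbounded near a. *)
Lemma bergman_local_bound a : D a -> exists2 r : R, 0 < r & exists2 C : R, 0 <= C &
  (forall z, cabs (z - a) <= r -> D z) /\
  forall f, berg f -> forall z, cabs (z - a) <= r -> cabs (f z) ^+ 2 <= C * ipw D mu f f.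
Proof.
move=> Da; have [r0 r00 r0D] := open_closed_disc oD Da.
apply: contrapT => nex.
(* A state consists of a stage number, the centre of a ball and its radius. *)
pose T : Type := nat * (R[i] -> R[i]) * R.
pose P (x : T) := berg x.1.2 /\ 0 < x.2.
pose rel (x y : T) := [/\ y.1.1 = x.1.1.+1, y.2 <= x.2 / 2, nr (y.1.2 - x.1.2) <= x.2 / 2 &
  exists z, [/\ D z, cabs (z - a) <= x.1.1.+1%:R^-1 &
    forall g, berg g -> nr (g - y.1.2) <= y.2 -> x.1.1%:R < cabs (g z)]].
have step x : P x -> exists2 y, P y & rel x y.
  case: x => [[k f] s] [/= bf s0].
  have k1 : 0 < k.+1%:R :> R by [].
  pose r := Num.min r0 k.+1%:R^-1.
  have rp : 0 < r by rewrite lt_min r00 invr_gt0.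
  (* If u violates the bound with this constant at z, then u scaled to have modulus k + 1 at z has
     norm at most s / 2. *)
  pose C := 4 * k.+1%:R ^+ 2 / s ^+ 2.
  have C0 : 0 < C by rewrite divr_gt0 ?mulr_gt0 ?exprn_gt0.
  have [u [bu [z [zr uz]]]] : exists u, berg u /\ exists z, cabs (z - a) <= r /\
      C * ipw D mu u u < cabs (u z) ^+ 2.
    apply: contrapT => H; apply: nex; exists r => //; exists C; first exact: ltW.
    split; first by move=> z zr; apply: r0D; apply: le_trans zr _; rewrite ge_min lexx.
    move=> u bu z zr; rewrite leNgt; apply/negP => lt; apply: H.
    by exists u; split => //; exists z.
  have Dz : D z by apply: r0D; apply: le_trans zr _; rewrite ge_min lexx.
  have zk : cabs (z - a) <= k.+1%:R^-1 by apply: le_trans zr _; rewrite ge_min lexx orbT.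
  have u0 := ip_ge0 form bu.
  have x0 : 0 < cabs (u z).
    rewrite lt_def cabs_ge0 andbT; apply: contraTneq uz => ->.
    by rewrite expr0n /= -leNgt mulr_ge0 // ltW.
  pose l := k.+1%:R / cabs (u z).
  have l0 : 0 < l by rewrite divr_gt0.
  pose v := l%:C *: u.
  have bv : berg v by exact: (rf_Z form).
  have vz : cabs (v z) = k.+1%:R.
    by rewrite /v -[(_ *: u) z]/(l%:C * u z) cabsM cabs_real gtr0_norm // /l divfK // gt_eqF.
  have nv : nr v <= s / 2.
    apply: (nrm_le form) => //; first by rewrite divr_ge0 // ltW.
    rewrite (ip_sqZ form) // cabs_real gtr0_norm // /l exprMn exprVn.
    rewrite mulrAC ler_pdivrMr ?exprn_gt0 //.
    have := ltW uz; rewrite /C mulrAC ler_pdivrMr ?exprn_gt0 // => H.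
    by rewrite exprMn exprVn -natrX; lra.
  (* The values of f + v and f - v at z differ by 2 v z, of modulus 2 (k + 1), so one of them has
     modulus at least k + 1. *)
  have [f' [bf' ff' f'z]] : exists f', [/\ berg f', nr (f' - f) <= s / 2 & k.+1%:R <= cabs (f' z)].
    have [h|h] := leP k.+1%:R (cabs ((f + v) z)).
      exists (f + v); split => //; first exact: (rf_D form).
      by rewrite addrC addKr.
    exists (f - v); split; first exact: (rf_B form).
      by rewrite addrC addKr -scaleN1r (nrm_Z form) // cabsN Normc.normc1 mul1r.
    have : cabs (2 * v z) <= cabs ((f + v) z) + cabs ((f - v) z).
      rewrite (_ : 2 * v z = (f + v) z - (f - v) z); first exact: cabsB.
      by rewrite !fctE; ring.
    rewrite cabsM vz -[2 : R[i]](rmorph_nat (real_complex R)) cabs_real normr_nat.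
    by move: h; set X := cabs _; lra.
  have [Cz Cz0 CzH] := eval_bounded oD adm Dz.
  have Cz1 : 0 < Cz + 1 by rewrite ltr_wpDl.
  (* On a ball of this radius evaluation at z moves by less than 1, so the modulus stays above k. *)
  pose s' := Num.min (s / 2) (Cz + 1)^-1.
  have s'0 : 0 < s' by rewrite lt_min divr_gt0 ?invr_gt0.
  exists (k.+1, f', s'); first by split.
  split => //=; first by rewrite ge_min lexx.
  exists z; split => // g bg gs.
  have bgf := rf_B form bg bf'.
  have : cabs ((g - f') z) < 1.
    rewrite -(@ltr_pXn2r _ 2) ?nnegrE ?cabs_ge0 // expr1n.
    apply: le_lt_trans (CzH _ bgf) _; rewrite -(nrm_sqr form) //.
    have : nr (g - f') <= (Cz + 1)^-1 by apply: le_trans gs _; rewrite ge_min lexx orbT.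
    have := nrm_ge0 (ipw D mu) (g - f'); set n := nr _ => n0 nC.
    have nC' : n * (Cz + 1) <= 1 by rewrite -ler_pdivlMr // mul1r.
    have n1 : n <= 1 by nra.
    have [n00|nn0] := eqVneq n 0; first by rewrite n00 expr0n mulr0.
    have np : 0 < n by rewrite lt_def nn0.
    by nra.
  have := cabs_tri (f' z) (g z) 0; rewrite !subr0 (cabsBC (f' z)).
  rewrite -[(g - f') z]/(g z - f' z).
  by move: f'z; rewrite -natr1; lra.
have [x [x0 Px rx]] := @dependent_choice_from T P rel (0%N, cst 0, 1) (conj (bergman0 D mu) ltr01) step.
have xk n : (x n).1.1 = n by elim: n => [|n IH]; [rewrite x0|have [-> _ _ _] := rx n; rewrite IH].
have bx n : berg (x n).1.2 by case: (Px n).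
have sx n : 0 < (x n).2 by case: (Px n).
have near m n : nr ((x (n + m)%N).1.2 - (x n).1.2) + (x (n + m)%N).2 <= (x n).2.
  elim: m => [|m IH].
    by rewrite addn0 subrr -(scale0r (x n).1.2) (nrm_Z form) // Normc.normc0 mul0r add0r.
  rewrite addnS; have [_ h1 h2 _] := rx (n + m)%N.
  have := nrm_D form (rf_B form (bx (n + m).+1) (bx (n + m)%N)) (rf_B form (bx (n + m)%N) (bx n)).
  by rewrite addrA subrK => h3; exact: step_arith IH h1 h2 h3.
have sx2 n : (x n).2 <= 1 / 2 ^+ n.
  elim: n => [|n IH]; first by rewrite x0 expr0 divr1.
  have [_ h _ _] := rx n; apply: le_trans h _.
  by rewrite exprSr invfM mulrA ler_pM2r // invr_gt0.
have [l bl xl] : exists2 l, berg l & cvg_in (ipw D mu) (fun n => (x n).1.2) l.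
  apply: bergman_complete; first exact: bx.
  move=> e e0; set N := Num.Def.archi_bound (4 / e); exists N => m n Nm Nn.
  have p2 : 0 < 2 ^+ N :> R by rewrite exprn_gt0.
  have NH : 4 / 2 ^+ N <= e.
    by rewrite ler_pdivrMr // -ler_pdivrMl // mulrC; exact/ltW/upper_nthrootP.
  rewrite -(nrm_sqr form (rf_B form (bx m) (bx n))).
  have := nrm_B form (rf_B form (bx m) (bx N)) (rf_B form (bx n) (bx N)).
  rewrite opprB addrA subrK.
  have := near (m - N)%N N; have := near (n - N)%N N; rewrite !subnKC //.
  have := sx m; have := sx n; have := sx2 N; have := nrm_ge0 (ipw D mu) ((x m).1.2 - (x n).1.2).
  set q := nr _; set q1 := nr _; set q2 := nr _ => q0 sN s1 s2 h1 h2 h3.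
  have qN : q <= 2 / 2 ^+ N by rewrite mul1r in sN; lra.
  apply: le_trans NH; apply: (@le_trans _ _ ((2 / 2 ^+ N) ^+ 2)).
    by rewrite lerXn2r // nnegrE divr_ge0 // ltW.
  have -> : (2 / 2 ^+ N) ^+ 2 = 4 * (2 ^+ N ^+ 2)^-1 :> R by rewrite exprMn exprVn -[2 ^+ 2]natrX.
  by rewrite ler_wpM2l // lef_pV2 ?posrE ?exprn_gt0 // expr2 ler_peMr ?(ltW p2) // exprn_ege1 // ler1n.
have lx n : nr (l - (x n).1.2) <= (x n).2.
  apply/ler_addgt0Pr => e e0; have [N NH] := xl (e ^+ 2) (exprn_gt0 2 e0).
  have := NH (n + N)%N (leq_addl _ _) => /(nrm_le form (rf_B form (bx _) bl) (ltW e0)) h1.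
  have := nrm_B form (rf_B form (bx (n + N)%N) (bx n)) (rf_B form (bx (n + N)%N) bl).
  rewrite opprB [_ - _ + _]addrC addrA subrK.
  by have := near N n; have := sx (n + N)%N; lra.
have [r1 r10 r1H] := cderiv_continuous (derivable_cderiv (bl.1 a Da)) ltr01.
(* Stage n offers a point z within r1 of a, where |l z| < |l a| + 1 < n, whereas membership of l in
   the next ball forces |l z| > n. *)
pose n := (Num.Def.archi_bound r1^-1 + Num.Def.archi_bound (cabs (l a) + 1))%N.
have [_ _ _ [z [Dz za /(_ l bl (lx _))]]] := rx n.
rewrite xk => nz.
have zr : cabs (z - a) < r1.
  apply: le_lt_trans za _; rewrite xk -[ltRHS]invrK ltf_pV2 ?posrE ?invr_gt0 //.
  apply: lt_le_trans (archi_boundP _) _; first by rewrite invr_ge0 ltW.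
  by rewrite ler_nat /n -addnS leq_addr.
have h1 := r1H z zr.
have h2 : cabs (l a) + 1 < n%:R.
  apply: lt_le_trans (archi_boundP _) _; first by rewrite addr_ge0 ?cabs_ge0.
  by rewrite ler_nat /n leq_addl.
have := cabs_tri (l z) (l a) 0; rewrite !subr0; lra.
Qed.

Lemma bergman_derive1n_bound a n : D a -> exists2 C : R, 0 <= C & forall f, berg f ->
  cabs (derive1n n f a) ^+ 2 <= C * ipw D mu f f.
Proof.
move=> Da; have [r r0 [C C0 [rD CH]]] := bergman_local_bound Da.
have [B B0 BH] := @derive1n_estimate R n r r0.
exists (B ^+ 2 * C); first by rewrite mulr_ge0 ?sqr_ge0.
move=> f bf; have N0 := ip_ge0 form bf.
have M0 : 0 <= C * ipw D mu f f by rewrite mulr_ge0.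
have := BH D f a (Num.sqrt (C * ipw D mu f f)) oD (proj1 bf) rD.
have fM w : cabs (w - a) <= r -> cabs (f w) <= Num.sqrt (C * ipw D mu f f).
  move=> wr; rewrite -(@ler_pXn2r _ 2) ?nnegrE ?cabs_ge0 ?sqrtr_ge0 // sqr_sqrtr //.
  exact: CH.
move=> /(_ fM) H; rewrite -mulrA -(sqr_sqrtr M0) -exprMn lerXn2r ?nnegrE ?cabs_ge0 //.
by rewrite mulr_ge0 ?sqrtr_ge0.
Qed.

End bergman_complete.

(** * The spaces AD and their kernels *)

Lemma eq_ipw_l (R : realType) (D : set R[i]) mu (f f' g : R[i] -> R[i]) :
  (forall z, D z -> f z = f' z) -> ipw D mu f g = ipw D mu f' g.
Proof. by move=> ff; exact: eq_ipw. Qed.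

Lemma eq_ipw_r (R : realType) (D : set R[i]) mu (f g g' : R[i] -> R[i]) :
  (forall z, D z -> g z = g' z) -> ipw D mu f g = ipw D mu f g'.
Proof. by move=> gg; exact: eq_ipw. Qed.

Section dirichlet.
Context {R : realType}.
Notation MR := (measurableTypeR R).
Variables (D : set R[i]) (mu : R[i] -> R).
Hypotheses (oD : open D) (adm : admissible D mu).
Implicit Types (f g : R[i] -> R[i]).

Let wD : weight D mu. Proof. by case: adm. Qed.
Let form := bergman_form oD adm.

Definition ipAD f g := ipw D mu (derive1 f) (derive1 g).

Lemma AD_bergman xi n f : AD D mu xi n f -> bergman D mu (derive1 f).
Proof. by move=> [hf _ nf]; split; [exact (holomorphic_derive1 oD hf)|exact nf]. Qed.

Lemma AD_holomorphic xi n f : AD D mu xi n f -> holomorphic_on D f.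
Proof. by case. Qed.

Lemma AD_mono xi m n f : (m <= n)%N -> AD D mu xi n f -> AD D mu xi m f.
Proof. by move=> mn [hf f0 nf]; split => // k km; apply: f0; exact: leq_trans mn. Qed.

Lemma derive1_addD f g : holomorphic_on D f -> holomorphic_on D g ->
  forall z, D z -> (derive1 f + derive1 g) z = derive1 (f + g) z.
Proof. by move=> hf hg z Dz; rewrite (derive1_add (hf z Dz) (hg z Dz)). Qed.

Lemma derive1_scaleD c f : holomorphic_on D f ->
  forall z, D z -> (c *: derive1 f) z = derive1 (c *: f) z.
Proof. by move=> hf z Dz; rewrite (derive1_scale c (hf z Dz)). Qed.

Lemma ADD xi n f g : D xi -> AD D mu xi n f -> AD D mu xi n g -> AD D mu xi n (f + g).
Proof.
move=> Dxi Af Ag; have [hf f0 _] := Af; have [hg g0 _] := Ag; split.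
- exact: holomorphicD.
- by move=> k kn; rewrite (derive1n_add k oD hf hg Dxi) f0 // g0 // addr0.
- rewrite -(eq_sqnormL2 mu (derive1_addD hf hg)).
  by have [] := bergmanD oD adm (AD_bergman Af) (AD_bergman Ag).
Qed.

Lemma ADZ xi n c f : D xi -> AD D mu xi n f -> AD D mu xi n (c *: f).
Proof.
move=> Dxi Af; have [hf f0 _] := Af; split.
- exact: holomorphicZ.
- by move=> k kn; rewrite (derive1n_scale k c oD hf Dxi) f0 // mulr0.
- rewrite -(eq_sqnormL2 mu (derive1_scaleD c hf)).
  by have [] := bergmanZ oD adm c (AD_bergman Af).
Qed.

Lemma AD0 xi n : D xi -> AD D mu xi n (cst 0).
Proof.
move=> Dxi; have d0 z : derive1 (cst 0 : R[i] -> R[i]) z = 0.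
  exact: cderiv_derive1 (cderiv_cst 0 z).
have E : derive1 (cst 0 : R[i] -> R[i]) = cst 0 by apply/funext => z; rewrite d0.
split.
- by move=> z _; exact: cderiv_derivable (cderiv_cst 0 z).
- by move=> k _; elim: k => [//|k IH]; rewrite derive1Sn E.
- by rewrite E; have [] := bergman0 D mu.
Qed.

Lemma AD_form xi n : D xi -> real_form (AD D mu xi n) ipAD.
Proof.
move=> Dxi; split.
- by move=> f g; exact: ADD.
- by move=> c f; exact: ADZ.
- by move=> f g _ _; exact: ipwC.
- move=> f g h Af Ag Ah; rewrite /ipAD.
  have E := derive1_addD (AD_holomorphic Af) (AD_holomorphic Ag).
  have E2 := @eq_ipw_l R D mu (derive1 f + derive1 g) (derive1 (f + g)) (derive1 h) E.
  exact (etrans (esym E2) (ip_Dl form (AD_bergman Af) (AD_bergman Ag) (AD_bergman Ah))).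
- move=> a f g Af Ag; rewrite /ipAD.
  have E := derive1_scaleD a%:C (AD_holomorphic Af).
  have E2 := @eq_ipw_l R D mu (a%:C *: derive1 f) (derive1 (a%:C *: f)) (derive1 g) E.
  exact (etrans (esym E2) (ip_Zl form a (AD_bergman Af) (AD_bergman Ag))).
- move=> c f g Af Ag; rewrite /ipAD.
  have E := derive1_scaleD c (AD_holomorphic Af).
  have E' := derive1_scaleD c^*%C (AD_holomorphic Ag).
  have E2 := @eq_ipw_l R D mu (c *: derive1 f) (derive1 (c *: f)) (derive1 g) E.
  have E3 := @eq_ipw_r R D mu (derive1 f) (c^*%C *: derive1 g) (derive1 (c^*%C *: g)) E'.
  exact (etrans (esym E2) (etrans (ip_adj form c (AD_bergman Af) (AD_bergman Ag)) E3)).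
- by move=> f Af; exact: (ip_ge0 form (AD_bergman Af)).
Qed.

Lemma holomorphic_lipschitz f a (r M : R) : (forall z, cabs (z - a) <= r -> D z) ->
  holomorphic_on D f -> (forall z, cabs (z - a) <= r -> cabs (derive1 f z) <= M) ->
  forall z w, cabs (z - a) <= r -> cabs (w - a) <= r -> cabs (f z - f w) <= M * cabs (z - w).
Proof.
move=> rD hf fM z w zr wr.
have := @mean_value01 R (fun t => f (seg w z t)) (fun t => derive1 f (seg w z t) * (z - w))
  (M * cabs (z - w)).
rewrite seg0 seg1; apply => t t01; have sr := seg_dist t01 wr zr.
  by apply: rderiv_comp (seg_rderiv _ _ _); apply/derivable_cderiv/hf/rD.
by rewrite cabsM ler_wpM2r ?cabs_ge0 // fM.
Qed.

(** The energy controls f' near every point and thereby the oscillation of f, but not its size. The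
    set S of points where f is controlled contains xi, because f xi = 0, and is open and closed in
    D. *)
Lemma AD_local_bound xi n a : connected D -> D xi -> (0 < n)%N -> D a ->
  exists2 r : R, 0 < r & exists2 C : R, 0 <= C &
  (forall z, cabs (z - a) <= r -> D z) /\
  forall f, AD D mu xi n f -> forall z, cabs (z - a) <= r -> cabs (f z) ^+ 2 <= C * ipAD f f.
Proof.
move=> cD Dxi n0.
pose S := [set a | D a /\ exists C : R, forall f, AD D mu xi n f -> cabs (f a) ^+ 2 <= C * ipAD f f].
have loc b : D b -> exists2 r : R, 0 < r & (forall z, cabs (z - b) <= r -> D z) /\
    forall w, cabs (w - b) <= r -> S w -> exists2 C : R, 0 <= C & forall f, AD D mu xi n f ->
      forall z, cabs (z - b) <= r -> cabs (f z) ^+ 2 <= C * ipAD f f.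
  move=> Db; have [r r0 [C C0 [rD CH]]] := bergman_local_bound oD adm Db.
  exists r => //; split => // w wr [_ [C1 C1H]].
  exists (2 * C * (2 * r) ^+ 2 + 2 * `|C1|); first by apply: addr_ge0; apply: mulr_ge0; rewrite ?sqr_ge0 // mulr_ge0.
  move=> f Af z zr; have N0 := ip_ge0 (AD_form n Dxi) Af.
  have M0 : 0 <= C * ipAD f f by rewrite mulr_ge0.
  have fM u : cabs (u - b) <= r -> cabs (derive1 f u) <= Num.sqrt (C * ipAD f f).
    move=> ur; rewrite -(@ler_pXn2r _ 2) ?nnegrE ?cabs_ge0 ?sqrtr_ge0 // sqr_sqrtr //.
    exact: CH (AD_bergman Af) u ur.
  have L := holomorphic_lipschitz rD (AD_holomorphic Af) fM zr wr.
  have zw : cabs (z - w) <= 2 * r by apply: (le_trans (cabs_tri _ b _)); rewrite (cabsBC b); lra.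
  have L2 : cabs (f z - f w) ^+ 2 <= C * ipAD f f * (2 * r) ^+ 2.
    have r20 : 0 <= 2 * r by rewrite mulr_ge0 // ltW.
    rewrite -(sqr_sqrtr M0) -exprMn lerXn2r ?nnegrE ?cabs_ge0 ?(mulr_ge0 (sqrtr_ge0 _) r20) //.
    by apply: (le_trans L); rewrite ler_wpM2l ?sqrtr_ge0.
  have fw : cabs (f w) ^+ 2 <= `|C1| * ipAD f f.
    by apply: (le_trans (C1H _ Af)); rewrite ler_wpM2r // ler_norm.
  have tri : cabs (f z) <= cabs (f z - f w) + cabs (f w).
    by have := cabs_tri (f z) (f w) 0; rewrite !subr0.
  have tri2 : cabs (f z) ^+ 2 <= 2 * cabs (f z - f w) ^+ 2 + 2 * cabs (f w) ^+ 2.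
    have h : cabs (f z) ^+ 2 <= (cabs (f z - f w) + cabs (f w)) ^+ 2.
      by rewrite lerXn2r ?nnegrE ?addr_ge0 ?cabs_ge0.
    apply: (le_trans h); have := sqr_ge0 (cabs (f z - f w) - cabs (f w)).
    by rewrite sqrrB sqrrD !mulr2n; lra.
  apply: (le_trans tri2).
  apply: (@le_trans _ _ (2 * (C * ipAD f f * (2 * r) ^+ 2) + 2 * (`|C1| * ipAD f f))).
    by apply: lerD; apply: ler_wpM2l.
  by rewrite le_eqVlt; apply/orP; left; apply/eqP; ring.
have Sxi : S xi.
  split=> //; exists 0 => f [_ f0 _]; have := f0 0%N n0 => /= ->.
  by rewrite Normc.normc0 expr0n mul0r.
suff SD : S = D.
  move=> Da; have [r r0 [rD H]] := loc a Da; exists r => //.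
  have Sa : S a by rewrite SD.
  have aa : cabs (a - a) <= r by rewrite subrr Normc.normc0 ltW.
  by have [C C0 CH] := H a aa Sa; exists C.
apply: cD; first by exists xi.
  exists S; last by apply/seteqP; split => z; [move=> Sz; split => //; case: Sz|case].
  apply/open_cabsP => b Sb; have [r r0 [rD H]] := loc b (proj1 Sb).
  have bb : cabs (b - b) <= r by rewrite subrr Normc.normc0 ltW.
  have [C C0 CH] := H b bb Sb.
  exists r => // w /ltW wr; split; first exact: rD.
  by exists C => f Af; exact: CH.
exists (~` (D `\` S)); last first.
  by apply/seteqP; split => z; [move=> Sz; split; [case: Sz|case]|move=> [Dz]; apply: contra_notP => nS; split].
apply: open_closedC; apply/open_cabsP => b [Db nSb]; have [r r0 [rD H]] := loc b Db.
exists r => // w /ltW wr; split; first exact: rD.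
move=> Sw; apply: nSb; split => //; have [C C0 CH] := H w wr Sw.
by exists C => f Af; apply: CH => //; rewrite subrr Normc.normc0 ltW.
Qed.

Lemma AD_derive1n_bound xi n k : D xi -> (0 < n)%N -> exists2 C : R, 0 <= C & forall f, AD D mu xi n f ->
  cabs (derive1n k f xi) ^+ 2 <= C * ipAD f f.
Proof.
move=> Dxi n0; case: k => [|k].
  exists 0 => // f [_ f0 _]; have := f0 0%N n0 => /= ->.
  by rewrite Normc.normc0 expr0n mul0r.
have [C C0 CH] := bergman_derive1n_bound oD adm k Dxi.
by exists C => // f Af; rewrite derive1Sn; apply: CH; exact: AD_bergman Af.
Qed.

End dirichlet.

(** * Completeness of AD and existence of kernels *)

Section kernel.
Context {R : realType}.
Variables (D : set R[i]) (mu : R[i] -> R).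
Hypotheses (oD : open D) (adm : admissible D mu).
Implicit Types (f g : R[i] -> R[i]).

Let form := bergman_form oD adm.
Local Notation E := (ipAD D mu).

Lemma derive1_subD f g : holomorphic_on D f -> holomorphic_on D g ->
  forall z, D z -> (derive1 f - derive1 g) z = derive1 (f - g) z.
Proof.
move=> hf hg z Dz; apply/esym.
exact: cderiv_derive1 (cderivB (derivable_cderiv (hf z Dz)) (derivable_cderiv (hg z Dz))).
Qed.

Lemma ipAD_sub f g : holomorphic_on D f -> holomorphic_on D g ->
  E (f - g) (f - g) = ipw D mu (derive1 f - derive1 g) (derive1 f - derive1 g).
Proof.
move=> hf hg; have H := derive1_subD hf hg; have H' z Dz := esym (H z Dz).
exact (@eq_ipw R D mu _ _ _ _ H' H').
Qed.

(** The derivatives converge to some h in A^2 and the functions converge pointwise to some f;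
    locally uniform convergence of the derivatives gives f' = h. The vanishing at xi survives
    because the functionals f -> f^(k)(xi) are bounded. *)
Lemma AD_complete xi n : connected D -> D xi -> (0 < n)%N -> complete_form (AD D mu xi n) E.
Proof.
move=> cD Dxi n0 w Aw cw.
have hw k : holomorphic_on D (w k) by case: (Aw k).
have bw k : bergman D mu (derive1 (w k)) := AD_bergman oD (Aw k).
have [h bh wh] : exists2 h, bergman D mu h & cvg_in (ipw D mu) (fun k => derive1 (w k)) h.
  apply: (bergman_complete oD adm bw) => e e0; have [N NH] := cw e e0; exists N => p q Np Nq.
  by rewrite -(ipAD_sub (hw p) (hw q)); exact: NH.
have hh : holomorphic_on D h by case: bh.
have aform := AD_form oD adm n Dxi.
have /choice[f fP] : forall z, exists l, D z ->
    forall e : R, 0 < e -> exists N, forall k, (N <= k)%N -> cabs (w k z - l) <= e.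
  move=> z; have [Dz|nDz] := pselect (D z); last by exists 0.
  have [r r0 [C C0 [rD CH]]] := AD_local_bound oD adm cD Dxi n0 Dz.
  have C1 : 0 < C + 1 by rewrite ltr_wpDl.
  have [|l lH] := @complex_cauchy_cvg R (fun k => w k z); last by exists l.
  move=> e e0; have [N NH] := cw (e ^+ 2 / (C + 1)) (divr_gt0 (exprn_gt0 2 e0) C1).
  exists N => p q Np Nq.
  have zz : cabs (z - z) <= r by rewrite subrr Normc.normc0 ltW.
  have Apq := rf_B aform (Aw p) (Aw q).
  rewrite -(@ler_pXn2r _ 2) ?nnegrE ?cabs_ge0 ?(ltW e0) //.
  apply: (le_trans (CH _ Apq z zz)).
  have := NH p q Np Nq; rewrite ler_pdivlMr // mulrDr mulr1 mulrC => H.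
  by have := ip_ge0 aform Apq; move: H; set x := E _ _; lra.
have fd z : D z -> cderiv f z (h z).
  move=> Dz e e0; have [r r0 [C C0 [rD CH]]] := bergman_local_bound oD adm Dz.
  have [s s0 sH] := cderiv_continuous (derivable_cderiv (hh z Dz)) e0.
  exists (Num.min r s); first by rewrite lt_min r0.
  move=> u; rewrite lt_min => /andP[ur us]; have Du : D u := rD u (ltW ur).
  apply/ler_addgt0Pr => d d0.
  have q0 : 0 < cabs (u - z) + 3 by rewrite ltr_wpDl ?cabs_ge0.
  (* The error consists of e' at each of z and u, plus e' |u - z| from replacing the k-th derivative
     by h; together these stay below d. *)
  pose e' := d / (cabs (u - z) + 3); have e'0 : 0 < e' by rewrite divr_gt0.
  have [N1 N1H] := fP z Dz e' e'0; have [N2 N2H] := fP u Du e' e'0.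
  have C1 : 0 < C + 1 by rewrite ltr_wpDl.
  have [N3 N3H] := wh (e' ^+ 2 / (C + 1)) (divr_gt0 (exprn_gt0 2 e'0) C1).
  pose k := (N1 + N2 + N3)%N.
  have k1 : (N1 <= k)%N by rewrite /k -addnA leq_addr.
  have k2 : (N2 <= k)%N by rewrite /k addnAC leq_addl.
  have k3 : (N3 <= k)%N by rewrite /k leq_addl.
  have kh v : cabs (v - z) <= r -> cabs (derive1 (w k) v - h v) <= e'.
    move=> vr; have bkh := rf_B form (bw k) bh.
    rewrite -(@ler_pXn2r _ 2) ?nnegrE ?cabs_ge0 ?(ltW e'0) //.
    apply: (le_trans (CH _ bkh v vr)).
    have := N3H k k3; rewrite ler_pdivlMr // mulrDr mulr1 mulrC => H.
    by have := ip_ge0 form bkh; move: H; set x := ipw _ _ _ _; lra.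
  have zz : cabs (z - z) <= cabs (u - z) by rewrite subrr Normc.normc0 cabs_ge0.
  have main : cabs (w k u - w k z - h z * (u - z)) <= (e + e') * cabs (u - z).
    have := @mean_value01 R (fun t => w k (seg z u t) - h z * seg z u t)
      (fun t => derive1 (w k) (seg z u t) * (u - z) - h z * (u - z)) ((e + e') * cabs (u - z)).
    rewrite seg0 seg1 (_ : w k u - h z * u - _ = w k u - w k z - h z * (u - z)); last by ring.
    apply => t t01; have st := seg_dist t01 zz (lexx (cabs (u - z))).
      apply: rderivB; last by apply: rderivZ; exact: seg_rderiv.
      apply: rderiv_comp (seg_rderiv _ _ _); apply/derivable_cderiv/hw/rD.
      exact: le_trans st (ltW ur).
    rewrite -mulrBl cabsM ler_wpM2r ?cabs_ge0 //.
    apply: (le_trans (cabs_tri _ (h (seg z u t)) _)); rewrite addrC; apply: lerD.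
      by apply/ltW/sH; exact: le_lt_trans us.
    by apply: kh; exact: le_trans st (ltW ur).
  have dE : d = e' * (cabs (u - z) + 3) by rewrite /e' divfK // gt_eqF.
  have h1 := N1H k k1; have h2 := N2H k k2.
  rewrite (_ : f u - f z - h z * (u - z) = (w k u - w k z - h z * (u - z)) - (w k u - f u) + (w k z - f z)); last by ring.
  apply: (le_trans (cabsD _ _)).
  have h3 := cabsB (w k u - w k z - h z * (u - z)) (w k u - f u).
  rewrite dE; move: h1 h2 h3 main e'0; set x1 := cabs (w k z - f z); set x2 := cabs (w k u - f u).
  by set x3 := cabs (_ - _ - _ * _); set x4 := cabs (_ - (_ - _)); set x5 := cabs (u - z); lra.
have hf : holomorphic_on D f by move=> z Dz; exact: cderiv_derivable (fd z Dz).
have f'h z : D z -> derive1 f z = h z by move=> Dz; exact: cderiv_derive1 (fd z Dz).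
exists f; first split.
- exact hf.
- case=> [_|j jn].
    rewrite derive1n0.
    apply/eqP; rewrite -cabs_eq0 eq_le cabs_ge0 andbT; apply/ler_addgt0Pr => e e0; rewrite add0r.
    have [N NH] := fP xi Dxi e e0; have := NH N (leqnn N).
    by have [_ /(_ 0%N n0) /= -> _] := Aw N; rewrite sub0r cabsN.
  rewrite derive1Sn.
  have hf' : holomorphic_on D (derive1 f) := holomorphic_derive1 oD hf.
  rewrite (eq_derive1n_on j oD hf' f'h Dxi).
  have [C C0 CH] := bergman_derive1n_bound oD adm j Dxi.
  have C1 : 0 < C + 1 by rewrite ltr_wpDl.
  apply/eqP; rewrite -cabs_eq0 -sqrf_eq0 eq_le sqr_ge0 andbT.
  apply/ler_addgt0Pr => e e0; rewrite add0r.
  have [N NH] := wh (e / (C + 1)) (divr_gt0 e0 C1).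
  have bNh := rf_B form (bw N) bh.
  have := CH _ bNh.
  rewrite (derive1n_add j oD (proj1 (bw N)) (proj1 (rf_N form bh)) Dxi).
  rewrite -derive1Sn (_ : derive1n j.+1 (w N) xi = 0); last by case: (Aw N) => _ /(_ _ jn).
  rewrite add0r -scaleN1r (derive1n_scale j (-1) oD hh Dxi) mulN1r cabsN scaleN1r => H.
  apply: (le_trans H); have := NH N (leqnn N); rewrite ler_pdivlMr // mulrDr mulr1 mulrC.
  by have := ip_ge0 form bNh; set x := ipw _ _ _ _; lra.
- by rewrite (eq_sqnormL2 mu f'h); case: bh.
move=> e e0; have [N NH] := wh e e0; exists N => k Nk.
rewrite (ipAD_sub (hw k) hf).
have H z : D z -> (derive1 (w k) - derive1 f) z = (derive1 (w k) - h) z.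
  by move=> Dz; rewrite !fctE f'h.
by rewrite (@eq_ipw R D mu _ _ _ _ H H); exact: NH.
Qed.

(** Im w = Re (-i w), so the real form carries the whole Hermitian product. *)
Lemma innerADE f g : innerAD D mu f g =
  ipAD D mu f g +i* ipw D mu (fun z => - 'i%C * derive1 f z) (derive1 g).
Proof.
rewrite /innerAD /ipAD; congr (_ +i* _).
apply: eq_Rintegral => p _; congr (_ * _).
by case: (derive1 f _) (derive1 g _) => [a b] [c d] /=; ring.
Qed.

(** Riesz represents f -> Re f^(n)(xi); testing the representing function on -i f supplies the
    imaginary part of the reproducing identity. *)
Lemma kernel_exists xi n : connected D -> D xi -> (0 < n)%N ->
  exists M, is_kernel D mu n xi M.
Proof.
move=> cD Dxi n0; have aform := AD_form oD adm n Dxi.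
have [C C0 CH] := AD_derive1n_bound oD adm n Dxi n0.
have hol f : AD D mu xi n f -> holomorphic_on D f by case.
have [M AM MP] : exists2 M, AD D mu xi n M & forall f, AD D mu xi n f ->
    E f M = complex.Re (derive1n n f xi).
  have cpl := AD_complete cD Dxi n0.
  have ex0 : exists f, AD D mu xi n f by exists (cst 0); exact (AD0 mu n Dxi).
  have phiD f g : AD D mu xi n f -> AD D mu xi n g -> complex.Re (derive1n n (f + g) xi) =
      complex.Re (derive1n n f xi) + complex.Re (derive1n n g xi).
    move=> Af Ag; rewrite (derive1n_add n oD (hol f Af) (hol g Ag) Dxi).
    by case: (derive1n n f xi) (derive1n n g xi) => [? ?] [? ?].
  have phiZ (a : R) f : AD D mu xi n f -> complex.Re (derive1n n (a%:C *: f) xi) =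
      a * complex.Re (derive1n n f xi).
    move=> Af; rewrite (derive1n_scale n a%:C oD (hol f Af) Dxi).
    by case: (derive1n n f xi) => [x y] /=; rewrite mul0r subr0.
  have phiC f : AD D mu xi n f -> complex.Re (derive1n n f xi) ^+ 2 <= C * E f f.
    move=> Af; apply: le_trans (CH f Af).
    by rewrite -real_normK ?num_real // lerXn2r ?nnegrE ?cabs_ge0 // Re_le_cabs.
  exact (riesz aform cpl ex0 phiD phiZ phiC).
exists M; split; first exact AM.
move=> f Af; rewrite innerADE (MP f Af).
have Aif := rf_Z aform (- 'i%C) Af.
have := MP _ Aif; rewrite (derive1n_scale n _ oD (hol f Af) Dxi).
have H := derive1_scaleD (- 'i%C) (hol f Af).
rewrite /ipAD -(@eq_ipw_l R D mu _ _ (derive1 M) H).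
rewrite -[_ *: derive1 f]/(fun z => - 'i%C * derive1 f z) => ->.
by case: (derive1n n f xi) => [x y] /=; congr (_ +i* _); ring.
Qed.

Lemma kernelMP xi n : connected D -> D xi -> (0 < n)%N ->
  AD D mu xi n (kernelM D mu n xi) /\
  forall f, AD D mu xi n f -> E f (kernelM D mu n xi) = complex.Re (derive1n n f xi).
Proof.
move=> cD Dxi n0; have [M MK] := kernel_exists cD Dxi n0.
have : is_kernel D mu n xi (kernelM D mu n xi) by apply: xgetPex; exists M.
by move=> [AK K]; split; [exact AK|move=> f Af; rewrite (K f Af) innerADE].
Qed.

End kernel.

(** * Comparison of kernels on nested domains *)

Section comparison.
Context {R : realType}.
Implicit Types (D : set R[i]) (mu : R[i] -> R) (f g : R[i] -> R[i]).

(** Compactness in its near-covering form passes from discs around the points of K to K itself, for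
    the inclusion in [Ds k] and for the distance alike. *)
Lemma locally_uniform_of_local (Ds : nat -> set R[i]) D F G :
  (forall a, D a -> exists2 r : R, 0 < r & forall e : R, 0 < e ->
    exists N, forall k, (N <= k)%N -> forall z, cabs (z - a) < r ->
      Ds k z /\ cabs (G z - F k z) <= e) ->
  cvg_locally_uniformly Ds D F G.
Proof.
move=> H K cK KD; move/compact_near_coveringP: cK => cK; split.
  apply: (cK nat \oo (fun k z => Ds k z)) => a Ka.
  have [r r0 rH] := H a (KD a Ka); have [N NH] := rH 1 ltr01.
  exists ([set z | cabs (z - a) < r], [set k | (N <= k)%N]).
    by split; [apply/near_cabsP; exists r|exists N].
  by move=> [z k] [/= zr Nk]; have [] := NH k Nk z zr.
move=> P /uniform_nbhs[E [entE EP]].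
move: entE; rewrite -entourage_ballE => -[e0 /= /gt0_complexE[e ep ->] eE].
have e2 : 0 < e / 2 by rewrite divr_gt0.
have : \forall k \near \oo, K `<=` (fun z => cabs (G z - F k z) <= e / 2).
  apply: (cK nat \oo (fun k z => cabs (G z - F k z) <= e / 2)) => a Ka.
  have [r r0 rH] := H a (KD a Ka); have [N NH] := rH _ e2.
  exists ([set z | cabs (z - a) < r], [set k | (N <= k)%N]).
    by split; [apply/near_cabsP; exists r|exists N].
  by move=> [z k] [/= zr Nk]; have [] := NH k Nk z zr.
move=> [N _ NH]; exists N => // k Nk; apply: EP => z Kz; apply: eE.
rewrite /= -ball_normE /= normC_cabs ltcR.
by apply: le_lt_trans (NH k Nk z Kz) _; lra.
Qed.

Lemma AD_small D mu xi n a : open D -> connected D -> admissible D mu -> D xi -> (0 < n)%N -> D a ->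
  exists2 r : R, 0 < r & (forall z, cabs (z - a) <= r -> D z) /\
  forall e : R, 0 < e -> exists2 d : R, 0 < d & forall f, AD D mu xi n f ->
    ipAD D mu f f <= d -> forall z, cabs (z - a) <= r -> cabs (f z) <= e.
Proof.
move=> oD cD adm Dxi n0 Da.
have [r r0 [C C0 [rD CH]]] := AD_local_bound oD adm cD Dxi n0 Da.
exists r => //; split => // e e0; have C1 : 0 < C + 1 by rewrite ltr_wpDl.
exists (e ^+ 2 / (C + 1)); first by rewrite divr_gt0 ?exprn_gt0.
move=> f Af; rewrite ler_pdivlMr // => fd z zr.
rewrite -(@ler_pXn2r _ 2) ?nnegrE ?cabs_ge0 ?(ltW e0) //.
apply: (le_trans (CH f Af z zr)); apply: le_trans fd.
by have := ip_ge0 (AD_form oD adm n Dxi) Af; set x := ipAD _ _ _ _; lra.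
Qed.

Section pair.
Variables (D1 D2 : set R[i]) (mu1 mu2 : R[i] -> R).
Hypotheses (o1 : open D1) (o2 : open D2) (a1 : admissible D1 mu1) (a2 : admissible D2 mu2).
Hypotheses (D12 : D1 `<=` D2) (mu12 : forall z, D1 z -> mu1 z <= mu2 z).

Let w1 : weight D1 mu1. Proof. by case: a1. Qed.
Let w2 : weight D2 mu2. Proof. by case: a2. Qed.

Let le12 f : (sqnormL2 D1 mu1 f <= sqnormL2 D2 mu2 f)%E.
Proof.
apply: le_sqnormL2 => // z Dz; last by apply/ltW; case: w2 => _; apply.
by rewrite mu12 // andbT; apply/ltW; case: w1 => _; apply.
Qed.

Lemma AD_restrict xi n f : AD D2 mu2 xi n f -> AD D1 mu1 xi n f.
Proof.
move=> [hf f0 nf]; split; [exact (holomorphicS D12 hf)|exact f0|].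
exact: le_lt_trans (le12 _) nf.
Qed.

Lemma ipAD_le xi n f : AD D2 mu2 xi n f -> ipAD D1 mu1 f f <= ipAD D2 mu2 f f.
Proof.
move=> Af; have b2 := bergman_sqi o2 (AD_bergman o2 Af).
have b1 := bergman_sqi o1 (AD_bergman o1 (AD_restrict Af)).
by rewrite -lee_fin -(sqnormL2E w1 b1) -(sqnormL2E w2 b2).
Qed.

Hypotheses (c1 : connected D1) (c2 : connected D2).

Definition lam D mu n xi : R := ipAD D mu (kernelM D mu n xi) (kernelM D mu n xi).

(** In the expanded square the kernel of D1 evaluates the cross term to Re M2^(n)(xi), which the
    kernel of D2 identifies with lam2; and |M2|_{D1}^2 <= lam2. *)
Lemma kernel_gap n xi : D1 xi -> (0 < n)%N ->
  ipAD D1 mu1 (kernelM D2 mu2 n xi - kernelM D1 mu1 n xi) (kernelM D2 mu2 n xi - kernelM D1 mu1 n xi)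
    <= lam D1 mu1 n xi - lam D2 mu2 n xi.
Proof.
move=> D1xi n0; set M1 := kernelM D1 mu1 n xi; set M2 := kernelM D2 mu2 n xi.
have [A1 K1] := kernelMP o1 a1 c1 D1xi n0.
have [A2 K2] := kernelMP o2 a2 c2 (D12 D1xi) n0.
have A21 := AD_restrict A2.
rewrite (ip_sqB (AD_form o1 a1 n D1xi) A21 A1) (K1 _ A21) -(K2 _ A2).
have := ipAD_le A2; rewrite -/M2 /lam -/M1 -/M2.
by set x := ipAD _ _ _ _; set y := ipAD _ _ _ _; set z := ipAD _ _ _ _; lra.
Qed.

Lemma lam_mono n xi : D1 xi -> (0 < n)%N -> lam D2 mu2 n xi <= lam D1 mu1 n xi.
Proof.
move=> D1xi n0; rewrite -subr_ge0; apply: (le_trans _ (kernel_gap D1xi n0)).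
have [A1 _] := kernelMP o1 a1 c1 D1xi n0.
have [A2 _] := kernelMP o2 a2 c2 (D12 D1xi) n0.
exact: (ip_ge0 (AD_form o1 a1 n D1xi) (rf_B (AD_form o1 a1 n D1xi) (AD_restrict A2) A1)).
Qed.

End pair.

Lemma lamE D mu n xi : open D -> admissible D mu -> connected D -> D xi -> (0 < n)%N ->
  lam D mu n xi = complex.Re (derive1n n (kernelM D mu n xi) xi).
Proof. by move=> oD aD cD Dxi n0; have [A K] := kernelMP oD aD cD Dxi n0; rewrite -(K _ A). Qed.

Lemma lam_ge0 D mu n xi : open D -> admissible D mu -> connected D -> D xi -> (0 < n)%N ->
  0 <= lam D mu n xi.
Proof.
move=> oD aD cD Dxi n0; have [A _] := kernelMP oD aD cD Dxi n0.
exact: (ip_ge0 (AD_form oD aD n Dxi) A).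
Qed.

End comparison.

(** * Increasing domains *)

Lemma limit_unique_eps (R : realType) (u : nat -> R[i]) l l' :
  (forall e : R, 0 < e -> exists N, forall k, (N <= k)%N -> cabs (u k - l) <= e) ->
  (forall e : R, 0 < e -> exists N, forall k, (N <= k)%N -> cabs (u k - l') <= e) -> l = l'.
Proof.
move=> H H'; apply/eqP; rewrite -subr_eq0 -cabs_eq0 eq_le cabs_ge0 andbT.
apply/ler_addgt0Pr => e e0; rewrite add0r; have e2 : 0 < e / 2 by rewrite divr_gt0.
have [N NH] := H _ e2; have [M MH] := H' _ e2.
have h1 := NH (maxn N M) (leq_maxl _ _); have h2 := MH (maxn N M) (leq_maxr _ _).
by apply: (le_trans (cabs_tri _ (u (maxn N M)) _)); rewrite cabsBC; lra.
Qed.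

Lemma parallelogram_arith (F : realFieldType) (e x y z : F) :
  x <= e / 4 -> y <= e / 4 -> 0 <= x + 2 * z + y -> x - 2 * z + y <= e.
Proof. by lra. Qed.

Lemma limit_norm_arith (F : realFieldType) (e L l x y z : F) :
  - (e / 4) <= z - x -> y <= l -> l <= L + e / 2 -> 0 <= x - 2 * z + y -> x <= L + e.
Proof. by lra. Qed.

Section exhaustion.
Context {R : realType}.
Variables (Ds : nat -> set R[i]) (mus : nat -> R[i] -> R) (D : set R[i]) (mu : R[i] -> R).
Hypotheses (domDs : forall i, domain (Ds i)) (admmus : forall i, admissible (Ds i) (mus i)).
Hypotheses (DE : D = \bigcup_i Ds i) (adm : admissible D mu).
Variable j : nat -> nat.
Hypothesis jP : forall i k, (j i <= k)%N ->
  Ds i `<=` Ds k /\ forall z, Ds i z -> mus i z <= mus k z /\ mus k z <= mu z.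
Hypothesis mus_cvg : ae_on D (fun z => mus i z @[i --> \oo] --> mu z).
Variables (n : nat) (xi : R[i]) (i0 : nat).
Hypotheses (n0 : (0 < n)%N) (Di0xi : Ds i0 xi).

Let oDs i : open (Ds i). Proof. by case: (domDs i). Qed.
Let cDs i : connected (Ds i). Proof. by case: (domDs i). Qed.
Let DsD i : Ds i `<=` D. Proof. by rewrite DE; exact: bigcup_sup. Qed.

Let oD : open D.
Proof. by rewrite DE; apply: bigcup_open => i _; exact: oDs. Qed.

(** The sequence of domains need not be monotone: comparison of i with k requires k >= j i, and xi
    is certain to lie in [Ds k] only past [j i0]. These two thresholds recur throughout. *)
Let xik k : (j i0 <= k)%N -> Ds k xi.
Proof. by move=> /jP[DD _]; exact: DD. Qed.

Let Dxi : D xi. Proof. exact: DsD Di0xi. Qed.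

(** D is also the union of the tail past [j i0], all of whose members contain xi. *)
Let cD : connected D.
Proof.
have -> : D = \bigcup_(k in [set k | (j i0 <= k)%N]) Ds k.
  rewrite DE; apply/seteqP; split => z [ i ]; last by exists i.
  move=> _ Diz; exists (maxn (j i) (j i0)); first exact: leq_maxr.
  by have [DD _] := jP (leq_maxl (j i) (j i0)); exact: DD.
apply: bigcup_connected; first by exists xi => k; exact: xik.
by move=> k _; exact: cDs.
Qed.

Let mumu i k z : (j i <= k)%N -> Ds i z -> mus i z <= mus k z.
Proof. by move=> /jP[_ H] /H[]. Qed.

Let mu_le i z : Ds i z -> mus i z <= mu z.
Proof. by move=> Dz; have [_ H] := jP (leqnn (j i)); have [h1 h2] := H z Dz; exact: le_trans h2. Qed.

Let M k := kernelM (Ds k) (mus k) n xi.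
Let MD := kernelM D mu n xi.
Let l k := lam (Ds k) (mus k) n xi.
Let lD := lam D mu n xi.
Let E k := ipAD (Ds k) (mus k).

Let AM k : (j i0 <= k)%N -> AD (Ds k) (mus k) xi n (M k).
Proof. by move=> kj; have [] := kernelMP (@oDs k) (admmus k) (@cDs k) (xik kj) n0. Qed.

Let AMD : AD D mu xi n MD.
Proof. by have [] := kernelMP oD adm cD Dxi n0. Qed.

Let form k (kj : (j i0 <= k)%N) := AD_form (@oDs k) (admmus k) n (xik kj).

Let restr i k f : (j i <= k)%N -> AD (Ds k) (mus k) xi n f -> AD (Ds i) (mus i) xi n f.
Proof.
move=> ik; have [DD _] := jP ik.
apply: (AD_restrict (admmus i) (admmus k) DD (fun z => @mumu i k z ik)).
Qed.

Let restrD i f : AD D mu xi n f -> AD (Ds i) (mus i) xi n f.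
Proof. apply: (AD_restrict (admmus i) adm (@DsD i) (@mu_le i)). Qed.

Let E_mono i k f : (j i <= k)%N -> AD (Ds k) (mus k) xi n f -> E i f f <= E k f f.
Proof.
move=> ik; have [DD _] := jP ik.
apply: (ipAD_le (@oDs i) (@oDs k) (admmus i) (admmus k) DD (fun z => @mumu i k z ik)).
Qed.

Let gap i k : (j i0 <= i)%N -> (j i <= k)%N -> E i (M k - M i) (M k - M i) <= l i - l k.
Proof.
move=> ii ik; have [DD _] := jP ik.
exact (kernel_gap (@oDs i) (@oDs k) (admmus i) (admmus k) DD (fun z => @mumu i k z ik)
   (@cDs i) (@cDs k) (xik ii) n0).
Qed.

Let gapD i : (j i0 <= i)%N -> E i (MD - M i) (MD - M i) <= l i - lD.
Proof.
move=> ii; exact (kernel_gap (@oDs i) oD (admmus i) adm (@DsD i) (@mu_le i) (@cDs i) cD (xik ii) n0).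
Qed.

Let l_mono i k : (j i0 <= i)%N -> (j i <= k)%N -> l k <= l i.
Proof.
move=> ii ik; have [DD _] := jP ik.
exact (lam_mono (@oDs i) (@oDs k) (admmus i) (admmus k) DD (fun z => @mumu i k z ik)
   (@cDs i) (@cDs k) (xik ii) n0).
Qed.

Let lD_le i : (j i0 <= i)%N -> lD <= l i.
Proof.
move=> ii; exact (lam_mono (@oDs i) oD (admmus i) adm (@DsD i) (@mu_le i) (@cDs i) cD (xik ii) n0).
Qed.

Let lD0 : 0 <= lD. Proof. exact (lam_ge0 oD adm cD Dxi n0). Qed.

Let L := inf [set l k | k in [set k | (j i0 <= k)%N]].

Let hasinf : has_inf [set l k | k in [set k | (j i0 <= k)%N]].
Proof.
split; first by exists (l (j i0)), (j i0) => /=.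
by exists lD => _ [k /= kj <-]; exact: lD_le.
Qed.

Let L_le k : (j i0 <= k)%N -> L <= l k.
Proof. by move=> kj; apply: ge_inf; [case: hasinf|exists k]. Qed.

(** From an almost minimising index k the values decrease only towards indices past [j k]; this is
    the threshold. *)
Let L_cvg (e : R) : 0 < e -> exists2 N, (j i0 <= N)%N & forall k, (N <= k)%N -> l k <= L + e.
Proof.
move=> e0; have [_ [k /= kj <-] /ltW lk] := inf_adherent e0 hasinf.
exists (maxn (j k) (j i0)); first exact: leq_maxr.
by move=> m; rewrite geq_max => /andP[km _]; apply: le_trans lk; exact: l_mono.
Qed.

(** Two late kernels need not be comparable with each other, so both are compared with a fixed M p,
    at squared distance at most l p - L <= e / 4; the parallelogram inequality then gives e. *)
Let cauchyM i (e : R) : (j i0 <= i)%N -> 0 < e -> exists2 N, (j i <= N)%N /\ (j i0 <= N)%N &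
  forall k m, (N <= k)%N -> (N <= m)%N -> E i (M k - M m) (M k - M m) <= e.
Proof.
move=> ii e0; have e4 : 0 < e / 4 by rewrite divr_gt0.
have [N Nj NH] := L_cvg e4.
pose p := maxn (j i) N; have pj : (j i0 <= p)%N by rewrite (leq_trans Nj) // leq_maxr.
have ip : (j i <= p)%N by exact: leq_maxl.
have lp := NH p (leq_maxr _ _).
exists (maxn (j p) p); first by split; rewrite (leq_trans _ (leq_maxr _ _)).
have H k : (maxn (j p) p <= k)%N -> AD (Ds i) (mus i) xi n (M k - M p) /\
    E i (M k - M p) (M k - M p) <= e / 4.
  rewrite geq_max => /andP[pk pk']; have kj : (j i0 <= k)%N := leq_trans pj pk'.
  have A := rf_B (form pj) (restr pk (AM kj)) (AM pj).
  split; first exact: restr ip A.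
  apply: le_trans (E_mono ip A) _; apply: le_trans (gap pj pk) _.
  by have := L_le kj; lra.
move=> k m /H[Ak Ek] /H[Am Em].
rewrite (_ : M k - M m = (M k - M p) - (M m - M p)); last by rewrite opprB addrA subrK.
rewrite /E in Ek Em *; rewrite (ip_sqB (form ii) Ak Am).
have := ip_ge0 (form ii) (rf_D (form ii) Ak Am); rewrite (ip_sqD (form ii) Ak Am).
by move=> h; exact: parallelogram_arith Ek Em h.
Qed.

Let limit_fun i : (j i0 <= i)%N -> exists2 f, AD (Ds i) (mus i) xi n f &
  cvg_in (E i) (fun k => M (k + maxn (j i) (j i0))%N) f.
Proof.
move=> ii; apply: (AD_complete (@oDs i) (admmus i) (@cDs i) (xik ii) n0).
  move=> k; apply: (@restr i (k + maxn (j i) (j i0))%N); first by rewrite (leq_trans (leq_maxl _ (j i0))) // leq_addl.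
  by apply: AM; rewrite (leq_trans (leq_maxr (j i) _)) // leq_addl.
move=> e e0; have [N _ NH] := cauchyM ii e0; exists N => k m Nk Nm.
by apply: NH; rewrite (leq_trans _ (leq_addr _ _)).
Qed.

Let pointwise i f z : (j i0 <= i)%N -> AD (Ds i) (mus i) xi n f ->
  cvg_in (E i) (fun k => M (k + maxn (j i) (j i0))%N) f -> Ds i z ->
  forall e : R, 0 < e -> exists N, forall k, (N <= k)%N -> cabs (M k z - f z) <= e.
Proof.
move=> ii Af cf Dz e e0.
have [r r0 [_ H]] := AD_small (@oDs i) (@cDs i) (admmus i) (xik ii) n0 Dz.
have [d d0 dH] := H e e0; have [N NH] := cf d d0.
exists (N + maxn (j i) (j i0))%N => k Nk.
have mk : (maxn (j i) (j i0) <= k)%N by rewrite (leq_trans _ Nk) // leq_addl.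
have jk : (j i <= k)%N by rewrite (leq_trans _ mk) // leq_maxl.
have j0k : (j i0 <= k)%N by rewrite (leq_trans _ mk) // leq_maxr.
have := NH (k - maxn (j i) (j i0))%N; rewrite leq_subRL // addnC => /(_ Nk); rewrite subnK // => Ek.
have A := rf_B (form ii) (restr jk (AM j0k)) Af.
by have := dH _ A Ek z; apply; rewrite subrr Normc.normc0 ltW.
Qed.

(** The limits obtained on the various [Ds i] agree pointwise, hence glue to one holomorphic f on D;
    it competes with the kernel of D. *)
Let L_le_lD : L <= lD.
Proof.
have /choice[f fP] : forall z, exists v, D z ->
    forall e : R, 0 < e -> exists N, forall k, (N <= k)%N -> cabs (M k z - v) <= e.
  move=> z; have [|nDz] := pselect (D z); last by exists 0.
  rewrite DE => -[i _ Dz].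
  pose i' := maxn (j i) (j i0); have ii' : (j i0 <= i')%N by exact: leq_maxr.
  have [g Ag cg] := limit_fun ii'; exists (g z) => _.
  apply: (pointwise ii' Ag cg).
  by have [DD _] := jP (leq_maxl (j i) (j i0)); exact: DD.
have fE i : (j i0 <= i)%N -> exists g, [/\ AD (Ds i) (mus i) xi n g,
    cvg_in (E i) (fun k => M (k + maxn (j i) (j i0))%N) g & forall z, Ds i z -> g z = f z].
  move=> ii; have [g Ag cg] := limit_fun ii; exists g; split; [exact Ag|exact cg|].
  move=> z Dz; exact: limit_unique_eps (pointwise ii Ag cg Dz) (fP z (DsD Dz)).
have hf : holomorphic_on D f.
  move=> z; rewrite DE => -[i _ Dz].
  pose i' := maxn (j i) (j i0); have ii' : (j i0 <= i')%N by exact: leq_maxr.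
  have Dz' : Ds i' z by have [DD _] := jP (leq_maxl (j i) (j i0)); exact: DD.
  have [g [Ag _ gf]] := fE i' ii'.
  exact (eq_holomorphic (@oDs i') gf (AD_holomorphic Ag) Dz').
have f'E i g : AD (Ds i) (mus i) xi n g -> (forall z, Ds i z -> g z = f z) ->
    forall z, Ds i z -> derive1 g z = derive1 f z.
  by move=> Ag gf; exact (eq_derive1_on (@oDs i) (AD_holomorphic Ag) gf).
have E_le i g : (j i0 <= i)%N -> AD (Ds i) (mus i) xi n g ->
    cvg_in (E i) (fun k => M (k + maxn (j i) (j i0))%N) g -> E i g g <= L.
  move=> ii Ag cg; apply/ler_addgt0Pr => e e0; have e2 : 0 < e / 2 by rewrite divr_gt0.
  have Mk k : AD (Ds i) (mus i) xi n (M (k + maxn (j i) (j i0))%N).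
    apply: (@restr i (k + maxn (j i) (j i0))%N); first by rewrite (leq_trans (leq_maxl _ (j i0))) // leq_addl.
    by apply: AM; rewrite (leq_trans (leq_maxr (j i) _)) // leq_addl.
  have e4 : 0 < e / 4 by rewrite divr_gt0.
  have [N NH] := cvg_in_ip (form ii) Mk Ag Ag cg e4.
  have [N' _ N'H] := L_cvg e2.
  pose k := maxn N N'; have := NH k (leq_maxl _ _); rewrite ler_norml => /andP[h _].
  pose k' := (k + maxn (j i) (j i0))%N.
  have lk : l k' <= L + e / 2 by apply: N'H; rewrite /k' (leq_trans (leq_maxr N N')) // leq_addr.
  have k'j : (j i0 <= k')%N by rewrite /k' (leq_trans (leq_maxr (j i) _)) // leq_addl.
  have ik' : (j i <= k')%N by rewrite /k' (leq_trans (leq_maxl _ (j i0))) // leq_addl.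
  have Ek : E i (M k') (M k') <= l k' := E_mono ik' (AM k'j).
  rewrite /E in Ek h *.
  have := ip_ge0 (form ii) (rf_B (form ii) Ag (Mk k)); rewrite (ip_sqB (form ii) Ag (Mk k)).
  by move=> h'; exact: limit_norm_arith h Ek lk h'.
(* Fatou is used here with the constant sequence f', only domains and weights varying: on each
   [Ds k] the energy of f is at most L by [E_le]. *)
have sqf : (sqnormL2 D mu (derive1 f) <= L%:E)%E.
  apply: (@fatou_sqnormL2 R D mu (fun k => Ds (k + j i0)%N) (fun k => mus (k + j i0)%N)
    (fun=> derive1 f)).
  - exact oD.
  - by case: adm.
  - by move=> k; exact: oDs.
  - by move=> k; case: (admmus (k + j i0)%N).
  - move=> k; apply: (borel_onS oD (@DsD _)); apply: (holomorphic_borel oD).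
    exact (holomorphic_derive1 oD hf).
  - move=> z; rewrite DE => -[i _ Dz]; exists (j i) => // k /= ik.
    have [DD _] : Ds i `<=` Ds (k + j i0)%N /\ True.
      by split => //; have [] := jP (leq_trans ik (leq_addr (j i0) k)).
    exact: DD.
  - case: mus_cvg => N [mN N0 NH]; exists N; split => // p Hp; apply: NH => H; apply: Hp => Dp.
    by have := H Dp; rewrite -(cvg_shiftn (j i0)).
  - by move=> z Dz; exact: cvg_cst.
  move=> k; have kj : (j i0 <= k + j i0)%N by exact: leq_addl.
  have [h [Ah ch hf']] := fE _ kj.
  rewrite -(eq_sqnormL2 _ (f'E _ _ Ah hf')).
  have wk : weight (Ds (k + j i0)%N) (mus (k + j i0)%N) by case: (admmus (k + j i0)%N).
  rewrite (sqnormL2E wk (bergman_sqi (@oDs _) (AD_bergman (@oDs _) Ah))) lee_fin.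
  exact: E_le kj Ah ch.
have [g [Ag cg gf]] := fE (j i0) (leqnn _).
have Dj : Ds (j i0) xi := xik (leqnn _).
have gfn k : derive1n k g xi = derive1n k f xi.
  exact (eq_derive1n_on k (@oDs (j i0)) (AD_holomorphic Ag) gf Dj).
have Af : AD D mu xi n f.
  split; first exact hf.
    by move=> k kn; rewrite -gfn; case: Ag => _ /(_ k kn).
  by apply: le_lt_trans sqf _; rewrite ltry.
have EfL : ipAD D mu f f <= L.
  have wD : weight D mu by case: adm.
  by rewrite -lee_fin -(sqnormL2E wD (bergman_sqi oD (AD_bergman oD Af))).
have [_ K0] := kernelMP (@oDs (j i0)) (admmus (j i0)) (@cDs (j i0)) Dj n0.
have [_ KD] := kernelMP oD adm cD Dxi n0.
(* Pairing with the kernel of [Ds (j i0)] is continuous along the M k and evaluates n-th derivatives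
   at xi, and Re (M k)^(n)(xi) = l k tends to L. *)
have RL : complex.Re (derive1n n f xi) = L.
  have jj : (j i0 <= j i0)%N by [].
  pose N0 := maxn (j (j i0)) (j i0).
  have kN k : (j i0 <= k + N0)%N /\ (j (j i0) <= k + N0)%N.
    by split; rewrite (leq_trans _ (leq_addl k N0)) // ?leq_maxl ?leq_maxr.
  have Mk k : AD (Ds (j i0)) (mus (j i0)) xi n (M (k + N0)%N).
    by have [h1 h2] := kN k; apply: (restr h2); exact: AM.
  apply/eqP; rewrite -subr_eq0 -normr_eq0 eq_le normr_ge0 andbT.
  apply/ler_addgt0Pr => e e0; rewrite add0r; have e2 : 0 < e / 2 by rewrite divr_gt0.
  have [N NH] := cvg_in_ip (form jj) Mk Ag (AM jj) cg e2.
  have [N' _ N'H] := L_cvg e2.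
  pose k := maxn N N'; have := NH k (leq_maxl _ _).
  rewrite (ip_sym (form jj) (AM jj) (Mk k)) (ip_sym (form jj) (AM jj) Ag).
  rewrite (K0 _ (Mk k)) (K0 _ Ag) gfn => h.
  have [h1 h2] := kN k.
  have lk : l (k + N0)%N <= L + e / 2 by apply: N'H; rewrite (leq_trans (leq_maxr N N')) // leq_addr.
  have Lk := L_le h1.
  have lkE := lamE (@oDs (k + N0)%N) (admmus (k + N0)%N) (@cDs (k + N0)%N) (xik h1) n0.
  rewrite /l lkE -/(M (k + N0)%N) in lk Lk.
  move: h lk Lk; set x := complex.Re (derive1n n (M _) xi); set y := complex.Re _.
  rewrite !ler_norml => /andP[h3 h4] h5 h6; apply/andP; split; lra.
(* This yields L^2 <= L lD; division needs L > 0, and otherwise L <= 0 <= lD. *)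
have := ip_CS (AD_form oD adm n Dxi) Af AMD.
rewrite (KD _ Af) RL -/lD => h.
have [L0|L0] := leP L 0; first exact: le_trans lD0.
have : L * L <= L * lD.
  rewrite -expr2; apply: (le_trans h); rewrite -[ipAD D mu MD MD]/lD.
  by rewrite ler_wpM2r.
by rewrite ler_pM2l.
Qed.

Lemma exhaustion_kernel_cvg :
  cvg_locally_uniformly Ds D (fun i => kernelM (Ds i) (mus i) n xi) (kernelM D mu n xi).
Proof.
apply: locally_uniform_of_local => a Daa.
have [i _ Dia] : (\bigcup_i Ds i) a by rewrite -DE.
pose p := maxn (j i) (j i0); have pj : (j i0 <= p)%N by exact: leq_maxr.
have Da : Ds p a by have [DD _] := jP (leq_maxl (j i) (j i0)); exact: DD.
have [r r0 [rD H]] := AD_small (@oDs p) (@cDs p) (admmus p) (xik pj) n0 Da.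
exists r => // e e0; have [d d0 dH] := H e e0.
have [N Nj NH] := L_cvg d0.
exists (maxn (j p) N) => k; rewrite geq_max => /andP[pk Nk] z /ltW zr.
have [DD _] := jP pk; split; first exact: DD (rD z zr).
have kj : (j i0 <= k)%N := leq_trans Nj Nk.
have A := rf_B (form kj) (restrD k AMD) (AM kj).
have h : E p (MD - M k) (MD - M k) <= d.
  apply: le_trans (E_mono pk A) _; apply: le_trans (gapD kj) _.
  by have := NH k Nk; have := L_le_lD; lra.
exact (dH _ (restr pk A) h z zr).
Qed.

End exhaustion.

(** * Decreasing domains *)

(** To be read with s = |M|, si = |M_i|_i and p the pairing of an e-approximant of M with M; the
    hypotheses force s - si <= 2 e. *)
Lemma kernel_norm_arith (F : realFieldType) (s si e p : F) : 0 <= s -> 0 <= si -> si <= s -> 0 < e ->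
  s ^+ 2 - e * s <= p -> p <= (s + e) * si -> s ^+ 2 - si ^+ 2 <= 4 * e * s.
Proof.
move=> s0 si0 sis e0 h1 h2.
have h3 : 0 <= (s + e) * (si - s + 2 * e).
  have -> : (s + e) * (si - s + 2 * e) = ((s + e) * si - (s ^+ 2 - e * s)) + 2 * e ^+ 2 by ring.
  apply: addr_ge0; first by rewrite subr_ge0; exact: le_trans h1 h2.
  by rewrite mulr_ge0 ?sqr_ge0.
have h4 : s - si <= 2 * e by move: h3; rewrite pmulr_rge0; lra.
have -> : s ^+ 2 - si ^+ 2 = (s - si) * (s + si) by ring.
have -> : 4 * e * s = (2 * e) * (2 * s) by ring.
by apply: ler_pM => //; lra.
Qed.

Section linear_arithmetic.
Context {F : realFieldType}.
Implicit Types e x y z w : F.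

Lemma parallelogram_arithD e x y z :
  x <= e / 4 -> y <= e / 4 -> 0 <= x - 2 * z + y -> x + 2 * z + y <= e.
Proof. by lra. Qed.

Lemma half_arith e x y z : x <= e / 2 -> y <= e / 2 -> z <= x + y -> z <= e.
Proof. by lra. Qed.

Lemma shift_arith e x y z : x <= e -> z <= x + y -> z <= y + e.
Proof. by lra. Qed.

Lemma lower_half_arith x y z : x <= z -> z <= 2^-1 -> 1 <= x + y -> 2^-1 <= y.
Proof. by lra. Qed.

Lemma inner_arith x y z w : - x <= y - z -> x <= w -> z - w <= y.
Proof. by lra. Qed.

End linear_arithmetic.

Section decreasing.
Context {R : realType}.
Variables (Ds : nat -> set R[i]) (mus : nat -> R[i] -> R) (D : set R[i]) (mu : R[i] -> R).
Hypotheses (domDs : forall i, domain (Ds i)) (admmus : forall i, admissible (Ds i) (mus i)).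
Hypotheses (domD : domain D) (adm : admissible D mu).
Hypotheses (DDs : forall i, D `<=` Ds i) (mu_le : forall i z, D z -> mu z <= mus i z).
(** One-sided, because [lam_mono] bounds the kernel value of [Ds k] by that of D. *)
Hypothesis lam_cvg1 : forall t, D t -> forall e : R, 0 < e -> exists N, forall k, (N <= k)%N ->
  lam D mu 1 t - lam (Ds k) (mus k) 1 t <= e.
Variable xi : R[i].
Hypothesis Dxi : D xi.

Let oDs i : open (Ds i). Proof. by case: (domDs i). Qed.
Let cDs i : connected (Ds i). Proof. by case: (domDs i). Qed.
Let oD : open D. Proof. by case: domD. Qed.
Let cD : connected D. Proof. by case: domD. Qed.
Let Dsxi i : Ds i xi. Proof. exact: DDs Dxi. Qed.

Local Notation E := (ipAD D mu).
Local Notation Ei i := (ipAD (Ds i) (mus i)).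
Local Notation nr := (nrm E).
Local Notation nri i := (nrm (Ei i)).
Local Notation ADi i := (AD (Ds i) (mus i) xi).

Let form n := AD_form oD adm n Dxi.
Let formi i n := AD_form (@oDs i) (admmus i) n (Dsxi i).

Let restr i t n f : AD (Ds i) (mus i) t n f -> AD D mu t n f.
Proof. by apply: (AD_restrict adm (admmus i) (@DDs i) (@mu_le i)). Qed.

Let E_le i n f : ADi i n f -> E f f <= Ei i f f.
Proof. by apply: (ipAD_le oD (@oDs i) adm (admmus i) (@DDs i) (@mu_le i)). Qed.

Let nr_le i n f : ADi i n f -> nr f <= nri i f.
Proof.
move=> Af; have h := ip_ge0 (formi i n) Af; have h' := E_le Af.
by rewrite /nrm ler_sqrt.
Qed.

Let gap i n t : D t -> (0 < n)%N ->
  E (kernelM (Ds i) (mus i) n t - kernelM D mu n t) (kernelM (Ds i) (mus i) n t - kernelM D mu n t)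
   <= lam D mu n t - lam (Ds i) (mus i) n t.
Proof.
move=> Dt n0; exact (kernel_gap oD (@oDs i) adm (admmus i) (@DDs i) (@mu_le i) cD (@cDs i) Dt n0).
Qed.

Lemma derive1_shift (U : set R[i]) f c : holomorphic_on U f -> forall z, U z ->
  derive1 (f - cst c) z = derive1 f z.
Proof.
move=> hf z Uz; rewrite -[RHS]subr0.
exact: cderiv_derive1 (cderivB (derivable_cderiv (hf z Uz)) (cderiv_cst c z)).
Qed.

Lemma derive1_sub_shift (f g : R[i] -> R[i]) (c c' z : R[i]) : derivable f z 1 -> derivable g z 1 ->
  derive1 (f - cst c - (g - cst c')) z = derive1 (f - g) z.
Proof.
move=> /derivable_cderiv; move: (derive1 f z) => d df.
move=> /derivable_cderiv; move: (derive1 g z) => d' dg.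
have e2 : derive1 (f - g) z = d - d' := cderiv_derive1 (cderivB df dg).
rewrite e2; have -> : d - d' = (d - 0) - (d' - 0) by rewrite !subr0.
exact (cderiv_derive1 (cderivB (cderivB df (cderiv_cst c z)) (cderivB dg (cderiv_cst c' z)))).
Qed.

(** First order spaces with different base points differ by additive constants, which the energy
    ignores; kernels based at all points t can thus be gathered in the space based at xi. *)
Lemma AD_shift (U : set R[i]) nu t s f : AD U nu t 1 f -> AD U nu s 1 (f - cst (f s)).
Proof.
move=> [hf _ nf]; split.
- move=> z Uz; exact: cderiv_derivable (cderivB (derivable_cderiv (hf z Uz)) (cderiv_cst (f s) z)).
- by case=> // _; rewrite derive1n0 !fctE subrr.
- by rewrite (eq_sqnormL2 nu (derive1_shift (f s) hf)).
Qed.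

Lemma kernel1_reproducing (U : set R[i]) nu t s f : open U -> connected U -> admissible U nu ->
  U t -> AD U nu s 1 f -> ipw U nu (derive1 f) (derive1 (kernelM U nu 1 t)) = complex.Re (derive1 f t).
Proof.
move=> oU cU aU Ut Af; have [_ K] := kernelMP oU aU cU Ut (ltn0Sn 0).
have hf : holomorphic_on U f by case: Af.
have := K _ (AD_shift t Af); rewrite derive1n1 (derive1_shift (f t) hf Ut) => <-.
exact (esym (eq_ipw_l nu _ (derive1_shift (f t) hf))).
Qed.

(* [u i] is the image of [g] under the adjoint of the inclusion of AD(D_i) in AD(D). *)
Let S (g : R[i] -> R[i]) := AD D mu xi 1 g /\ exists u : nat -> R[i] -> R[i],
  [/\ forall i, ADi i 1 (u i), forall i w, ADi i 1 w -> Ei i (u i) w = E g w &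
      forall e : R, 0 < e -> exists N, forall i, (N <= i)%N -> E (u i - g) (u i - g) <= e].

Let S_add f g : S f -> S g -> S (f + g).
Proof.
move=> [Af [u [Au uw uf]]] [Ag [v [Av vw vg]]]; split; first exact (rf_D (form 1) Af Ag).
exists (fun i => u i + v i); split.
- by move=> i; exact (rf_D (formi i 1) (Au i) (Av i)).
- move=> i w Aw; have e1 := ip_Dl (formi i 1) (Au i) (Av i) Aw.
  have e2 := ip_Dl (form 1) Af Ag (restr Aw).
  by rewrite (uw i w Aw) (vw i w Aw) in e1; exact (etrans e1 (esym e2)).
move=> e e0; have e4 : 0 < e / 4 by rewrite divr_gt0.
have [N NH] := uf _ e4; have [M MH] := vg _ e4.
exists (maxn N M) => i; rewrite geq_max => /andP[/NH h1 /MH h2].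
have A1 := rf_B (form 1) (restr (Au i)) Af; have A2 := rf_B (form 1) (restr (Av i)) Ag.
rewrite opprD addrACA (ip_sqD (form 1) A1 A2).
have := ip_ge0 (form 1) (rf_B (form 1) A1 A2); rewrite (ip_sqB (form 1) A1 A2).
exact: parallelogram_arithD h1 h2.
Qed.

Let S_scale c f : S f -> S (c *: f).
Proof.
move=> [Af [u [Au uw uf]]]; split; first exact (rf_Z (form 1) c Af).
exists (fun i => c *: u i); split.
- by move=> i; exact (rf_Z (formi i 1) c (Au i)).
- move=> i w Aw; have e1 := ip_adj (formi i 1) c (Au i) Aw.
  have e2 := ip_adj (form 1) c Af (restr Aw).
  rewrite (uw i _ (rf_Z (formi i 1) c^*%C Aw)) in e1; exact (etrans e1 (esym e2)).
move=> e e0; have c1 : 0 < cabs c ^+ 2 + 1 by rewrite ltr_wpDl ?sqr_ge0.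
have [N NH] := uf _ (divr_gt0 e0 c1); exists N => i /NH h.
have A := rf_B (form 1) (restr (Au i)) Af.
rewrite -scalerBr (ip_sqZ (form 1) c A); move: h; rewrite ler_pdivlMr //.
rewrite mulrDr mulr1 [_ * cabs c ^+ 2]mulrC => h; apply: le_trans h.
by rewrite lerDl (ip_ge0 (form 1) A).
Qed.

(** The generators of the dense subspace: first order kernels at t, normalised to vanish at xi. *)
Let genE t := kernelM D mu 1 t - cst (kernelM D mu 1 t xi).

Let AMt t : D t -> AD D mu t 1 (kernelM D mu 1 t).
Proof. by move=> Dt; have [] := kernelMP oD adm cD Dt (ltn0Sn 0). Qed.

Let AMit i t : D t -> AD (Ds i) (mus i) t 1 (kernelM (Ds i) (mus i) 1 t).
Proof. by move=> Dt; have [] := kernelMP (@oDs i) (admmus i) (@cDs i) (DDs i Dt) (ltn0Sn 0). Qed.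

Let genP t w : D t -> AD D mu xi 1 w -> E (genE t) w = complex.Re (derive1 w t).
Proof.
move=> Dt Aw; rewrite -(kernel1_reproducing oD cD adm Dt Aw) [RHS]ipwC.
exact (eq_ipw_l mu _ (derive1_shift _ (AD_holomorphic (AMt Dt)))).
Qed.

(** The adjoint image of the generator is the kernel of D_i at t, shifted likewise: both pairings
    evaluate Re w'(t). Convergence is then [gap] together with [lam_cvg1]. *)
Let S_gen t : D t -> S (genE t).
Proof.
move=> Dt; split; first exact (AD_shift xi (AMt Dt)).
exists (fun i => kernelM (Ds i) (mus i) 1 t - cst (kernelM (Ds i) (mus i) 1 t xi)); split.
- by move=> i; exact (AD_shift xi (AMit i Dt)).
- move=> i w Aw; rewrite (genP Dt (restr Aw)).
  rewrite -(kernel1_reproducing (@oDs i) (@cDs i) (admmus i) (DDs i Dt) Aw) [RHS]ipwC.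
  exact (eq_ipw_l (mus i) _ (derive1_shift _ (AD_holomorphic (AMit i Dt)))).
move=> e e0; have [N NH] := lam_cvg1 Dt e0; exists N => i /NH h.
apply: le_trans h; apply: le_trans (gap i Dt (ltn0Sn 0)).
have A := restr (AMit i Dt).
set f := kernelM (Ds i) _ _ _; set g := kernelM D _ _ _.
have H z (Dz : D z) := derive1_sub_shift (f xi) (g xi) (AD_holomorphic A Dz) (AD_holomorphic (AMt Dt) Dz).
rewrite le_eqVlt; apply/orP; left; apply/eqP; exact (eq_ipw mu H H).
Qed.

(** Orthogonality to the generator at z kills the real part of g' z and orthogonality to i times it
    the imaginary part, so g' vanishes on D. *)
Let S_orth g : AD D mu xi 1 g -> (forall s, S s -> E s g = 0) -> E g g = 0.
Proof.
move=> Ag Sg.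
have g'0 z : D z -> derive1 g z = (0 *: derive1 g) z.
  move=> Dz; rewrite -[RHS]/(0 * derive1 g z) mul0r.
  have h1 := Sg _ (S_gen Dz); rewrite (genP Dz Ag) in h1.
  have Agen : AD D mu xi 1 (genE z) by case: (S_gen Dz).
  have Aig := rf_Z (form 1) (('i%C)^*%C) Ag.
  have h2 := Sg _ (S_scale 'i%C (S_gen Dz)).
  rewrite (ip_adj (form 1) _ Agen Ag) (genP Dz Aig) in h2.
  rewrite (derive1_scale _ (AD_holomorphic Ag Dz)) in h2.
  move: h1 h2; case: (derive1 g z) => [a b] /= -> ; rewrite !mul0r !mulN1r opprK add0r => h.
  by rewrite h.
have -> : E g g = ipw D mu (0 *: derive1 g) (0 *: derive1 g) by exact (eq_ipw mu g'0 g'0).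
by rewrite (ip_sqZ (bergman_form oD adm) 0 (AD_bergman oD Ag)) Normc.normc0 expr0n mul0r.
Qed.

(** The approximants are adjoint images u_i of some g in S near f. They are no larger than g, since
    |u_i|_i^2 = E g u_i <= |g| |u_i| <= |g| |u_i|_i. *)
Let approx1 f (e : R) : AD D mu xi 1 f -> 0 < e -> exists N, forall i, (N <= i)%N ->
  exists u, [/\ ADi i 1 u, nr (u - f) <= e & nri i u <= nr f + e].
Proof.
move=> Af e0; have e2 : 0 < e / 2 by rewrite divr_gt0.
have [g Sg gf] := dense_of_orthogonal (form 1) (AD_complete oD adm cD Dxi (ltn0Sn 0))
    (ex_intro _ _ (S_gen Dxi)) (fun g Sg => proj1 Sg) S_add (fun a g => @S_scale a%:C g) S_orth
    Af (exprn_gt0 2 e2).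
have [Ag [u [Au uw ug]]] := Sg; have [N NH] := ug _ (exprn_gt0 2 e2).
exists N => i /NH ui; exists (u i).
have A1 := rf_B (form 1) (restr (Au i)) Ag; have A2 := rf_B (form 1) Ag Af.
have n1 := nrm_le (form 1) A1 (ltW e2) ui; have n2 := nrm_le (form 1) A2 (ltW e2) gf.
split; first exact: Au.
  have := nrm_D (form 1) A1 A2; rewrite addrA subrK; exact: half_arith n1 n2.
have ng : nr g <= nr f + e / 2.
  have := nrm_D (form 1) A2 Af; rewrite subrK; exact: shift_arith n2.
have nu : nri i (u i) <= nr g.
  have [->|n0] := eqVneq (nri i (u i)) 0; first exact: nrm_ge0.
  have np : 0 < nri i (u i) by rewrite lt_def n0 nrm_ge0.
  rewrite -(ler_pM2r np) -expr2 (nrm_sqr (formi i 1) (Au i)) (uw i _ (Au i)).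
  apply: le_trans (ler_norm _) _; apply: le_trans (nrm_CS (form 1) Ag (restr (Au i))) _.
  by rewrite ler_wpM2l ?nrm_ge0 // (nr_le (Au i)).
apply: (le_trans nu); apply: (le_trans ng); rewrite lerD2l.
by rewrite ler_pdivrMr // ler_pMr // ler1n.
Qed.

Lemma AD_succ (U : set R[i]) nu n f : AD U nu xi n f -> derive1n n f xi = 0 -> AD U nu xi n.+1 f.
Proof.
move=> [hf f0 nf] fn; split; [exact hf| |exact nf].
by move=> k; rewrite ltnS leq_eqVlt => /predU1P[->|]; [exact: fn|exact: f0].
Qed.

Lemma AD_pred (U : set R[i]) nu n f : AD U nu xi n.+1 f -> AD U nu xi n f /\ derive1n n f xi = 0.
Proof.
by move=> Af; split; [exact: AD_mono Af|case: Af => _ /(_ n (ltnSn n))].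
Qed.

(* Induction on [n]: an approximant [u] of [f] vanishing to order [n] is corrected
   by a small multiple of an approximant [v] of some [g] whose [n]-th derivative at
   [xi] is 1; without such a [g], [u] already vanishes to order [n + 1]. *)
Let approx n f (e : R) : (0 < n)%N -> AD D mu xi n f -> 0 < e -> exists N, forall i, (N <= i)%N ->
  exists u, [/\ ADi i n u, nr (u - f) <= e & nri i u <= nr f + e].
Proof.
case: n => // n _; elim: n f e => [|n IH] f e Af e0; first exact: approx1.
(* After the shift of n the induction hypothesis concerns order [n.+1], and order [n.+2] is to be
   reached. *)
have [Anf fn0] := AD_pred Af.
have [triv|] := pselect (forall g, AD D mu xi n.+1 g -> derive1n n.+1 g xi = 0).
  have [N NH] := IH f e Anf e0; exists N => i /NH[u [Au h1 h2]]; exists u; split; [|exact h1|exact h2].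
  by apply: (AD_succ Au); apply: triv; exact: restr Au.
move=> /existsNP[g0 /not_implyP[Ag0 /eqP g0n]].
pose g := (derive1n n.+1 g0 xi)^-1 *: g0.
have Ag : AD D mu xi n.+1 g := rf_Z (form n.+1) _ Ag0.
have gn : derive1n n.+1 g xi = 1.
  by rewrite (derive1n_scale n.+1 _ oD (AD_holomorphic Ag0) Dxi) mulVf.
have [C C0 CH] := AD_derive1n_bound oD adm n.+1 Dxi (ltn0Sn n).
pose B := Num.sqrt C.
have B0 : 0 <= B by exact: sqrtr_ge0.
have BH w : AD D mu xi n.+1 w -> cabs (derive1n n.+1 w xi) <= B * nr w.
  move=> Aw; rewrite -(@ler_pXn2r _ 2) ?nnegrE ?cabs_ge0 ?mulr_ge0 ?nrm_ge0 //.
  by rewrite exprMn sqr_sqrtr // (nrm_sqr (form n.+1) Aw); exact: CH.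
have B1 : 0 < 2 * (B + 1) by rewrite mulr_gt0 // ltr_wpDl.
(* With B the norm bound of the derivative functional, this accuracy keeps the derivative of v
   within 1/2 of that of g, which is 1; so it may be divided by. *)
pose e2 := (2 * (B + 1))^-1; have e20 : 0 < e2 by rewrite invr_gt0.
have Be2 : B * e2 <= 2^-1.
  by rewrite /e2 invfM mulrCA -[leRHS]mulr1 ler_wpM2l // ler_pdivrMr ?ltr_wpDl // mul1r lerDl.
pose G := nr g + e2; have G0 : 0 <= G by rewrite addr_ge0 ?nrm_ge0 ?(ltW e20).
have q0 : 0 < 1 + 2 * B * G by rewrite ltr_pwDl // mulr_ge0 // mulr_ge0.
(* The correction c v has |c| <= 2 B e1 and norm of v at most G, so e1 plus the norm of the
   correction is at most e. *)
pose e1 := e / (1 + 2 * B * G); have e10 : 0 < e1 by rewrite divr_gt0.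
have eE : e = e1 + 2 * B * e1 * G by rewrite /e1; field; rewrite gt_eqF.
have [N NH] := IH f e1 Anf e10; have [M MH] := IH g e2 Ag e20.
exists (maxn N M) => i; rewrite geq_max => /andP[/NH[u [Au uf nu]] /MH[v [Av vg nv]]].
have Du := restr Au; have Dv := restr Av.
have hu := AD_holomorphic Du; have hv := AD_holomorphic Dv.
have dsub w w' : AD D mu xi n.+1 w -> AD D mu xi n.+1 w' ->
    derive1n n.+1 (w - w') xi = derive1n n.+1 w xi - derive1n n.+1 w' xi.
  move=> Aw Aw'; rewrite -scaleN1r.
  rewrite (derive1n_add n.+1 oD (AD_holomorphic Aw) (AD_holomorphic (rf_Z (form n.+1) (-1) Aw')) Dxi).
  by rewrite (derive1n_scale n.+1 _ oD (AD_holomorphic Aw') Dxi) mulN1r.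
have vn : 2^-1 <= cabs (derive1n n.+1 v xi).
  have := BH _ (rf_B (form n.+1) Dv Ag); rewrite (dsub _ _ Dv Ag) gn => h.
  have h2 : B * nr (v - g) <= 2^-1.
    by apply: le_trans Be2; rewrite ler_wpM2l.
  have := cabs_tri 1 (derive1n n.+1 v xi) 0; rewrite !subr0 Normc.normc1 cabsBC.
  exact: lower_half_arith h h2.
have un : cabs (derive1n n.+1 u xi) <= B * e1.
  have := BH _ (rf_B (form n.+1) Du Anf); rewrite (dsub _ _ Du Anf) fn0 subr0 => h.
  by apply: (le_trans h); rewrite ler_wpM2l.
have v0 : derive1n n.+1 v xi != 0 by rewrite -cabs_gt0; apply: lt_le_trans vn; rewrite invr_gt0.
pose c := derive1n n.+1 u xi / derive1n n.+1 v xi.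
have cB : cabs c <= 2 * B * e1.
  rewrite cabsM cabsV ler_pdivrMr ?cabs_gt0 //; apply: (le_trans un).
  have B1' : 0 <= B * e1 by rewrite mulr_ge0 // ltW.
  have -> : 2 * B * e1 * cabs (derive1n n.+1 v xi) = (B * e1) * (2 * cabs (derive1n n.+1 v xi)) by ring.
  by apply: ler_peMr => //; rewrite -ler_pdivrMl // mulr1.
have Acv := rf_Z (formi i n.+1) c Av.
have Dcv := rf_Z (form n.+1) c Dv.
have Au' := rf_B (formi i n.+1) Au Acv.
have nv' : nr v <= G := le_trans (nr_le Av) nv.
exists (u - c *: v); split.
- apply: (AD_succ Au'); rewrite (dsub _ _ Du Dcv) (derive1n_scale n.+1 c oD hv Dxi).
  by rewrite /c divfK // subrr.
- rewrite addrAC; apply: le_trans (nrm_B (form n.+1) (rf_B (form n.+1) Du Anf) Dcv) _.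
  rewrite (nrm_Z (form n.+1) c Dv) eE; apply: lerD; first exact: uf.
  by apply: ler_pM; rewrite ?cabs_ge0 ?nrm_ge0.
apply: le_trans (nrm_B (formi i n.+1) Au Acv) _.
rewrite (nrm_Z (formi i n.+1) c Av) eE addrA; apply: lerD; first exact: nu.
by apply: ler_pM; rewrite ?cabs_ge0 ?nrm_ge0.
Qed.

Lemma decreasing_lam_cvg n (e : R) : (0 < n)%N -> 0 < e -> exists N, forall k, (N <= k)%N ->
  lam D mu n xi - lam (Ds k) (mus k) n xi <= e.
Proof.
move=> n0 e0; have [AM KM] := kernelMP oD adm cD Dxi n0.
set M := kernelM D mu n xi in AM KM.
pose s := nr M; have s0 : 0 <= s by exact: nrm_ge0.
have s1 : 0 < 4 * (s + 1) by rewrite mulr_gt0 // ltr_wpDl.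
(* Chosen against the final bound 4 e' s; adding 1 covers s = 0. *)
pose e' := e / (4 * (s + 1)); have e'0 : 0 < e' by rewrite divr_gt0.
have [N NH] := approx n0 AM e'0; exists N => i /NH[u [Au uM nu]].
have [AMi KMi] := kernelMP (@oDs i) (admmus i) (@cDs i) (Dsxi i) n0.
set Mi := kernelM (Ds i) (mus i) n xi in AMi KMi.
have sE : lam D mu n xi = s ^+ 2 by rewrite (nrm_sqr (form n) AM).
have siE : lam (Ds i) (mus i) n xi = (nri i Mi) ^+ 2 by rewrite (nrm_sqr (formi i n) AMi).
have si0 : 0 <= nri i Mi by exact: nrm_ge0.
have sis : nri i Mi <= s.
  rewrite -(@ler_pXn2r _ 2) ?nnegrE // -sE -siE.
  exact (lam_mono oD (@oDs i) adm (admmus i) (@DDs i) (@mu_le i) cD (@cDs i) Dxi n0).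
(* The number E u M = Re u^(n)(xi) is estimated twice: it is near |M|^2 because u is near M, and the
   kernel of D_i bounds it by |u|_i |M_i|_i. *)
have h1 : s ^+ 2 - e' * s <= E u M.
  have Du := restr Au; have A := rf_B (form n) Du AM.
  have := nrm_CS (form n) A AM; rewrite (ip_Bl (form n) Du AM AM) -sE ler_norml => /andP[h _].
  have h' : nr (u - M) * nr M <= e' * s by rewrite ler_wpM2r.
  exact: inner_arith h h'.
have h2 : E u M <= (s + e') * nri i Mi.
  rewrite (KM _ (restr Au)) -(KMi _ Au); apply: le_trans (ler_norm _) _.
  by apply: le_trans (nrm_CS (formi i n) Au AMi) _; rewrite ler_wpM2r.
rewrite sE siE; apply: le_trans (kernel_norm_arith s0 si0 sis e'0 h1 h2) _.
have -> : e = 4 * e' * (s + 1) by rewrite /e'; field; rewrite gt_eqF // ltr_wpDl.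
by apply: ler_wpM2l; rewrite ?lerDl // mulr_ge0 // ltW.
Qed.

Lemma decreasing_kernel_cvg n : (0 < n)%N ->
  cvg_locally_uniformly Ds D (fun i => kernelM (Ds i) (mus i) n xi) (kernelM D mu n xi).
Proof.
move=> n0; apply: locally_uniform_of_local => a Da.
have [r r0 [rD H]] := AD_small oD cD adm Dxi n0 Da.
exists r => // e e0; have [d d0 dH] := H e e0.
have [N NH] := decreasing_lam_cvg n0 d0; exists N => k Nk z /ltW zr.
split; first exact: DDs (rD z zr).
have [AM _] := kernelMP oD adm cD Dxi n0.
have [AMk _] := kernelMP (@oDs k) (admmus k) (@cDs k) (Dsxi k) n0.
have A := rf_B (form n) (restr AMk) AM.
rewrite cabsBC; exact (dH _ A (le_trans (gap k Dxi n0) (NH k Nk)) z zr).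
Qed.

End decreasing.

(** For n = 1 the squared norm of the kernel is the real part of its derivative at t, that is of
    [Ktilde] on the diagonal. *)
Lemma Ktilde_lam_cvg (R : realType) (Ds : nat -> set R[i]) (mus : nat -> R[i] -> R) D mu t :
  (forall i, domain (Ds i)) -> (forall i, admissible (Ds i) (mus i)) -> domain D ->
  admissible D mu -> (forall i, Ds i t) -> D t ->
  Ktilde (Ds i) (mus i) 1 t t @[i --> \oo] --> Ktilde D mu 1 t t ->
  forall e : R, 0 < e -> exists N, forall k, (N <= k)%N ->
    lam D mu 1 t - lam (Ds k) (mus k) 1 t <= e.
Proof.
move=> domDs admDs [_ oD cD] adm Dst Dt H e e0.
have e0C : 0 < e%:C by rewrite ltcR.
have [N _ NH] := (cvgrPdist_le _ _).1 H _ e0C; exists N => k Nk.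
have [_ oDk cDk] := domDs k.
rewrite (lamE oD adm cD Dt (ltn0Sn 0)) (lamE oDk (admDs k) cDk (Dst k) (ltn0Sn 0)) !derive1n1.
have := NH k Nk; rewrite normC_cabs lecR; apply: le_trans.
apply: le_trans (ler_norm _) _; exact: Re_lip.
Qed.

Close Scope complex_scope.
Unset Implicit Arguments.
Set Strict Implicit.

Theorem corollary1p8 (R : realType)
  (Ds : nat -> set R[i]) (mus : nat -> R[i] -> R)
  (domDs : forall i, domain (Ds i))
  (admmus : forall i, admissible (Ds i) (mus i)) :
  (forall (D : set R[i]) (mu : R[i] -> R),
     D = \bigcup_i Ds i ->
     admissible D mu ->
     (forall i, exists j, forall k, (j <= k)%N ->
        Ds i `<=` Ds k /\
        forall z, Ds i z -> mus i z <= mus k z /\ mus k z <= mu z) ->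
     ae_on D (fun z => mus i z @[i --> \oo] --> mu z) ->
     forall (n : nat) (xi : R[i]), (1 <= n)%N -> D xi ->
       cvg_locally_uniformly Ds D
         (fun i => kernelM (Ds i) (mus i) n xi) (kernelM D mu n xi))
  /\
  (forall (D : set R[i]) (mu : R[i] -> R),
     D = \bigcap_i Ds i ->
     domain D ->
     admissible D mu ->
     (forall i z, D z -> mu z <= mus i z) ->
     ae_on D (fun z => mus i z @[i --> \oo] --> mu z) ->
     (forall t, D t ->
        Ktilde (Ds i) (mus i) 1 t t @[i --> \oo] --> Ktilde D mu 1 t t) ->
     (forall xi, D xi ->
        cvg_locally_uniformly Ds D
          (fun i => kernelM (Ds i) (mus i) 1 xi) (kernelM D mu 1 xi)) /\
     (forall (n : nat) (xi : R[i]), (1 < n)%N -> (D `\` Nset D mu) xi ->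
        cvg_locally_uniformly Ds D
          (fun i => kernelM (Ds i) (mus i) n xi) (kernelM D mu n xi))).
Proof.
split=> D mu DE.
  move=> adm /choice[j jP] mus_cvg n xi n1 Dxi.
  have [i0 _ Di0] : (\bigcup_i Ds i) xi by rewrite -DE.
  exact (exhaustion_kernel_cvg domDs admmus DE adm jP mus_cvg n1 Di0).
move=> domD adm mu_le _ Kcvg.
have DDs i : D `<=` Ds i by rewrite DE; exact: bigcap_inf.
have lcvg t : D t -> forall e : R, 0 < e -> exists N, forall k, (N <= k)%N ->
    lam D mu 1 t - lam (Ds k) (mus k) 1 t <= e.
  move=> Dt; exact: (Ktilde_lam_cvg domDs admmus domD adm (fun i => DDs i t Dt) Dt (Kcvg t Dt)).
split=> [xi Dxi|n xi n1 [Dxi _]].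
  exact (decreasing_kernel_cvg domDs admmus domD adm DDs mu_le lcvg Dxi (ltn0Sn 0)).
exact (decreasing_kernel_cvg domDs admmus domD adm DDs mu_le lcvg Dxi (ltnW n1)).
Qed.
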